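(* Consider a problem satisfying the power-law spectral conditions $$\lambda_k=\Lambda k^{-\nu}(1+o(1)),\ k\to\infty,\qquad \sum_{k:\lambda_k<\lambda}\lambda_k(\mathbf e_k^T\mathbf w_* )^2=Q\lambda^\zeta(1+o(1)),\ \lambda\searrow 0,$$ with constants $\Lambda,Q>0$, in the signal-dominated phase, i.e. $\nu>1$, $0<\zeta<2-1/\nu$. Let $\theta_{\max}$ denote the supremum of those $\theta$ for which there exist a corner algorithm and a batch size $|B|\in\{1,2,\dots\}$ such that the corresponding mean losses satisfy $L_t=O(t^{-\theta\zeta})$ as $t\to\infty$. Then $$\theta_{\max}=\min\Big(2,\nu,\frac{2}{\zeta+1/\nu}\Big).$$
   Context: $\mathbf H$ is a strictly positive definite self-adjoint operator on an infinite-dimensional real Hilbert space with discrete spectrum, eigenvalues $\lambda_1\ge\lambda_2\ge\dots>0$, $\lambda_k\searrow0$, $\lambda_{\max}=\lambda_1$, and orthonormal eigenvectors $\mathbf e_k$. The target $\mathbf w_*$ enters only through its real coefficients $\mathbf e_k^T\mathbf w_*$, $k\ge 1$; it need not have finite norm. The constant $\tau_1>0$ is fixed. A corner algorithm is a generalized stationary SGD identified with a corner map. A corner map is a function $\Psi$, holomorphic in $\{\mu\in\mathbb C:|\mu|>1\}$ and commuting with complex conjugation, such that for some exponent $\theta'\in(1,2)$ (corner with external angle $\theta'\pi$) and some $c_\Psi>0$ one has $\Psi(\mu)=-c_\Psi(\mu-1)^{\theta'}(1+o(1))$ as $\mu\to1$ (standard branch of the power, with cut along the negative semi-axis); $\Psi$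 extends continuously to a $C^1$ function on $|\mu|\ge1$; $\Psi(\mu)\to\infty$ as $\mu\to\infty$; $\frac{d}{d\mu}\Psi(\mu)=O(|\mu-1|^{\theta'-1})$ as $\mu\to1$; $\Psi(\{|\mu|=1,\mu\ne1\})\cap[0,\lambda_{\max}]=\varnothing$; and the stability condition $\lambda_k\notin\Psi(\{|\mu|>1\})$ holds for all $k$. Given $\Psi$ and a batch size $|B|$, for $t=1,2,\dots$ define $$U(t,\lambda)=\frac{1}{2\pi i}\oint_{|\mu|=1}\frac{\mu^{t-1}\,d\mu}{\Psi(\mu)-\lambda},\qquad V(t,\lambda)=\frac{1}{2\pi i}\oint_{|\mu|=1}\frac{\mu^{t-1}\Psi(\mu)\,d\mu}{(\Psi(\mu)-\lambda)(\mu-1)},$$ $$U_t=\frac{\tau_1}{|B|}\sum_{k=1}^\infty\lambda_k^2|U(t,\lambda_k)|^2,\qquad V_t=\sum_{k=1}^\infty\lambda_k(\mathbf e_k^T\mathbf w_* )^2|V(t,\lambda_k)|^2,$$ and define the mean losses $L_t$, $t=0,1,2,\dots$, by $$L_t=\frac12\Big(V_{t+1}+\sum_{m=1}^t\ \sum_{0<t_1<\dots<t_m<t+1}U_{t+1-t_m}U_{t_m-t_{m-1}}\cdots U_{t_2-t_1}V_{t_1}\Big).$$ (This expansion is the loss of mini-batch SGD with batch size $|B|$ under the paper's standing assumption, the spectrally-expressible approximation with $\tau_2=0$.) *)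

(* Defs.v *)
(* Stdlib reals with Coquelicot: complex numbers, filters, series, integrals. *)
From Stdlib Require Import Reals List.
From Coquelicot Require Export Coquelicot.
Import ListNotations.

Open Scope R_scope.

Definition is_bigO {T : Type} {Ku Kv : AbsRing} {U : NormedModule Ku}
  {V : NormedModule Kv} (F : (T -> Prop) -> Prop) (f : T -> U) (g : T -> V) :
  Prop :=
  exists M : R, F (fun x => norm (f x) <= M * norm (g x)).

(* Argument in (-PI, PI]; the value at 0 is irrelevant. *)
Definition Carg (z : C) : R :=
  if Rle_dec 0 (Im z) then acos (Re z / Cmod z) else - acos (Re z / Cmod z).

Definition cis (s : R) : C := (cos s, sin s).

(* Standard branch of z^a, with cut along the negative semi-axis; [z <> 0]. *)
Definition Cpower (z : C) (a : R) : C :=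
  (RtoC (Rpower (Cmod z) a) * cis (a * Carg z))%C.

Definition circle_integral (f : C -> C) : C :=
  RInt (V := C_R_CompleteNormedModule)
    (fun s : R => (f (cis s) * (Ci * cis s))%C) 0 (2 * PI).

Record inner_product {E : NormedModule R_AbsRing} (ip : E -> E -> R) : Prop := {
  ip_sym : forall x y, ip x y = ip y x;
  ip_plus : forall x y z, ip (plus x y) z = ip x z + ip y z;
  ip_scal : forall (a : R) x y, ip (scal a x) y = a * ip x y;
  ip_norm : forall x, ip x x = norm x ^ 2
}.

(* Eigenvalues and eigenvectors are indexed from 0: [lam k] and [e k] are the
   (k+1)-st ones, so the largest eigenvalue is [lam 0].  [is_linear] includes
   boundedness.  Discreteness of the spectrum is the completeness of the
   orthonormal system of eigenvectors; as that system is infinite, the space is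
   infinite-dimensional. *)
Record spectral_problem {E : CompleteNormedModule R_AbsRing}
  (ip : E -> E -> R) (H : E -> E) (lam : nat -> R) (e : nat -> E) : Prop := {
  sp_inner : inner_product ip;
  sp_linear : is_linear H;
  sp_self_adjoint : forall x y, ip (H x) y = ip x (H y);
  sp_positive : forall x, x <> zero -> 0 < ip (H x) x;
  sp_eigen : forall k, H (e k) = scal (lam k) (e k);
  sp_orthonormal : forall j k, ip (e j) (e k) = if Nat.eqb j k then 1 else 0;
  sp_complete : forall x, (forall k, ip (e k) x = 0) -> x = zero;
  sp_lam_pos : forall k, 0 < lam k;
  sp_lam_decr : forall k, lam (S k) <= lam k;
  sp_lam_lim : is_lim_seq lam 0
}.

Definition at_corner : (C -> Prop) -> Prop :=
  within (fun mu : C => 1 <= Cmod mu /\ mu <> RtoC 1) (locally (RtoC 1)).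

(* [Psi] stands for the corner map together with its continuous extension to
   [1 <= Cmod mu], and [dPsi] for the continuous extension of its derivative:
   being C^1 on the closed domain means that both extensions exist.  Values
   inside the open unit disk play no role. *)
Record corner_map_with (lam : nat -> R) (Psi dPsi : C -> C) (theta c : R) :
  Prop := {
  cm_theta : 1 < theta < 2;
  cm_c : 0 < c;
  cm_holomorphic : forall mu : C, 1 < Cmod mu ->
    is_derive (K := C_AbsRing) (V := C_NormedModule) Psi mu (dPsi mu);
  cm_conj : forall mu : C, 1 < Cmod mu -> Psi (Cconj mu) = Cconj (Psi mu);
  cm_corner : is_equiv at_corner Psi
    (fun mu : C => (- RtoC c * Cpower (mu - RtoC 1) theta)%C);
  cm_cont : continuous_on (fun mu : C => 1 <= Cmod mu) Psi;
  cm_C1 : continuous_on (fun mu : C => 1 <= Cmod mu) dPsi;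
  cm_infty : forall M : R, exists r : R, forall mu : C,
    1 < Cmod mu -> r < Cmod mu -> M < Cmod (Psi mu);
  cm_deriv_bound : is_bigO at_corner dPsi
    (fun mu : C => Rpower (Cmod (mu - RtoC 1)%C) (theta - 1));
  cm_boundary : forall mu : C, Cmod mu = 1 -> mu <> RtoC 1 ->
    forall x : R, 0 <= x <= lam 0%nat -> Psi mu <> RtoC x;
  cm_stable : forall (k : nat) (mu : C), 1 < Cmod mu -> Psi mu <> RtoC (lam k)
}.

Definition corner_map (lam : nat -> R) (Psi : C -> C) : Prop :=
  exists (theta c : R) (dPsi : C -> C), corner_map_with lam Psi dPsi theta c.

Definition Ucoef (Psi : C -> C) (t : nat) (l : R) : C :=
  (/ (RtoC (2 * PI) * Ci) *
   circle_integral (fun mu => mu ^ (t - 1) / (Psi mu - RtoC l)))%C.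

(* The integrand is 0 at [mu = 1], both by [/ 0 = 0] and by continuity. *)
Definition Vcoef (Psi : C -> C) (t : nat) (l : R) : C :=
  (/ (RtoC (2 * PI) * Ci) *
   circle_integral (fun mu =>
     mu ^ (t - 1) * Psi mu / ((Psi mu - RtoC l) * (mu - RtoC 1))))%C.

Definition Ut (lam : nat -> R) (tau1 : R) (Psi : C -> C) (B t : nat) : R :=
  tau1 / INR B * Series (fun k => lam k ^ 2 * Cmod (Ucoef Psi t (lam k)) ^ 2).

(* [w k] is the coefficient of the target on the eigenvector [e k]. *)
Definition Vt (lam w : nat -> R) (Psi : C -> C) (t : nat) : R :=
  Series (fun k => lam k * w k ^ 2 * Cmod (Vcoef Psi t (lam k)) ^ 2).

Fixpoint sublists {A : Type} (l : list A) : list (list A) :=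
  match l with
  | [] => [[]]
  | x :: l' => map (cons x) (sublists l') ++ sublists l'
  end.

(* All [t_1; ...; t_m] with 0 < t_1 < ... < t_m < t + 1. *)
Definition increasing_tuples (m t : nat) : list (list nat) :=
  filter (fun l => Nat.eqb (length l) m) (sublists (seq 1 t)).

(* [chain U p [t_2; ...; t_m] n = U_{n - t_m} * ... * U_{t_2 - p}]. *)
Fixpoint chain (U : nat -> R) (p : nat) (l : list nat) (n : nat) : R :=
  match l with
  | [] => U (n - p)%nat
  | q :: l' => chain U q l' n * U (q - p)%nat
  end.

Definition path_weight (U V : nat -> R) (l : list nat) (n : nat) : R :=
  match l with
  | [] => V n
  | t1 :: l' => chain U t1 l' n * V t1
  end.

Definition loss (U V : nat -> R) (t : nat) : R :=
  / 2 * (V (t + 1)%nat +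
    sum_n_m (fun m => fold_right Rplus 0
      (map (fun l => path_weight U V l (t + 1)) (increasing_tuples m t))) 1 t).

Definition achievable_rate (lam w : nat -> R) (tau1 zeta theta : R) : Prop :=
  exists (Psi : C -> C) (B : nat), corner_map lam Psi /\ (1 <= B)%nat /\
    is_bigO eventually (loss (Ut lam tau1 Psi B) (Vt lam w Psi))
      (fun t => Rpower (INR t) (- (theta * zeta))).

Definition theta_max (lam w : nat -> R) (tau1 zeta : R) : Rbar :=
  Lub_Rbar (achievable_rate lam w tau1 zeta).

Definition power_law_eigenvalues (lam : nat -> R) (Lambda nu : R) : Prop :=
  is_equiv eventually lam (fun k => Lambda * Rpower (INR (S k)) (- nu)).

(* If the series of [lam k * w k ^ 2] diverges, then [Series] is 0 for every
   positive [x] and the condition fails for Q > 0: convergence is implied. *)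
Definition power_law_target (lam w : nat -> R) (Q zeta : R) : Prop :=
  is_equiv (at_right 0)
    (fun x => Series (fun k =>
       if Rlt_dec (lam k) x then lam k * w k ^ 2 else 0))
    (fun x => Q * Rpower x zeta).

(* Main.v *)
(* Write h = l^(1/theta) for an eigenvalue l and the exponent theta of a corner map.  Near the
   corner |Psi - l| >= c (d + h)^theta, where d = |mu - 1|, so the integrals defining the
   coefficients give, directly or after one integration by parts on the circle, |U(t,l)| <= C h / l,
   |U(t,l)| <= C / (t l) and |V(t,l)| <= C / (t h).  Moving the circle to infinity gives V(1,l) = 1,
   and V(t+1,l) - V(t,l) = l U(t,l), hence |V(t,l) - 1| <= C t h.  Summing over the spectrum,
   V_t is of order t^(-theta zeta) and U_t = O(t^(theta/nu - 2)).  The latter is sharp on average: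
   V(.,l) has to drop from 1 to 1/2 within a time of order 1/h, so the sum of l |U(t,l)| over that
   time is bounded below.

   The loss solves the renewal equation L_t = V_(t+1) / 2 + sum_(s<t) U_(t-s) L_s.  Since
   L_t >= V_(t+1) / 2 and L_t >= U_t V_1 / 2, a rate tht satisfies tht <= theta < 2 and
   tht zeta <= 2 - theta/nu, so tht (zeta + 1/nu) <= 2; if theta > nu, the U_t have infinite sum and
   the loss does not tend to 0.  Conversely, when theta < min(2, nu, 2/(zeta + 1/nu)) the U_t are
   summable and decay at least as fast as the V_t; a large batch makes their sum small, and the loss
   inherits the rate of V_t.  The corner map is then Psi(mu) = - A mu (1 - 1/mu)^theta, A large. *)
Require Import Defs.
From Stdlib Require Import Reals List Lra Lia Psatz.
From Coquelicot Require Import Coquelicot.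
Import ListNotations.
Open Scope R_scope.

(** The corner map is C^1 only up to the circle, and the derivative of the integrand of [Vcoef] may
    blow up at the corner. Integrals are therefore bounded by increments of explicit primitives of
    majorants on open subintervals, so that no improper integral is formed. Writing l = h^theta
    makes d and h lengths of the same kind: the majorants depend on d + h, and theta > 1 makes their
    integrals negative powers of h.

    A lower bound on the noise in the mean over a block of times suffices, because the assumed rate
    t^(-a) is monotone and can be summed over the same block.

    The hypothesis zeta < 2 - 1/nu says exactly that 2/(zeta + 1/nu) > 1, so that admissible
    exponents theta > 1 exist below the minimum. Every such exponent is achieved; the minimum itself
    need not be, and the supremum does not ask for it.

    In the explicit corner map the factor 1 - 1/mu has positive real part outside the disk, which
    keeps its power away from the cut; the factor mu provides the growth at infinity. *)

(** * Modulus and points of the unit circle *)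

Lemma Re_le_Cmod (z : C) : Rabs (fst z) <= Cmod z.
Proof. exact (re_le_Cmod z). Qed.

Lemma Im_le_Cmod (z : C) : Rabs (snd z) <= Cmod z.
Proof. eapply Rle_trans; [apply Rmax_r | apply Rmax_Cmod]. Qed.

Lemma Cmod_le_abs (z : C) : Cmod z <= Rabs (fst z) + Rabs (snd z).
Proof.
  unfold Cmod. pose proof (Rabs_pos (fst z)). pose proof (Rabs_pos (snd z)).
  rewrite <- (sqrt_Rsqr (Rabs (fst z) + Rabs (snd z))) by lra.
  apply sqrt_le_1_alt. rewrite <- (pow2_abs (fst z)), <- (pow2_abs (snd z)).
  unfold Rsqr. nra.
Qed.

Lemma C_ext (x y : C) : fst x = fst y -> snd x = snd y -> x = y.
Proof. destruct x, y; simpl; congruence. Qed.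

Lemma Cmod_cis (s : R) : Cmod (cis s) = 1.
Proof.
  unfold Cmod, cis; cbn [fst snd]. pose proof (sin2_cos2 s) as H. unfold Rsqr in H.
  replace (cos s ^ 2 + sin s ^ 2) with 1 by lra. apply sqrt_1.
Qed.

Lemma cis_plus (s t : R) : cis (s + t) = (cis s * cis t)%C.
Proof. apply C_ext; simpl; [rewrite cos_plus | rewrite sin_plus]; lra. Qed.

Lemma cis_0 : cis 0 = RtoC 1.
Proof. unfold cis. now rewrite cos_0, sin_0. Qed.

Lemma cis_2PI : cis (2 * PI) = RtoC 1.
Proof. unfold cis. now rewrite cos_2PI, sin_2PI. Qed.

Lemma cis_pow (n : nat) (s : R) : (cis s ^ n)%C = cis (INR n * s).
Proof.
  induction n as [|n IH].
  - simpl. now rewrite Rmult_0_l, cis_0.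
  - rewrite S_INR. replace ((INR n + 1) * s) with (s + INR n * s) by ring.
    rewrite cis_plus, <- IH. reflexivity.
Qed.

Lemma Cmod_scal_cis (r s : R) : 0 <= r -> Cmod (RtoC r * cis s) = r.
Proof. intros. rewrite Cmod_mult, Cmod_R, Cmod_cis, Rabs_pos_eq; lra. Qed.

Lemma Cmod_minus_ge (x y : C) : Cmod x - Cmod y <= Cmod (x - y).
Proof.
  pose proof (Cmod_triangle (x - y) y).
  replace (x - y + y)%C with x in H by ring. lra.
Qed.

Lemma Cmod_sub_sym (x y : C) : Cmod (x - y) = Cmod (y - x).
Proof. rewrite <- Cmod_opp. f_equal. ring. Qed.

Lemma Cmod_sq (z : C) : Cmod z ^ 2 = fst z ^ 2 + snd z ^ 2.
Proof. exact (Cmod2_alt z). Qed.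

Lemma Cmod_cis_minus_1 (s : R) : Cmod (cis s - 1) = 2 * Rabs (sin (s / 2)).
Proof.
  apply Rsqr_inj; [apply Cmod_ge_0 | pose proof (Rabs_pos (sin (s / 2))); lra |].
  rewrite Rsqr_mult, <- Rsqr_abs. unfold Rsqr.
  replace (Cmod (cis s - 1) * Cmod (cis s - 1)) with (Cmod (cis s - 1) ^ 2) by ring.
  rewrite Cmod_sq. simpl.
  replace s with (2 * (s / 2)) at 1 2 3 4 by field.
  rewrite cos_2a, sin_2a. pose proof (sin2_cos2 (s / 2)) as H. unfold Rsqr in H.
  set (a := sin (s / 2)) in *. set (b := cos (s / 2)) in *. clearbody a b.
  replace (b * b) with (1 - a * a) by lra. ring_simplify.
  replace (b ^ 2) with (1 - a ^ 2) by lra. ring.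
Qed.

(** * Continuity and derivatives of complex-valued functions *)

Lemma continuous_C_pair {T : UniformSpace} (f : T -> C) (x : T) :
  continuous (fun y => fst (f y)) x -> continuous (fun y => snd (f y)) x ->
  continuous (T := T) (U := C_UniformSpace) f x.
Proof.
  intros H1 H2. intros P [eps HP].
  assert (E1 := H1 _ (locally_ball _ eps)). assert (E2 := H2 _ (locally_ball _ eps)).
  unfold filtermap in *.
  generalize (filter_and _ _ E1 E2). apply filter_imp. intros y [A B].
  apply HP. split; assumption.
Qed.

Lemma continuous_C_fst {T : UniformSpace} (f : T -> C) (x : T) :
  continuous (T := T) (U := C_UniformSpace) f x -> continuous (fun y => fst (f y)) x.
Proof.
  intros H. apply (continuous_comp f (fun z : C => fst z) x H).
  destruct (f x). apply (@continuous_fst R_UniformSpace R_UniformSpace).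
Qed.

Lemma continuous_C_snd {T : UniformSpace} (f : T -> C) (x : T) :
  continuous (T := T) (U := C_UniformSpace) f x -> continuous (fun y => snd (f y)) x.
Proof.
  intros H. apply (continuous_comp f (fun z : C => snd z) x H).
  destruct (f x). apply (@continuous_snd R_UniformSpace R_UniformSpace).
Qed.

Lemma continuous_Cplus {T : UniformSpace} (f g : T -> C) (x : T) :
  continuous (U := C_UniformSpace) f x -> continuous (U := C_UniformSpace) g x ->
  continuous (U := C_UniformSpace) (fun y => (f y + g y)%C) x.
Proof.
  intros Hf Hg. apply continuous_C_pair; simpl.
  - apply (continuous_plus (V := R_NormedModule)); now apply continuous_C_fst.
  - apply (continuous_plus (V := R_NormedModule)); now apply continuous_C_snd.
Qed.

Lemma continuous_Copp {T : UniformSpace} (f : T -> C) (x : T) :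
  continuous (U := C_UniformSpace) f x ->
  continuous (U := C_UniformSpace) (fun y => (- f y)%C) x.
Proof.
  intros Hf. apply continuous_C_pair; simpl.
  - apply (continuous_opp (V := R_NormedModule)); now apply continuous_C_fst.
  - apply (continuous_opp (V := R_NormedModule)); now apply continuous_C_snd.
Qed.

Lemma continuous_Cminus {T : UniformSpace} (f g : T -> C) (x : T) :
  continuous (U := C_UniformSpace) f x -> continuous (U := C_UniformSpace) g x ->
  continuous (U := C_UniformSpace) (fun y => (f y - g y)%C) x.
Proof. intros. apply continuous_Cplus; [|apply continuous_Copp]; assumption. Qed.

Lemma continuous_Cmult {T : UniformSpace} (f g : T -> C) (x : T) :
  continuous (U := C_UniformSpace) f x -> continuous (U := C_UniformSpace) g x ->
  continuous (U := C_UniformSpace) (fun y => (f y * g y)%C) x.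
Proof.
  intros Hf Hg.
  pose proof (continuous_C_fst _ _ Hf). pose proof (continuous_C_snd _ _ Hf).
  pose proof (continuous_C_fst _ _ Hg). pose proof (continuous_C_snd _ _ Hg).
  apply continuous_C_pair; simpl.
  - apply (continuous_minus (V := R_NormedModule));
      apply (continuous_mult (K := R_AbsRing)); assumption.
  - apply (continuous_plus (V := R_NormedModule));
      apply (continuous_mult (K := R_AbsRing)); assumption.
Qed.

Lemma C_neq_0_sq (z : C) : z <> RtoC 0 -> fst z ^ 2 + snd z ^ 2 <> 0.
Proof.
  intros H E. apply H. pose proof (pow2_ge_0 (fst z)). pose proof (pow2_ge_0 (snd z)).
  apply C_ext; simpl; nra.
Qed.

Lemma continuous_Cinv {T : UniformSpace} (f : T -> C) (x : T) :
  f x <> RtoC 0 -> continuous (U := C_UniformSpace) f x ->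
  continuous (U := C_UniformSpace) (fun y => (/ f y)%C) x.
Proof.
  intros H0 Hf.
  pose proof (continuous_C_fst _ _ Hf) as H1. pose proof (continuous_C_snd _ _ Hf) as H2.
  assert (Hd : continuous (fun y => / (fst (f y) ^ 2 + snd (f y) ^ 2)) x).
  { apply (continuous_comp (fun y => fst (f y) ^ 2 + snd (f y) ^ 2) Rinv).
    - apply (continuous_ext (fun y => plus (mult (fst (f y)) (fst (f y)))
        (mult (snd (f y)) (snd (f y))))).
      { intros y. unfold plus, mult; simpl. unfold mult; simpl. ring. }
      apply (continuous_plus (V := R_NormedModule));
        apply (continuous_mult (K := R_AbsRing)); assumption.
    - apply continuous_Rinv. now apply C_neq_0_sq. }
  apply continuous_C_pair; simpl.
  - apply (continuous_mult (K := R_AbsRing) (fun y => fst (f y))); assumption.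
  - apply (continuous_mult (K := R_AbsRing) (fun y => - snd (f y))); [|assumption].
    now apply (continuous_opp (V := R_NormedModule)).
Qed.

Lemma continuous_Cdiv {T : UniformSpace} (f g : T -> C) (x : T) :
  g x <> RtoC 0 -> continuous (U := C_UniformSpace) f x ->
  continuous (U := C_UniformSpace) g x ->
  continuous (U := C_UniformSpace) (fun y => (f y / g y)%C) x.
Proof. intros. apply continuous_Cmult; [|apply continuous_Cinv]; assumption. Qed.

Lemma continuous_RtoC {T : UniformSpace} (f : T -> R) (x : T) :
  continuous f x -> continuous (U := C_UniformSpace) (fun y => RtoC (f y)) x.
Proof. intros. apply continuous_C_pair; simpl; [assumption | apply continuous_const]. Qed.

Lemma continuous_cis {T : UniformSpace} (f : T -> R) (x : T) :
  continuous f x -> continuous (U := C_UniformSpace) (fun y => cis (f y)) x.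
Proof.
  intros. apply continuous_C_pair; simpl.
  - apply (continuous_comp f cos); [assumption | apply continuous_cos].
  - apply (continuous_comp f sin); [assumption | apply continuous_sin].
Qed.

(** The uniform structure of [C] is that of a product, with square balls. Comparing squares with
    discs allows all later epsilon arguments to be run with the modulus. *)
Lemma locally_Cmod (z : C) (P : C -> Prop) :
  locally (T := C_UniformSpace) z P <->
  exists d : R, 0 < d /\ forall y : C, Cmod (y - z) < d -> P y.
Proof.
  split.
  - intros [e He]. exists e. split; [apply e|]. intros y Hy. apply He.
    split; (eapply Rle_lt_trans; [|exact Hy]).
    + exact (Re_le_Cmod (y - z)).
    + exact (Im_le_Cmod (y - z)).
  - intros [d [Hd H]]. assert (Hd' : 0 < d / 2) by lra. exists (mkposreal _ Hd').
    intros y [H1 H2]. apply H. eapply Rle_lt_trans; [apply Cmod_le_abs|].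
    assert (A : Rabs (fst (y - z)%C) < d / 2) by exact H1.
    assert (B : Rabs (snd (y - z)%C) < d / 2) by exact H2. lra.
Qed.

Lemma continuous_Cmod_eps {T : UniformSpace} (f : T -> C) (x : T) :
  continuous (U := C_UniformSpace) f x <->
  forall eps : R, 0 < eps -> locally x (fun y => Cmod (f y - f x) < eps).
Proof.
  split.
  - intros H eps He. apply (H (fun z => Cmod (z - f x) < eps)).
    apply locally_Cmod. now exists eps.
  - intros H P HP. apply locally_Cmod in HP. destruct HP as [d [Hd HP]].
    unfold filtermap. generalize (H d Hd). apply filter_imp. auto.
Qed.

(** The general notion quantifies over the limit points of the filter; for [locally x] uniqueness of
    limits leaves only x itself. *)
Lemma is_derive_eps {K : AbsRing} {V : NormedModule K} (f : K -> V) (x : K) (l : V) :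
  is_derive f x l <-> forall eps : posreal, locally x (fun y =>
    norm (minus (minus (f y) (f x)) (scal (minus y x) l)) <= eps * norm (minus y x)).
Proof.
  split.
  - intros [_ H] eps. exact (H x (fun P HP => HP) eps).
  - intros H. split; [apply is_linear_scal_l|].
    intros y Hy eps. rewrite <- (is_filter_lim_locally_unique _ _ Hy). apply H.
Qed.

(** [C] carries two structures: curves are differentiated over the reals in [C_R_NormedModule],
    holomorphic maps over [C_AbsRing] in [C_NormedModule]. *)
Notation is_derive_curve := (is_derive (K := R_AbsRing) (V := C_R_NormedModule)).

Lemma norm_C_R (z : C) : norm (V := C_R_NormedModule) z = Cmod z.
Proof.
  change (sqrt (Rabs (fst z) ^ 2 + Rabs (snd z) ^ 2) = Cmod z).
  now rewrite !pow2_abs.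
Qed.

Lemma is_derive_curve_eps (f : R -> C) (s : R) (l : C) :
  is_derive_curve f s l <-> forall eps : R, 0 < eps -> locally s (fun t =>
    Cmod (f t - f s - RtoC (t - s) * l) <= eps * Rabs (t - s)).
Proof.
  assert (E : forall t : R, scal (V := C_R_NormedModule) (minus t s) l =
    (RtoC (t - s) * l)%C).
  { intros t. apply C_ext; simpl; unfold scal; simpl; unfold mult, minus, plus, opp; simpl; ring. }
  rewrite is_derive_eps. split.
  - intros H eps He. generalize (H (mkposreal eps He)). apply filter_imp. intros t Ht.
    rewrite E, norm_C_R in Ht. exact Ht.
  - intros H eps. generalize (H eps (cond_pos eps)). apply filter_imp. intros t Ht.
    rewrite E, norm_C_R. exact Ht.
Qed.

Lemma is_derive_R_eps (f : R -> R) (s l : R) :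
  is_derive f s l <-> forall eps : R, 0 < eps -> locally s (fun t =>
    Rabs (f t - f s - (t - s) * l) <= eps * Rabs (t - s)).
Proof.
  rewrite is_derive_eps. split.
  - intros H eps He. exact (H (mkposreal eps He)).
  - intros H eps. exact (H eps (cond_pos eps)).
Qed.

Lemma is_derive_curve_iff (f : R -> C) (s : R) (l : C) :
  is_derive_curve f s l <->
  is_derive (fun t => fst (f t)) s (fst l) /\ is_derive (fun t => snd (f t)) s (snd l).
Proof.
  rewrite is_derive_curve_eps, !is_derive_R_eps. split.
  - intros H. split; intros eps He; generalize (H eps He); apply filter_imp; intros t Ht;
      (eapply Rle_trans; [|exact Ht]).
    + eapply Rle_trans; [|apply Re_le_Cmod]. right. f_equal. simpl. ring.
    + eapply Rle_trans; [|apply Im_le_Cmod]. right. f_equal. simpl. ring.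
  - intros [H1 H2] eps He. assert (He' : 0 < eps / 2) by lra.
    generalize (filter_and _ _ (H1 _ He') (H2 _ He')). apply filter_imp. intros t [A B].
    eapply Rle_trans; [apply Cmod_le_abs|].
    replace (fst (f t - f s - RtoC (t - s) * l)%C) with (fst (f t) - fst (f s) - (t - s) * fst l)
      by (simpl; ring).
    replace (snd (f t - f s - RtoC (t - s) * l)%C) with (snd (f t) - snd (f s) - (t - s) * snd l)
      by (simpl; ring). lra.
Qed.

Lemma is_derive_curve_minus (f g : R -> C) (s : R) (df dg : C) :
  is_derive_curve f s df -> is_derive_curve g s dg ->
  is_derive_curve (fun t => (f t - g t)%C) s (df - dg)%C.
Proof. intros. now apply (is_derive_minus (V := C_R_NormedModule) f g). Qed.

Lemma is_derive_curve_const (a : C) (s : R) : is_derive_curve (fun _ => a) s (RtoC 0).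
Proof. exact (is_derive_const (V := C_R_NormedModule) a s). Qed.

Lemma is_derive_curve_mult (f g : R -> C) (s : R) (df dg : C) :
  is_derive_curve f s df -> is_derive_curve g s dg ->
  is_derive_curve (fun t => (f t * g t)%C) s (df * g s + f s * dg)%C.
Proof.
  rewrite !is_derive_curve_iff. intros [F1 F2] [G1 G2]. split.
  - evar_last.
    + apply (is_derive_minus (V := R_NormedModule) (fun t => fst (f t) * fst (g t))
        (fun t => snd (f t) * snd (g t))).
      * apply (is_derive_mult (K := R_AbsRing)); [apply F1 | apply G1 | intros; apply Rmult_comm].
      * apply (is_derive_mult (K := R_AbsRing)); [apply F2 | apply G2 | intros; apply Rmult_comm].
    + unfold minus, plus, opp, mult; simpl. ring.
  - evar_last.
    + apply (is_derive_plus (V := R_NormedModule) (fun t => fst (f t) * snd (g t))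
        (fun t => snd (f t) * fst (g t))).
      * apply (is_derive_mult (K := R_AbsRing)); [apply F1 | apply G2 | intros; apply Rmult_comm].
      * apply (is_derive_mult (K := R_AbsRing)); [apply F2 | apply G1 | intros; apply Rmult_comm].
    + unfold minus, plus, opp, mult; simpl. ring.
Qed.

Lemma is_derive_div_sq (x y z : R -> R) (s a b c : R) :
  is_derive x s a -> is_derive y s b -> is_derive z s c -> x s ^ 2 + y s ^ 2 <> 0 ->
  is_derive (fun t => z t / (x t ^ 2 + y t ^ 2)) s
    ((c * (x s ^ 2 + y s ^ 2) - z s * (2 * a * x s + 2 * b * y s)) / (x s ^ 2 + y s ^ 2) ^ 2).
Proof.
  intros Hx Hy Hz H0.
  assert (E1 : ex_derive x s) by (eexists; exact Hx).
  assert (E2 : ex_derive y s) by (eexists; exact Hy).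
  assert (E3 : ex_derive z s) by (eexists; exact Hz).
  auto_derive; [repeat split; auto|].
  change (Derive (fun t => x t) s) with (Derive x s).
  change (Derive (fun t => y t) s) with (Derive y s).
  change (Derive (fun t => z t) s) with (Derive z s).
  rewrite (is_derive_unique _ _ _ Hx), (is_derive_unique _ _ _ Hy), (is_derive_unique _ _ _ Hz).
  field. exact H0.
Qed.

Lemma is_derive_curve_inv (f : R -> C) (s : R) (df : C) :
  f s <> RtoC 0 -> is_derive_curve f s df ->
  is_derive_curve (fun t => (/ f t)%C) s (- df / (f s * f s))%C.
Proof.
  intros H0 F. pose proof (C_neq_0_sq _ H0) as P.
  replace (- df / (f s * f s))%C with (- df * (/ f s * / f s))%C by (field; exact H0).
  apply is_derive_curve_iff in F. destruct F as [F1 F2].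
  apply is_derive_curve_iff. split.
  - evar_last; [apply (is_derive_div_sq (fun t => fst (f t)) (fun t => snd (f t))
      (fun t => fst (f t)) s _ _ _ F1 F2 F1 P)|]. simpl in *. field. lra.
  - evar_last; [apply (is_derive_div_sq (fun t => fst (f t)) (fun t => snd (f t))
      (fun t => - snd (f t)) s _ _ (- snd df) F1 F2); [|exact P]|].
    + apply (is_derive_opp (fun t => snd (f t)) s _ F2).
    + simpl in *. field. lra.
Qed.

Lemma is_derive_curve_cis (s : R) : is_derive_curve cis s (Ci * cis s)%C.
Proof.
  apply is_derive_curve_iff. split; simpl; auto_derive; auto; ring.
Qed.

Lemma is_derive_C_eps (F : C -> C) (z l : C) :
  is_derive (K := C_AbsRing) (V := C_NormedModule) F z l <->
  forall eps : R, 0 < eps -> exists d : R, 0 < d /\ forall w : C, Cmod (w - z) < d ->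
    Cmod (F w - F z - (w - z) * l) <= eps * Cmod (w - z).
Proof.
  rewrite is_derive_eps. split.
  - intros H eps He. specialize (H (mkposreal eps He)). apply locally_C in H.
    apply locally_Cmod in H. exact H.
  - intros H eps. apply locally_C. apply locally_Cmod. exact (H eps (cond_pos eps)).
Qed.

(** The outer derivative is complex and the inner one real, so the two remainders are combined
    directly. The remainder of F takes half of eps through |g t - g s| <= G |t - s|, the remainder
    of g the other half through L >= |l|. *)
Lemma is_derive_curve_comp (F : C -> C) (g : R -> C) (s : R) (l dg : C) :
  is_derive (K := C_AbsRing) (V := C_NormedModule) F (g s) l ->
  is_derive_curve g s dg -> is_derive_curve (fun t => F (g t)) s (dg * l)%C.
Proof.
  rewrite is_derive_C_eps, !is_derive_curve_eps. intros HF Hg eps He.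
  set (G := Cmod dg + 1). set (L := Cmod l + 1).
  assert (G0 : 0 < G) by (unfold G; pose proof (Cmod_ge_0 dg); lra).
  assert (L0 : 0 < L) by (unfold L; pose proof (Cmod_ge_0 l); lra).
  assert (He1 : 0 < eps / 2 / G) by (apply Rdiv_lt_0_compat; lra).
  assert (He2 : 0 < Rmin 1 (eps / 2 / L)).
  { apply Rmin_pos; [lra|]. apply Rdiv_lt_0_compat; lra. }
  destruct (HF _ He1) as [d [Hd HF']].
  assert (Hd' : 0 < d / G) by (apply Rdiv_lt_0_compat; lra).
  generalize (filter_and _ _ (Hg _ He2) (locally_ball s (mkposreal _ Hd'))).
  apply filter_imp. intros t [A B].
  assert (B' : Rabs (t - s) < d / G) by exact B. clear B.
  set (e := (g t - g s - RtoC (t - s) * dg)%C) in *.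
  assert (Q : Cmod (g t - g s) <= G * Rabs (t - s)).
  { replace (g t - g s)%C with (e + RtoC (t - s) * dg)%C by (unfold e; ring).
    eapply Rle_trans; [apply Cmod_triangle|]. rewrite Cmod_mult, Cmod_R.
    pose proof (Rmin_l 1 (eps / 2 / L)). pose proof (Rabs_pos (t - s)). unfold G. nra. }
  assert (Q' : Cmod (g t - g s) < d).
  { eapply Rle_lt_trans; [exact Q|]. apply Rlt_le_trans with (G * (d / G)).
    - now apply Rmult_lt_compat_l.
    - right. field. lra. }
  specialize (HF' _ Q').
  replace (F (g t) - F (g s) - RtoC (t - s) * (dg * l))%C with
    ((F (g t) - F (g s) - (g t - g s) * l) + e * l)%C by (unfold e; ring).
  eapply Rle_trans; [apply Cmod_triangle|]. rewrite Cmod_mult.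
  assert (X1 : eps / 2 / G * Cmod (g t - g s) <= eps / 2 * Rabs (t - s)).
  { apply Rle_trans with (eps / 2 / G * (G * Rabs (t - s))).
    - apply Rmult_le_compat_l; lra.
    - right. field. lra. }
  assert (X2 : Cmod e * Cmod l <= eps / 2 * Rabs (t - s)).
  { apply Rle_trans with ((eps / 2 / L * Rabs (t - s)) * L).
    - apply Rmult_le_compat; try apply Cmod_ge_0.
      + eapply Rle_trans; [exact A|]. apply Rmult_le_compat_r; [apply Rabs_pos | apply Rmin_r].
      + unfold L. lra.
    - right. field. lra. }
  lra.
Qed.

(** The real mean value inequality is applied to both components; the factor 2 is the price, and it
    is harmless throughout. *)
Lemma curve_increment_le (f df : R -> C) (D a b : R) :
  (forall t, Rabs (t - a) <= Rabs (b - a) -> is_derive_curve f t (df t) /\ Cmod (df t) <= D) ->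
  Cmod (f b - f a) <= 2 * (D * Rabs (b - a)).
Proof.
  intros H. eapply Rle_trans; [apply Cmod_le_abs|].
  assert (H1 : Rabs (fst (f b) - fst (f a)) <= D * Rabs (b - a)).
  { apply (bounded_variation (fun t => fst (f t)) (fun t => fst (df t))). intros t Ht.
    destruct (H t Ht) as [A B]. apply is_derive_curve_iff in A. split; [apply A|].
    eapply Rle_trans; [apply Re_le_Cmod | exact B]. }
  assert (H2 : Rabs (snd (f b) - snd (f a)) <= D * Rabs (b - a)).
  { apply (bounded_variation (fun t => snd (f t)) (fun t => snd (df t))). intros t Ht.
    destruct (H t Ht) as [A B]. apply is_derive_curve_iff in A. split; [apply A|].
    eapply Rle_trans; [apply Im_le_Cmod | exact B]. }
  replace (fst (f b - f a)%C) with (fst (f b) - fst (f a)) by (simpl; ring).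
  replace (snd (f b - f a)%C) with (snd (f b) - snd (f a)) by (simpl; ring). lra.
Qed.

(** * Circle means outside the unit disk *)

Lemma continuity_2d_pt_snd (f : R -> R -> R) (x y : R) :
  continuity_2d_pt f x y -> continuous (f x) y.
Proof.
  intros H. apply continuity_2d_pt_filterlim in H.
  apply (continuous_comp_2 (fun _ : R => x) (fun t : R => t) f y).
  - apply continuous_const.
  - apply continuous_id.
  - exact H.
Qed.

Lemma eq_of_Rabs_le (x y : R) : (forall eps, 0 < eps -> Rabs (x - y) <= eps) -> x = y.
Proof.
  intros H. destruct (Req_dec x y) as [E|E]; [exact E|].
  assert (P : 0 < Rabs (x - y)) by (apply Rabs_pos_lt; lra).
  specialize (H (Rabs (x - y) / 2)). lra.
Qed.

Lemma Rabs_RInt_sub_le (f g : R -> R) (a b e : R) :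
  a <= b -> ex_RInt f a b -> ex_RInt g a b ->
  (forall x, a <= x <= b -> Rabs (f x - g x) <= e) ->
  Rabs (RInt f a b - RInt g a b) <= (b - a) * e.
Proof.
  intros Hab Hf Hg H.
  apply (norm_RInt_le_const (V := R_NormedModule) (fun x => minus (f x) (g x)) a b _ e Hab H).
  apply (is_RInt_minus (V := R_NormedModule)); apply (RInt_correct (V := R_CompleteNormedModule));
    assumption.
Qed.

(* [u] and [v] stand for the real and imaginary parts, in polar coordinates, of
   a function that is holomorphic outside the unit disk: the angular derivative
   of [v] is [r] times the radial derivative of [u] (Cauchy-Riemann), so circle
   means of [u] do not depend on the radius. *)
Lemma polar_mean (u v p : R -> R -> R) (l : R) :
  (forall r s, 1 < r -> is_derive (fun x => u x s) r (p r s)) ->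
  (forall r s, 1 < r -> is_derive (fun x => v r x) s (r * p r s)) ->
  (forall r, 1 < r -> v r 0 = v r (2 * PI)) ->
  (forall r s, 1 < r -> continuity_2d_pt p r s) ->
  (forall s, continuity_2d_pt (fun x y => u (Rmax 1 x) y) 1 s) ->
  (forall r s, 1 < r -> continuous (u r) s) ->
  (forall eps, 0 < eps -> exists R0, forall r s, R0 < r -> Rabs (u r s - l) <= eps) ->
  is_RInt (u 1) 0 (2 * PI) (2 * PI * l).
Proof.
  intros H1 H2 H3 H4 H5 H6 H7. pose proof PI_RGT_0 as HPI.
  set (J := fun r => RInt (u r) 0 (2 * PI)).
  assert (I1 : ex_RInt (u 1) 0 (2 * PI)).
  { apply (ex_RInt_continuous (V := R_CompleteNormedModule)). intros z _.
    apply (continuous_ext (fun y => u (Rmax 1 1) y)).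
    - intros y. now rewrite Rmax_left by lra.
    - now apply (continuity_2d_pt_snd (fun x y => u (Rmax 1 x) y)). }
  assert (Ir : forall r, 1 < r -> ex_RInt (u r) 0 (2 * PI)).
  { intros r Hr. apply (ex_RInt_continuous (V := R_CompleteNormedModule)). intros z _. auto. }
  assert (dJ : forall r, 1 < r -> is_derive J r 0).
  { intros r Hr.
    assert (L : locally (T := R_UniformSpace) r (fun x => 1 < x)) by (apply (open_gt 1); exact Hr).
    evar_last.
    - apply (is_derive_RInt_param u 0 (2 * PI) r).
      + generalize L. apply filter_imp. intros x Hx t _. eexists. now apply H1.
      + intros t _. apply continuity_2d_pt_ext_loc with (f := p); [|now apply H4].
        assert (Hr' : 0 < r - 1) by lra. exists (mkposreal _ Hr'). intros x y Hx _.
        simpl in Hx. apply Rabs_lt_between in Hx.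
        symmetry. apply is_derive_unique, H1. lra.
      + generalize L. apply filter_imp. auto.
    - rewrite (RInt_ext _ (p r)).
      2:{ intros x _. now apply is_derive_unique, H1. }
      (* The derivative of J at r is the integral of [p r], that is 1/r times the change of [v r]
         over a full period, hence 0. *)
      assert (E : is_RInt (fun s => r * p r s) 0 (2 * PI) (minus (v r (2 * PI)) (v r 0))).
      { apply (is_RInt_derive (V := R_CompleteNormedModule)).
        - intros x _. now apply H2.
        - intros x _. apply (continuous_mult (K := R_AbsRing)); [apply continuous_const|].
          now apply continuity_2d_pt_snd, H4. }
      apply (is_RInt_scal (V := R_NormedModule) _ _ _ (/ r)) in E.
      apply (is_RInt_ext _ (p r)) in E.
      2:{ intros x _. unfold scal; simpl; unfold mult; simpl. field. lra. }
      rewrite (is_RInt_unique _ _ _ _ E), (H3 r Hr).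
      unfold scal, minus, plus, opp; simpl; unfold mult; simpl. ring. }
  assert (Jc : forall r r', 1 < r < r' -> J r = J r').
  { intros r r' Hr. apply eq_is_derive; [|lra]. intros t Ht. apply dJ. lra. }
  assert (E : J 1 = 2 * PI * l).
  { apply eq_of_Rabs_le. intros eps He.
    assert (He' : 0 < eps / (4 * PI)) by (apply Rdiv_lt_0_compat; lra).
    destruct (H7 _ He') as [R0 HR].
    (* J is constant on (1, oo). It is compared with [J 1] at a radius r near 1, by uniform
       continuity up to the boundary circle, and with the limit at a large radius r'. *)
    destruct (uniform_continuity_2d_1d' (fun x y => u (Rmax 1 x) y) 0 (2 * PI) 1
      (fun x _ => H5 x) (mkposreal _ He')) as [d Hd].
    pose proof (cond_pos d) as Hd0. simpl in Hd.
    set (r := 1 + d / 2). set (r' := Rmax (r + 1) (R0 + 1)).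
    assert (Hr' : r < r' /\ R0 < r') by (unfold r', Rmax; destruct Rle_dec; lra).
    assert (A : Rabs (J 1 - J r) <= (2 * PI - 0) * (eps / (4 * PI))).
    { apply Rabs_RInt_sub_le; [lra | exact I1 | apply Ir; unfold r; lra |].
      intros x Hx. rewrite Rabs_minus_sym. left.
      specialize (Hd x 1 x r Hx ltac:(lra) Hx ltac:(unfold r; lra)
        ltac:(rewrite Rminus_diag, Rabs_R0; exact Hd0)).
      rewrite !Rmax_right in Hd by (unfold r; lra). exact Hd. }
    assert (B : Rabs (J r' - RInt (fun _ => l) 0 (2 * PI)) <= (2 * PI - 0) * (eps / (4 * PI))).
    { apply Rabs_RInt_sub_le; [lra | apply Ir; unfold r in *; lra | apply ex_RInt_const |].
      intros x _. now apply HR. }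
    rewrite RInt_const in B. unfold scal in B; simpl in B; unfold mult in B; simpl in B.
    rewrite <- (Jc r r') in B by (unfold r in *; lra).
    replace (J 1 - 2 * PI * l) with ((J 1 - J r) + (J r - (2 * PI - 0) * l)) by ring.
    eapply Rle_trans; [apply Rabs_triang|].
    replace ((2 * PI - 0) * (eps / (4 * PI))) with (eps / 2) in * by (field; lra). lra. }
  rewrite <- E. now apply (RInt_correct (V := R_CompleteNormedModule)).
Qed.

Lemma continuity_2d_pt_fst_C (f : R * R -> C) (x y : R) :
  continuous (U := C_UniformSpace) f (x, y) ->
  continuity_2d_pt (fun a b => fst (f (a, b))) x y.
Proof.
  intros H. apply continuity_2d_pt_filterlim.
  apply filterlim_ext with (f := fun z => fst (f z)); [now intros []|].
  exact (continuous_C_fst _ _ H).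
Qed.

Lemma continuity_2d_pt_snd_C (f : R * R -> C) (x y : R) :
  continuous (U := C_UniformSpace) f (x, y) ->
  continuity_2d_pt (fun a b => snd (f (a, b))) x y.
Proof.
  intros H. apply continuity_2d_pt_filterlim.
  apply filterlim_ext with (f := fun z => snd (f z)); [now intros []|].
  exact (continuous_C_snd _ _ H).
Qed.

(** [a r s] is the radial derivative of F, and the second hypothesis is the Cauchy-Riemann equation
    in polar form. The circle mean then equals the value 1 of F at infinity; continuity up to radius
    1 suffices on the circle itself. *)
Lemma exterior_mean (F : C -> C) (a : R -> R -> C) :
  (forall r s, 1 < r -> is_derive_curve (fun x => F (RtoC x * cis s)%C) r (a r s)) ->
  (forall r s, 1 < r -> is_derive_curve (fun x => F (RtoC r * cis x)%C) s
     (Ci * RtoC r * a r s)%C) ->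
  (forall r s, 1 < r ->
     continuous (U := C_UniformSpace) (fun z : R * R => a (fst z) (snd z)) (r, s)) ->
  (forall s, continuous (U := C_UniformSpace)
     (fun z : R * R => F (RtoC (Rmax 1 (fst z)) * cis (snd z))%C) (1, s)) ->
  (forall eps, 0 < eps -> exists R0, forall z, R0 < Cmod z -> Cmod (F z - 1) <= eps) ->
  is_RInt (V := C_R_NormedModule) (fun s => F (cis s)) 0 (2 * PI) (RtoC (2 * PI)).
Proof.
  intros Hr Hs Ha Hb Hinf.
  assert (Hper : forall r, F (RtoC r * cis 0)%C = F (RtoC r * cis (2 * PI))%C).
  { intros r. now rewrite cis_0, cis_2PI. }
  assert (Hc : forall r s, 1 < r ->
    continuous (U := C_UniformSpace) (fun x => F (RtoC r * cis x)%C) s).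
  { intros r s Hr1. apply continuous_C_pair; apply (ex_derive_continuous (V := R_NormedModule));
      pose proof (Hs r s Hr1) as D; apply is_derive_curve_iff in D;
      eexists; [apply (proj1 D) | apply (proj2 D)]. }
  assert (Hi : forall eps, 0 < eps -> exists R0, 0 <= R0 /\ forall r s, R0 < r ->
    Cmod (F (RtoC r * cis s)%C - 1) <= eps).
  { intros eps He. destruct (Hinf eps He) as [R0 H]. exists (Rmax 0 R0).
    split; [apply Rmax_l|]. intros r s H1. apply H.
    pose proof (Rmax_l 0 R0). pose proof (Rmax_r 0 R0).
    rewrite Cmod_scal_cis; lra. }
  apply is_RInt_fct_extend_pair.
  - rewrite <- (Rmult_1_r (2 * PI)) at 2.
    apply (is_RInt_ext (fun s => fst (F (RtoC 1 * cis s)%C))).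
    { intros x _. now rewrite Cmult_1_l. }
    apply (polar_mean (fun r s => fst (F (RtoC r * cis s)%C))
      (fun r s => snd (F (RtoC r * cis s)%C)) (fun r s => fst (a r s))).
    + intros r s H. now apply is_derive_curve_iff, Hr.
    + intros r s H. evar_last; [apply (proj1 (is_derive_curve_iff _ _ _) (Hs r s H))|].
      simpl. ring.
    + intros r _. now rewrite Hper.
    + intros r s H. exact (continuity_2d_pt_fst_C _ _ _ (Ha r s H)).
    + intros s. exact (continuity_2d_pt_fst_C _ _ _ (Hb s)).
    + intros r s H. exact (continuous_C_fst _ _ (Hc r s H)).
    + intros eps He. destruct (Hi eps He) as [R0 [_ H]]. exists R0. intros r s H1.
      eapply Rle_trans; [|apply (H r s H1)]. eapply Rle_trans; [|apply Re_le_Cmod].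
      right. reflexivity.
  - rewrite <- (Rmult_0_r (2 * PI)) at 2.
    apply (is_RInt_ext (fun s => snd (F (RtoC 1 * cis s)%C))).
    { intros x _. now rewrite Cmult_1_l. }
    (* The imaginary part of F is the real part of -i F, whose imaginary part is minus the real part
       of F. *)
    apply (polar_mean (fun r s => snd (F (RtoC r * cis s)%C))
      (fun r s => - fst (F (RtoC r * cis s)%C)) (fun r s => snd (a r s))).
    + intros r s H. now apply is_derive_curve_iff, Hr.
    + intros r s H. evar_last.
      * exact (is_derive_opp (V := R_NormedModule) (fun x => fst (F (RtoC r * cis x)%C)) s _
          (proj1 (proj1 (is_derive_curve_iff _ _ _) (Hs r s H)))).
      * simpl. unfold opp; simpl. ring.
    + intros r _. now rewrite Hper.
    + intros r s H. exact (continuity_2d_pt_snd_C _ _ _ (Ha r s H)).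
    + intros s. exact (continuity_2d_pt_snd_C _ _ _ (Hb s)).
    + intros r s H. exact (continuous_C_snd _ _ (Hc r s H)).
    + intros eps He. destruct (Hi eps He) as [R0 [_ H]]. exists R0. intros r s H1.
      eapply Rle_trans; [|apply (H r s H1)]. eapply Rle_trans; [|apply Im_le_Cmod].
      right. reflexivity.
Qed.

(** * Boundary values and Fourier decay *)

Lemma continuous_on_Cmod_eps (D : C -> Prop) (F : C -> C) :
  continuous_on (T := C_UniformSpace) (U := C_UniformSpace) D F <->
  forall z, D z -> forall eps, 0 < eps -> exists d, 0 < d /\
    forall w, D w -> Cmod (w - z) < d -> Cmod (F w - F z) < eps.
Proof.
  split.
  - intros H z Hz eps He. specialize (H z Hz (fun y => Cmod (y - F z) < eps)).
    assert (L : locally (T := C_UniformSpace) (F z) (fun y : C => Cmod (y - F z) < eps)).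
    { apply locally_Cmod. now exists eps. }
    specialize (H L). unfold filtermap, within in H. apply locally_Cmod in H.
    destruct H as [d [Hd H]]. exists d. split; [exact Hd|]. intros w Hw Hw'. now apply H.
  - intros H z Hz P HP. apply locally_Cmod in HP. destruct HP as [e [He HP]].
    destruct (H z Hz e He) as [d [Hd Hd']]. unfold filtermap, within. apply locally_Cmod.
    exists d. split; [exact Hd|]. intros w Hw Hw'. apply HP. now apply Hd'.
Qed.

Lemma continuous_on_comp {T : UniformSpace} (D : C -> Prop) (F : C -> C) (g : T -> C) (x : T) :
  continuous_on (T := C_UniformSpace) (U := C_UniformSpace) D F -> (forall y, D (g y)) ->
  continuous (U := C_UniformSpace) g x -> continuous (U := C_UniformSpace) (fun y => F (g y)) x.
Proof.
  intros HF HD Hg. apply continuous_Cmod_eps. intros eps He.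
  destruct (proj1 (continuous_on_Cmod_eps _ _) HF (g x) (HD x) eps He) as [d [Hd H]].
  generalize (proj1 (continuous_Cmod_eps _ _) Hg d Hd). apply filter_imp. intros y Hy. now apply H.
Qed.

Lemma continuous_curve (f : R -> C) (s : R) :
  continuous (U := C_R_NormedModule) f s <-> continuous (U := C_UniformSpace) f s.
Proof. reflexivity. Qed.

Lemma is_derive_curve_continuous (f : R -> C) (s : R) (l : C) :
  is_derive_curve f s l -> continuous (U := C_UniformSpace) f s.
Proof.
  intros H. apply continuous_curve.
  apply (ex_derive_continuous (K := R_AbsRing) (V := C_R_NormedModule)). now exists l.
Qed.

Lemma Cmod_cis_sub_le (s t : R) : Cmod (cis s - cis t) <= 2 * Rabs (s - t).
Proof.
  rewrite <- (Rmult_1_l (Rabs _)).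
  apply (curve_increment_le cis (fun x => (Ci * cis x)%C)). intros x _. split.
  - apply is_derive_curve_cis.
  - rewrite Cmod_mult, Cmod_Ci, Cmod_cis. lra.
Qed.

(* The derivative bound is uniform in the radius [r > 1], so it survives the limit. *)
Lemma boundary_derive (F dF : C -> C) (s : R) :
  (forall z, 1 < Cmod z -> is_derive (K := C_AbsRing) (V := C_NormedModule) F z (dF z)) ->
  continuous_on (T := C_UniformSpace) (U := C_UniformSpace) (fun z => 1 <= Cmod z) F ->
  continuous_on (T := C_UniformSpace) (U := C_UniformSpace) (fun z => 1 <= Cmod z) dF ->
  is_derive_curve (fun x => F (cis x)) s (Ci * cis s * dF (cis s))%C.
Proof.
  intros HF CF CdF. rewrite continuous_on_Cmod_eps in CF, CdF.
  set (q := fun w => (Ci * w * dF w)%C). change (Ci * cis s * dF (cis s))%C with (q (cis s)).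
  assert (Hcis : forall x, 1 <= Cmod (cis x)) by (intros; rewrite Cmod_cis; lra).
  assert (Cq : forall eps, 0 < eps -> exists d, 0 < d /\ forall w, 1 <= Cmod w ->
    Cmod (w - cis s) < d -> Cmod (q w - q (cis s)) <= eps).
  { intros eps He. set (L := Cmod (dF (cis s)) + 1).
    assert (L0 : 0 < L) by (unfold L; pose proof (Cmod_ge_0 (dF (cis s))); lra).
    destruct (CdF (cis s) (Hcis s) (eps / 4) ltac:(lra)) as [d [Hd H]].
    assert (E1 : 0 < eps / 2 / L) by (apply Rdiv_lt_0_compat; lra).
    exists (Rmin (Rmin 1 d) (eps / 2 / L)). split; [repeat apply Rmin_pos; lra|].
    intros w Hw Hd'.
    pose proof (Rmin_l (Rmin 1 d) (eps / 2 / L)). pose proof (Rmin_r (Rmin 1 d) (eps / 2 / L)).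
    pose proof (Rmin_l 1 d). pose proof (Rmin_r 1 d).
    replace (q w - q (cis s))%C with
      (Ci * (w * (dF w - dF (cis s)) + (w - cis s) * dF (cis s)))%C by (unfold q; ring).
    rewrite Cmod_mult, Cmod_Ci, Rmult_1_l.
    eapply Rle_trans; [apply Cmod_triangle|]. rewrite !Cmod_mult.
    assert (W : Cmod w <= 2).
    { pose proof (Cmod_minus_ge w (cis s)) as A. rewrite Cmod_cis in A. lra. }
    assert (X : Cmod (dF w - dF (cis s)) < eps / 4) by (apply H; [exact Hw | lra]).
    assert (Y : Cmod (w - cis s) * Cmod (dF (cis s)) <= eps / 2 / L * L).
    { apply Rmult_le_compat; try apply Cmod_ge_0; [lra | unfold L; lra]. }
    replace (eps / 2 / L * L) with (eps / 2) in Y by (field; lra).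
    pose proof (Cmod_ge_0 (dF w - dF (cis s))). pose proof (Cmod_ge_0 w). nra. }
  apply is_derive_curve_eps. intros eps He.
  destruct (Cq (eps / 2) ltac:(lra)) as [d [Hd Hq]].
  (* A chord is at most 2 |x - s| < d/2 and the radial offset m/2 is at most d/4, so all points used
     below lie within d of [cis s]. *)
  assert (Hd4 : 0 < d / 4) by lra. exists (mkposreal _ Hd4). intros t Ht.
  assert (Ht' : Rabs (t - s) < d / 4) by exact Ht. clear Ht.
  (* The radius r is chosen after t and eta, to bring F at both endpoints within eta/2 of its
     boundary values. The bound on the derivative, through d, does not depend on r. *)
  apply le_epsilon. intros eta Heta.
  destruct (CF (cis t) (Hcis t) (eta / 2) ltac:(lra)) as [d1 [Hd1 H1]].
  destruct (CF (cis s) (Hcis s) (eta / 2) ltac:(lra)) as [d2 [Hd2 H2]].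
  set (m := Rmin (d / 2) (Rmin d1 d2)).
  assert (Hm : 0 < m <= d / 2 /\ m <= d1 /\ m <= d2).
  { unfold m, Rmin. repeat destruct Rle_dec; lra. }
  set (r := 1 + m / 2).
  assert (Hr : forall x, Cmod (RtoC r * cis x - cis x) = m / 2).
  { intros x. replace (RtoC r * cis x - cis x)%C with (RtoC (m / 2) * cis x)%C.
    - apply Cmod_scal_cis. lra.
    - unfold r. rewrite RtoC_plus. ring. }
  assert (Hr1 : forall x, 1 <= Cmod (RtoC r * cis x)).
  { intros x. rewrite Cmod_scal_cis; unfold r; lra. }
  specialize (H1 _ (Hr1 t) ltac:(rewrite Hr; lra)).
  specialize (H2 _ (Hr1 s) ltac:(rewrite Hr; lra)).
  (* Once the linear part is subtracted, the derivative along the circle of radius r is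
     [q (RtoC r * cis x) - q (cis s)], which is small. *)
  assert (X : Cmod ((F (RtoC r * cis t) - RtoC t * q (cis s)) -
    (F (RtoC r * cis s) - RtoC s * q (cis s)))%C <= 2 * (eps / 2 * Rabs (t - s))).
  { apply (curve_increment_le (fun x => (F (RtoC r * cis x) - RtoC x * q (cis s))%C)
      (fun x => (q (RtoC r * cis x) - q (cis s))%C)).
    intros x Hx. split.
    - apply is_derive_curve_minus.
      + unfold q. replace (Ci * (RtoC r * cis x) * dF (RtoC r * cis x)%C)%C with
          ((RtoC 0 * cis x + RtoC r * (Ci * cis x)) * dF (RtoC r * cis x)%C)%C by ring.
        apply (is_derive_curve_comp F (fun x => (RtoC r * cis x)%C)).
        * apply HF. rewrite Cmod_scal_cis; unfold r; lra.
        * apply (is_derive_curve_mult (fun _ => RtoC r) cis);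
            [apply is_derive_curve_const | apply is_derive_curve_cis].
      + apply is_derive_curve_iff. split; simpl; auto_derive; auto; ring.
    - apply Hq; [apply Hr1|].
      replace (RtoC r * cis x - cis s)%C with ((RtoC r * cis x - cis x) + (cis x - cis s))%C by ring.
      eapply Rle_lt_trans; [apply Cmod_triangle|]. rewrite Hr.
      pose proof (Cmod_cis_sub_le x s). lra. }
  replace (F (cis t) - F (cis s) - RtoC (t - s) * q (cis s))%C with
    (((F (RtoC r * cis t) - RtoC t * q (cis s)) - (F (RtoC r * cis s) - RtoC s * q (cis s)))
     + ((F (RtoC r * cis s) - F (cis s)) - (F (RtoC r * cis t) - F (cis t))))%C
    by (rewrite RtoC_minus; ring).
  eapply Rle_trans; [apply Cmod_triangle|].
  assert (Y : Cmod ((F (RtoC r * cis s) - F (cis s)) - (F (RtoC r * cis t) - F (cis t)))%C <= eta).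
  { eapply Rle_trans; [apply Cmod_triangle|]. rewrite Cmod_opp. lra. }
  lra.
Qed.

Lemma Cmod_RInt_le (f : R -> C) (g : R -> R) (a b : R) (lf : C) (lg : R) :
  a <= b -> (forall x, a <= x <= b -> Cmod (f x) <= g x) ->
  is_RInt (V := C_R_NormedModule) f a b lf -> is_RInt g a b lg -> Cmod lf <= lg.
Proof.
  intros Hab H Hf Hg. rewrite <- norm_C_R.
  apply (norm_RInt_le (V := C_R_NormedModule) f g a b lf lg Hab); auto.
  intros x Hx. rewrite norm_C_R. now apply H.
Qed.

(** Continuity carries bounds on interior increments to the endpoints. This is how the corner, where
    derivatives may be singular, enters the integrals over the circle. *)
Lemma Cmod_increment_limit (Q : R -> C) (a b M : R) :
  a < b -> continuous (U := C_UniformSpace) Q a -> continuous (U := C_UniformSpace) Q b ->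
  (forall x y, a < x < y -> y < b -> Cmod (Q y - Q x) <= M) -> Cmod (Q b - Q a) <= M.
Proof.
  intros Hab Ha Hb H. apply le_epsilon. intros eps He.
  destruct (proj1 (continuous_Cmod_eps _ _) Ha (eps / 2) ltac:(lra)) as [d1 H1].
  destruct (proj1 (continuous_Cmod_eps _ _) Hb (eps / 2) ltac:(lra)) as [d2 H2].
  set (m := Rmin (Rmin d1 d2) ((b - a) / 2)).
  assert (Hm : 0 < m <= d1 /\ m <= d2 /\ m <= (b - a) / 2).
  { pose proof (cond_pos d1). pose proof (cond_pos d2).
    unfold m, Rmin. repeat destruct Rle_dec; lra. }
  set (x := a + m / 2) in *. set (y := b - m / 2) in *.
  assert (X1 : Cmod (Q x - Q a) < eps / 2).
  { apply H1. change (Rabs (x - a) < d1). unfold x. rewrite Rabs_pos_eq; lra. }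
  assert (X2 : Cmod (Q y - Q b) < eps / 2).
  { apply H2. change (Rabs (y - b) < d2). unfold y. rewrite Rabs_left; lra. }
  assert (X3 := H x y ltac:(unfold x, y; lra) ltac:(unfold y; lra)).
  replace (Q b - Q a)%C with ((Q y - Q x) +
    ((Q x - Q a) - (Q y - Q b)))%C by ring.
  eapply Rle_trans; [apply Cmod_triangle|].
  assert (Y : Cmod ((Q x - Q a) - (Q y - Q b))%C <= eps).
  { eapply Rle_trans; [apply Cmod_triangle|]. rewrite Cmod_opp. lra. }
  lra.
Qed.

(** Integration by parts against [cis (INR t * s)]: the boundary terms cancel by periodicity. The
    derivative of F may blow up at both ends of the interval; its majorant g enters only through a
    primitive G bounded by M, whose increments are at most 2 M. *)
Lemma fourier_decay (F dF : R -> C) (g G : R -> R) (M : R) (t : nat) :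
  (1 <= t)%nat -> F 0 = F (2 * PI) ->
  (forall s, continuous (U := C_UniformSpace) F s) ->
  (forall s, 0 < s < 2 * PI -> is_derive_curve F s (dF s)) ->
  (forall s, 0 < s < 2 * PI -> continuous (U := C_UniformSpace) dF s) ->
  (forall s, 0 < s < 2 * PI -> Cmod (dF s) <= g s) ->
  (forall s, 0 < s < 2 * PI -> is_derive G s (g s)) ->
  (forall s, 0 < s < 2 * PI -> continuous g s) ->
  (forall s, 0 < s < 2 * PI -> Rabs (G s) <= M) ->
  Cmod (RInt (V := C_R_CompleteNormedModule)
    (fun s => F s * (Ci * cis (INR t * s)))%C 0 (2 * PI)) <= 2 * M / INR t.
Proof.
  intros Ht Hper CF DF CdF BdF DG Cg BG. pose proof PI_RGT_0 as HPI.
  assert (Ht0 : 0 < INR t) by (apply lt_0_INR; lia).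
  set (E := fun s => cis (INR t * s)).
  assert (DE : forall s, is_derive_curve E s (Ci * RtoC (INR t) * E s)%C).
  { intros s. unfold E. apply is_derive_curve_iff.
    split; simpl; auto_derive; auto; ring. }
  set (f := fun s => (F s * (Ci * E s))%C).
  assert (Cf : forall s, continuous (U := C_UniformSpace) f s).
  { intros s. apply continuous_Cmult; [apply CF|]. apply continuous_Cmult.
    - apply continuous_const.
    - exact (is_derive_curve_continuous _ _ _ (DE s)). }
  set (W := fun x => RInt (V := C_R_CompleteNormedModule) f 0 x).
  assert (DW : forall s, is_derive_curve W s (f s)).
  { intros s. apply (is_derive_RInt (V := C_R_NormedModule) f W 0 s).
    - apply filter_forall. intros b. apply (RInt_correct (V := C_R_CompleteNormedModule)).
      apply (ex_RInt_continuous (V := C_R_CompleteNormedModule)). intros z _. apply Cf.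
    - apply Cf. }
  (* This combination has derivative -E F', without the factor t, while its increment over the
     period is t times the integral sought. *)
  set (Q := fun s => (RtoC (INR t) * W s - E s * F s)%C).
  assert (CQ : forall s, continuous (U := C_UniformSpace) Q s).
  { intros s. apply continuous_Cminus; apply continuous_Cmult.
    - apply continuous_const.
    - exact (is_derive_curve_continuous _ _ _ (DW s)).
    - exact (is_derive_curve_continuous _ _ _ (DE s)).
    - apply CF. }
  assert (DQ : forall s, 0 < s < 2 * PI -> is_derive_curve Q s (- (E s * dF s))%C).
  { intros s Hs. replace (- (E s * dF s))%C with ((RtoC 0 * W s + RtoC (INR t) * f s)
      - (Ci * RtoC (INR t) * E s * F s + E s * dF s))%C by (unfold f; ring).
    apply is_derive_curve_minus.
    - apply (is_derive_curve_mult (fun _ => RtoC (INR t)) W); auto.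
      apply is_derive_curve_const.
    - apply is_derive_curve_mult; auto. }
  assert (B : Cmod (Q (2 * PI)%R - Q 0%R)%C <= 2 * M).
  { apply Cmod_increment_limit; auto; [lra|]. intros x y Hxy Hy.
    apply Rle_trans with (G y - G x).
    - apply (Cmod_RInt_le (fun s => (- (E s * dF s))%C) g x y); [lra| | |].
      + intros z Hz. rewrite Cmod_opp, Cmod_mult. unfold E. rewrite Cmod_cis, Rmult_1_l.
        apply BdF. lra.
      + apply (is_RInt_derive (V := C_R_CompleteNormedModule) Q);
          rewrite Rmin_left, Rmax_right by lra; intros z Hz.
        * apply DQ. lra.
        * apply continuous_curve. apply continuous_Copp, continuous_Cmult.
          -- exact (is_derive_curve_continuous _ _ _ (DE z)).
          -- apply CdF. lra.
      + apply (is_RInt_derive (V := R_CompleteNormedModule) G);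
          rewrite Rmin_left, Rmax_right by lra; intros z Hz; [apply DG | apply Cg]; lra.
    - pose proof (BG x ltac:(lra)) as A1. pose proof (BG y ltac:(lra)) as A2.
      apply Rabs_le_between in A1. apply Rabs_le_between in A2. lra. }
  assert (W0 : W 0 = RtoC 0) by exact (RInt_point (V := C_R_CompleteNormedModule) 0 f).
  assert (EQ : (Q (2 * PI)%R - Q 0%R = RtoC (INR t) * W (2 * PI)%R)%C).
  { unfold Q. rewrite W0, <- Hper. unfold E. rewrite <- !cis_pow, cis_2PI, cis_0. ring. }
  rewrite EQ, Cmod_mult, Cmod_R, Rabs_pos_eq in B by lra.
  fold f. fold (W (2 * PI)). apply Rmult_le_reg_l with (INR t); [exact Ht0|].
  eapply Rle_trans; [exact B|]. right. field. lra.
Qed.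

(** * Corner maps on the unit circle *)

Lemma Rpower_pos (x a : R) : 0 < Rpower x a.
Proof. apply exp_pos. Qed.

Lemma Rpower_le_l (x y a : R) : 0 <= a -> 0 < x <= y -> Rpower x a <= Rpower y a.
Proof. intros. apply Rle_Rpower_l; lra. Qed.

Lemma Rpower_le_l_neg (x y a : R) : a <= 0 -> 0 < x <= y -> Rpower y a <= Rpower x a.
Proof.
  intros Ha Hxy. replace a with (- - a) by ring. rewrite (Rpower_Ropp x), (Rpower_Ropp y).
  apply Rinv_le_contravar; [apply Rpower_pos | apply Rpower_le_l; lra].
Qed.

Lemma Rpower_eventually_lt (a e : R) : 0 < a -> 0 < e ->
  exists d, 0 < d /\ forall x, 0 < x < d -> Rpower x a < e.
Proof.
  intros Ha He. exists (Rpower e (/ a)). split; [apply Rpower_pos|]. intros x Hx.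
  apply Rlt_le_trans with (Rpower (Rpower e (/ a)) a).
  - apply Rlt_Rpower_l; lra.
  - rewrite Rpower_mult, Rinv_l, Rpower_1 by lra. lra.
Qed.

(** With x = 2 y one has y cos y <= sin y, so sin x = 2 sin y cos y >= 2 y cos^2 y >= y, as cos^2 y
    >= 1/2 for y <= PI/4. *)
Lemma sin_ge_half (x : R) : 0 <= x <= PI / 2 -> x / 2 <= sin x.
Proof.
  intros Hx. pose proof PI_RGT_0.
  set (y := x / 2). replace x with (2 * y) by (unfold y; field).
  assert (Hy : 0 <= y <= PI / 4) by (unfold y; lra).
  assert (T : y * cos y <= sin y).
  { destruct (MVT_gen (fun z => sin z - z * cos z) 0 y (fun z => z * sin z)) as [z [Hz E]].
    - intros z _. auto_derive; auto. ring.
    - intros z _. apply continuity_pt_filterlim.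
      apply (ex_derive_continuous (V := R_NormedModule) (fun x => sin x - x * cos x)). auto_derive; auto.
    - rewrite Rmin_left, Rmax_right in Hz by lra. rewrite sin_0 in E.
      assert (0 <= sin z) by (apply sin_ge_0; lra).
      assert (0 <= z * sin z * (y - 0)) by (repeat apply Rmult_le_pos; lra). lra. }
  rewrite sin_2a.
  assert (C4 : cos (PI / 4) <= cos y) by (apply cos_decr_1; lra).
  assert (S : cos (PI / 4) * cos (PI / 4) = / 2).
  { rewrite cos_PI4. replace (1 / sqrt 2 * (1 / sqrt 2)) with (/ (sqrt 2 * sqrt 2)).
    - now rewrite sqrt_sqrt by lra.
    - field. apply Rgt_not_eq, sqrt_lt_R0. lra. }
  assert (P : 0 < cos (PI / 4)) by (apply cos_gt_0; lra).
  assert (Q : / 2 <= cos y * cos y) by nra.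
  assert (y * (cos y * cos y) <= sin y * cos y) by nra. nra.
Qed.

(** Chord against arc: [Rmin s (2 * PI - s)] is the arc distance to the corner, in which all
    estimates on the circle are expressed. *)
Lemma Cmod_cis_minus_1_bounds (s : R) : 0 <= s <= 2 * PI ->
  Rmin s (2 * PI - s) / 2 <= Cmod (cis s - 1) <= Rmin s (2 * PI - s).
Proof.
  intros Hs. pose proof PI_RGT_0. rewrite Cmod_cis_minus_1.
  assert (A : forall x, 0 <= x <= PI -> x / 2 <= 2 * Rabs (sin (x / 2)) <= x).
  { intros x Hx. rewrite Rabs_pos_eq by (apply sin_ge_0; lra). split.
    - pose proof (sin_ge_half (x / 2) ltac:(lra)). lra.
    - destruct (Req_dec x 0) as [->|E].
      + replace (0 / 2) with 0 by field. rewrite sin_0. lra.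
      + pose proof (sin_lt_x (x / 2) ltac:(lra)). lra. }
  unfold Rmin. destruct Rle_dec.
  - apply A. lra.
  - replace (sin (s / 2)) with (sin ((2 * PI - s) / 2)).
    + apply A. lra.
    + replace ((2 * PI - s) / 2) with (PI - s / 2) by field. now rewrite sin_PI_x.
Qed.

Lemma cis_neq_1 (s : R) : 0 < s < 2 * PI -> cis s <> RtoC 1.
Proof.
  intros Hs E. pose proof (Cmod_cis_minus_1_bounds s ltac:(lra)) as [H _].
  rewrite E in H. replace (RtoC 1 - 1)%C with (RtoC 0) in H by ring. rewrite Cmod_0 in H.
  revert H. unfold Rmin. destruct Rle_dec; lra.
Qed.

Lemma at_corner_iff (P : C -> Prop) : at_corner P <->
  exists d, 0 < d /\ forall z, 1 <= Cmod z -> z <> RtoC 1 -> Cmod (z - 1) < d -> P z.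
Proof.
  unfold at_corner, within. rewrite locally_Cmod. split.
  - intros [d [Hd H]]. exists d. split; auto.
  - intros [d [Hd H]]. exists d. split; [exact Hd|]. intros y Hy [A B]. auto.
Qed.

Lemma Cmod_minus_1_pos (z : C) : z <> RtoC 1 -> 0 < Cmod (z - 1).
Proof. intros H. apply Cmod_gt_0. intros E. apply H. rewrite <- (Cplus_0_r 1), <- E. ring. Qed.

Lemma Cmod_Cpower (z : C) (a : R) : Cmod (Cpower z a) = Rpower (Cmod z) a.
Proof.
  unfold Cpower. apply Cmod_scal_cis. left. apply Rpower_pos.
Qed.

Lemma corner_asymptotic (lam : nat -> R) (Psi dPsi : C -> C) (theta c : R) :
  corner_map_with lam Psi dPsi theta c -> forall eps, 0 < eps ->
  exists d, 0 < d /\ forall z, 1 <= Cmod z -> z <> RtoC 1 -> Cmod (z - 1) < d ->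
    Cmod (Psi z + RtoC c * Cpower (z - 1) theta) <= eps * (c * Rpower (Cmod (z - 1)) theta).
Proof.
  intros H eps He. assert (K := cm_corner _ _ _ _ _ H (mkposreal eps He)).
  apply at_corner_iff in K. destruct K as [d [Hd K]]. exists d. split; [exact Hd|].
  intros z Z1 Z2 Z3. specialize (K z Z1 Z2 Z3). simpl in K.
  pose proof (cm_c _ _ _ _ _ H).
  replace (c * Rpower (Cmod (z - 1)) theta) with
    (Cmod (- RtoC c * Cpower (z - 1) theta)).
  - rewrite <- Cmod_opp. replace (- (Psi z + RtoC c * Cpower (z - 1) theta))%C with
      (- RtoC c * Cpower (z - 1) theta - Psi z)%C by ring. exact K.
  - rewrite Cmod_mult, Cmod_opp, Cmod_R, Cmod_Cpower, Rabs_pos_eq by lra. reflexivity.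
Qed.

Lemma cos_Carg (z : C) (a : R) : cos (a * Carg z) = cos (a * acos (fst z / Cmod z)).
Proof.
  unfold Carg. destruct Rle_dec; [reflexivity|].
  rewrite <- cos_neg. f_equal. unfold Re. ring.
Qed.

(* On the unit circle [Re (z - 1) = - |z - 1|^2 / 2], so the argument of [z - 1] tends to
   [+-PI/2] at the corner and [theta * PI / 2 < PI] keeps [-(z-1)^theta] away from the
   positive axis. *)
Lemma cos_Carg_near_corner (theta : R) : 1 < theta < 2 ->
  exists k d, 0 < k <= 1 /\ 0 < d /\ forall s, cis s <> RtoC 1 -> Cmod (cis s - 1) < d ->
    -1 + k <= cos (theta * Carg (cis s - 1)).
Proof.
  intros Ht. pose proof PI_RGT_0.
  assert (C0 : -1 < cos (theta * (PI / 2))).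
  { rewrite <- cos_PI. apply cos_decreasing_1; nra. }
  set (k := Rmin 1 ((1 + cos (theta * (PI / 2))) / 2)).
  assert (Hk : 0 < k <= 1 /\ 2 * k <= 1 + cos (theta * (PI / 2))).
  { unfold k, Rmin. destruct Rle_dec; lra. }
  assert (Cc : continuity_pt (fun x => cos (theta * acos x)) 0).
  { apply (continuity_pt_comp (fun x => theta * acos x) cos).
    - apply (continuity_pt_scal acos theta). apply derivable_continuous_pt.
      apply derivable_pt_acos. lra.
    - apply continuity_cos. }
  destruct (Cc k (proj1 (proj1 Hk))) as [e [He Hc]]. simpl in Hc. unfold R_dist in Hc.
  (* The argument of [acos] is -|z - 1| / 2, so the radius e for it becomes 2 e for |z - 1|. *)
  exists k, (2 * e). split; [lra|]. split; [lra|]. intros s Hs Hd.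
  pose proof (Cmod_minus_1_pos _ Hs) as P.
  assert (E : fst (cis s - 1)%C / Cmod (cis s - 1) = - (Cmod (cis s - 1) / 2)).
  { assert (X : fst (cis s - 1)%C = - (Cmod (cis s - 1) ^ 2 / 2)).
    { rewrite Cmod_sq. simpl. pose proof (sin2_cos2 s) as Q. unfold Rsqr in Q. nra. }
    rewrite X. field. lra. }
  rewrite cos_Carg, E.
  set (x := - (Cmod (cis s - 1) / 2)) in *.
  assert (Hx : x <> 0) by (unfold x; lra).
  assert (A : Rabs (cos (theta * acos x) - cos (theta * acos 0)) < k).
  { apply Hc. split.
    - split; [exact I | auto].
    - rewrite Rminus_0_r. unfold x. rewrite Rabs_Ropp, Rabs_pos_eq; lra. }
  rewrite acos_0 in A. apply Rabs_lt_between in A. lra.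
Qed.

(** By the law of cosines the square of the modulus is at least (1 - k) (rho - x)^2 + k (rho^2 +
    x^2), hence at least (k/2) (rho + x)^2. *)
Lemma Cmod_cis_plus_ge (rho x a k : R) : 0 <= rho -> 0 <= x -> 0 < k <= 1 -> -1 + k <= cos a ->
  k / 2 * (rho + x) <= Cmod (RtoC rho * cis a + RtoC x).
Proof.
  intros Hr Hx Hk Ha.
  apply Rsqr_incr_0_var; [|apply Cmod_ge_0].
  replace (Rsqr (Cmod (RtoC rho * cis a + RtoC x))) with (rho ^ 2 + x ^ 2 + 2 * rho * x * cos a).
  - unfold Rsqr. assert (0 <= rho * x) by nra.
    assert (rho * x * (-1 + k) <= rho * x * cos a) by nra.
    assert (0 <= (1 - k) * (rho - x) ^ 2) by (apply Rmult_le_pos; [lra | apply pow2_ge_0]).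
    assert (0 <= (rho - x) ^ 2) by apply pow2_ge_0.
    assert (k * k <= k) by nra. nra.
  - rewrite Rsqr_pow2, Cmod_sq. simpl. pose proof (sin2_cos2 a) as Q. unfold Rsqr in Q.
    transitivity (rho ^ 2 * (sin a * sin a + cos a * cos a) + x ^ 2 + 2 * rho * x * cos a).
    + rewrite Q. ring.
    + ring.
Qed.

(** The leading term c (z - 1)^theta has distance at least (k/2) (c rho + x) from -x. The error of
    the asymptotics is taken as (k/4) c rho, which consumes at most half of it. *)
Lemma corner_distance_near (lam : nat -> R) (Psi dPsi : C -> C) (theta c : R) :
  corner_map_with lam Psi dPsi theta c -> exists k d, 0 < k /\ 0 < d /\
  forall s x, cis s <> RtoC 1 -> Cmod (cis s - 1) < d -> 0 <= x ->
    k * (Rpower (Cmod (cis s - 1)) theta + x) <= Cmod (Psi (cis s) - RtoC x).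
Proof.
  intros H. pose proof (cm_theta _ _ _ _ _ H) as Ht. pose proof (cm_c _ _ _ _ _ H) as Hc.
  destruct (cos_Carg_near_corner theta Ht) as [k [d1 [Hk [Hd1 H1]]]].
  destruct (corner_asymptotic _ _ _ _ _ H (k / 4) ltac:(lra)) as [d2 [Hd2 H2]].
  exists (k / 4 * Rmin c 1), (Rmin d1 d2).
  pose proof (Rmin_l c 1). pose proof (Rmin_r c 1).
  assert (0 < Rmin c 1) by (apply Rmin_pos; lra).
  split; [apply Rmult_lt_0_compat; lra|]. split; [now apply Rmin_pos|].
  intros s x Hs Hd Hx. pose proof (Rmin_l d1 d2). pose proof (Rmin_r d1 d2).
  set (z := (cis s - 1)%C) in *. set (rho := Rpower (Cmod z) theta).
  assert (Hrho : 0 < rho) by apply Rpower_pos.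
  assert (A : Cmod (Psi (cis s) + RtoC c * Cpower z theta) <= k / 4 * (c * rho)).
  { apply H2; [rewrite Cmod_cis; lra | exact Hs | fold z; lra]. }
  assert (B : k / 2 * (c * rho + x) <= Cmod (RtoC (c * rho) * cis (theta * Carg z) + RtoC x)).
  { apply Cmod_cis_plus_ge; [nra | lra | lra | apply H1; [exact Hs | fold z; lra]]. }
  replace (RtoC (c * rho) * cis (theta * Carg z))%C with (RtoC c * Cpower z theta)%C in B
    by (unfold Cpower; fold rho; rewrite RtoC_mult; ring).
  replace (RtoC c * Cpower z theta + RtoC x)%C with
    ((Psi (cis s) + RtoC c * Cpower z theta) - (Psi (cis s) - RtoC x))%C in B by ring.
  pose proof (Cmod_triangle (Psi (cis s) + RtoC c * Cpower z theta) (- (Psi (cis s) - RtoC x))) as T.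
  rewrite Cmod_opp in T. unfold Cminus at 1 in B.
  assert (k / 4 * Rmin c 1 * (rho + x) <= k / 4 * (c * rho + x)).
  { rewrite Rmult_assoc. apply Rmult_le_compat_l; [lra|]. nra. }
  assert (0 <= k * x) by nra. nra.
Qed.

Lemma continuity_pt_of_continuous (f : R -> R) (x : R) : continuous f x -> continuity_pt f x.
Proof. intros. now apply continuity_pt_filterlim. Qed.

Lemma continuous_Rabs_comp {T : UniformSpace} (f : T -> R) (x : T) :
  continuous f x -> continuous (fun y => Rabs (f y)) x.
Proof. intros H. apply (continuous_comp f Rabs x H). apply continuous_Rabs. Qed.

Lemma continuous_Rmax {T : UniformSpace} (f g : T -> R) (x : T) :
  continuous f x -> continuous g x -> continuous (fun y => Rmax (f y) (g y)) x.
Proof.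
  intros Hf Hg.
  apply (continuous_ext (fun y => / 2 * ((f y + g y) + Rabs (f y - g y)))).
  { intros y. unfold Rmax, Rabs. destruct Rle_dec, Rcase_abs; lra. }
  apply (continuous_mult (K := R_AbsRing)); [apply continuous_const|].
  apply (continuous_plus (V := R_NormedModule)).
  - now apply (continuous_plus (V := R_NormedModule)).
  - apply continuous_Rabs_comp. now apply (continuous_minus (V := R_NormedModule)).
Qed.

Lemma continuous_Rmin {T : UniformSpace} (f g : T -> R) (x : T) :
  continuous f x -> continuous g x -> continuous (fun y => Rmin (f y) (g y)) x.
Proof.
  intros Hf Hg.
  apply (continuous_ext (fun y => - Rmax (- f y) (- g y))).
  { intros y. rewrite Ropp_Rmax, !Ropp_involutive. reflexivity. }
  apply (continuous_opp (V := R_NormedModule)), continuous_Rmax;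
    now apply (continuous_opp (V := R_NormedModule)).
Qed.

Lemma continuous_Cmod_comp {T : UniformSpace} (f : T -> C) (x : T) :
  continuous (U := C_UniformSpace) f x -> continuous (fun y => Cmod (f y)) x.
Proof.
  intros H. apply (filterlim_locally (U := R_UniformSpace)). intros eps.
  generalize (proj1 (continuous_Cmod_eps f x) H eps (cond_pos eps)). apply filter_imp.
  intros y Hy. change (Rabs (Cmod (f y) - Cmod (f x)) < eps).
  eapply Rle_lt_trans; [|exact Hy]. apply Rabs_le. split.
  - pose proof (Cmod_minus_ge (f x) (f y)). rewrite Cmod_sub_sym in H0. lra.
  - apply Cmod_minus_ge.
Qed.

Lemma continuous_corner_circle (F : C -> C) (s : R) :
  continuous_on (T := C_UniformSpace) (U := C_UniformSpace) (fun z => 1 <= Cmod z) F ->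
  continuous (U := C_UniformSpace) (fun x => F (cis x)) s.
Proof.
  intros H. apply (continuous_on_comp _ F cis s H).
  - intros y. rewrite Cmod_cis. lra.
  - apply continuous_cis, continuous_id.
Qed.

Lemma corner_distance_far (lam : nat -> R) (Psi dPsi : C -> C) (theta c d : R) :
  corner_map_with lam Psi dPsi theta c -> 0 <= lam 0%nat -> 0 < d ->
  exists m, 0 < m /\ forall s x, 0 <= s <= 2 * PI -> d <= Cmod (cis s - 1) ->
    0 <= x <= lam 0%nat -> m <= Cmod (Psi (cis s) - RtoC x).
Proof.
  intros H Hl Hd. pose proof PI_RGT_0.
  (* [cl] projects onto [0, [lam 0]] and gives the closest admissible x, so a minimum over the
     circle alone suffices. The second summand of [q] keeps this minimum positive at the corner,
     where Psi = 0 itself lies in the interval; it vanishes in the region of interest. *)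
  set (cl := fun y => Rmax 0 (Rmin y (lam 0%nat))).
  set (q := fun s => Cmod (Psi (cis s) - RtoC (cl (fst (Psi (cis s)))))
    + Rmax 0 (d - Cmod (cis s - 1))).
  pose proof (fun s => continuous_corner_circle Psi s (cm_cont _ _ _ _ _ H)) as CP.
  assert (Cq : forall s, continuous q s).
  { intros s. apply (continuous_plus (V := R_NormedModule)).
    - apply continuous_Cmod_comp, continuous_Cminus; [apply CP|]. apply continuous_RtoC.
      apply continuous_Rmax; [apply continuous_const|].
      apply continuous_Rmin; [|apply continuous_const]. exact (continuous_C_fst _ _ (CP s)).
    - apply continuous_Rmax; [apply continuous_const|].
      apply (continuous_minus (V := R_NormedModule)); [apply continuous_const|].
      apply continuous_Cmod_comp, continuous_Cminus; [|apply continuous_const].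
      apply continuous_cis, continuous_id. }
  destruct (continuity_ab_min q 0 (2 * PI) ltac:(lra)
    (fun s _ => continuity_pt_of_continuous q s (Cq s))) as [s0 [Hmin Hs0]].
  assert (Hcl : forall y, 0 <= cl y <= lam 0%nat).
  { intros y. unfold cl, Rmax, Rmin. repeat destruct Rle_dec; lra. }
  exists (q s0 / 2). split.
  - assert (0 <= Rmax 0 (d - Cmod (cis s0 - 1))) by apply Rmax_l.
    destruct (Req_dec (Cmod (cis s0 - 1)) 0) as [E|E].
    + pose proof (Rmax_r 0 (d - Cmod (cis s0 - 1))).
      pose proof (Cmod_ge_0 (Psi (cis s0) - RtoC (cl (fst (Psi (cis s0)))))).
      unfold q. lra.
    + assert (N : cis s0 <> RtoC 1).
      { intros E'. apply E. rewrite E'. replace (RtoC 1 - 1)%C with (RtoC 0) by ring. apply Cmod_0. }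
      assert (0 < Cmod (Psi (cis s0) - RtoC (cl (fst (Psi (cis s0)))))).
      { apply Cmod_gt_0. intros Z.
        apply (cm_boundary _ _ _ _ _ H (cis s0) (Cmod_cis s0) N _ (Hcl (fst (Psi (cis s0))))).
        rewrite <- (Cplus_0_r (RtoC _)), <- Z. ring. }
      unfold q. lra.
  - intros s x Hs Hds Hx. specialize (Hmin s Hs). revert Hmin. unfold q.
    rewrite (Rmax_left 0 (d - Cmod (cis s - 1))) by lra.
    assert (B : Cmod (Psi (cis s) - RtoC (cl (fst (Psi (cis s))))) <= Cmod (Psi (cis s) - RtoC x)).
    { unfold Cmod. apply sqrt_le_1_alt. simpl. destruct (Psi (cis s)) as [a b]. simpl.
      assert (Rabs (a - cl a) <= Rabs (a - x)).
      { unfold cl, Rmax, Rmin. repeat destruct Rle_dec; unfold Rabs; repeat destruct Rcase_abs; lra. }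
      assert (Y : (a - cl a) ^ 2 <= (a - x) ^ 2).
      { rewrite <- (pow2_abs (a - cl a)), <- (pow2_abs (a - x)). apply pow_incr.
        split; [apply Rabs_pos | assumption]. }
      simpl in Y. unfold Rminus in Y. lra. }
    pose proof (Cmod_ge_0 (Psi (cis s) - RtoC x)). unfold q in *. lra.
Qed.

Lemma corner_upper_near (lam : nat -> R) (Psi dPsi : C -> C) (theta c : R) :
  corner_map_with lam Psi dPsi theta c -> exists d, 0 < d /\
  forall z, 1 <= Cmod z -> z <> RtoC 1 -> Cmod (z - 1) < d ->
    Cmod (Psi z) <= 2 * c * Rpower (Cmod (z - 1)) theta.
Proof.
  intros H. pose proof (cm_c _ _ _ _ _ H) as Hc.
  destruct (corner_asymptotic _ _ _ _ _ H 1 Rlt_0_1) as [d [Hd K]].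
  exists d. split; [exact Hd|]. intros z Z1 Z2 Z3. specialize (K z Z1 Z2 Z3).
  replace (Psi z) with ((Psi z + RtoC c * Cpower (z - 1) theta) - RtoC c * Cpower (z - 1) theta)%C
    by ring.
  eapply Rle_trans; [apply Cmod_triangle|].
  rewrite Cmod_opp, (Cmod_mult (RtoC c)), Cmod_R, Cmod_Cpower, Rabs_pos_eq by lra. lra.
Qed.

(** The asymptotics exclude the corner itself; its value is the limit along the real points 1 +
    e. *)
Lemma corner_value (lam : nat -> R) (Psi dPsi : C -> C) (theta c : R) :
  corner_map_with lam Psi dPsi theta c -> Psi (RtoC 1) = RtoC 0.
Proof.
  intros H. pose proof (cm_theta _ _ _ _ _ H) as Ht. pose proof (cm_c _ _ _ _ _ H) as Hc.
  apply Cmod_eq_0. apply Rle_antisym; [|apply Cmod_ge_0].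
  apply le_epsilon. intros eps He. rewrite Rplus_0_l.
  destruct (corner_upper_near _ _ _ _ _ H) as [d1 [Hd1 H1]].
  destruct (Rpower_eventually_lt theta (eps / (4 * c)) ltac:(lra)) as [d2 [Hd2 H2]].
  { apply Rdiv_lt_0_compat; lra. }
  destruct (proj1 (continuous_on_Cmod_eps _ _) (cm_cont _ _ _ _ _ H) (RtoC 1)
    ltac:(cbv beta; rewrite Cmod_R, Rabs_R1; lra) (eps / 2) ltac:(lra)) as [d3 [Hd3 H3]].
  set (e := Rmin d1 (Rmin d2 d3) / 2).
  assert (He' : 0 < e /\ e < d1 /\ e < d2 /\ e < d3).
  { unfold e, Rmin. repeat destruct Rle_dec; lra. }
  set (z := RtoC (1 + e)).
  assert (Z0 : (z - 1)%C = RtoC e) by (unfold z; rewrite RtoC_plus; ring).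
  assert (Zm : Cmod (z - 1) = e) by (rewrite Z0, Cmod_R, Rabs_pos_eq; lra).
  assert (Z1 : 1 <= Cmod z) by (unfold z; rewrite Cmod_R, Rabs_pos_eq; lra).
  assert (Z2 : z <> RtoC 1).
  { intros E. rewrite E in Zm. replace (RtoC 1 - 1)%C with (RtoC 0) in Zm by ring.
    rewrite Cmod_0 in Zm. lra. }
  specialize (H1 z Z1 Z2 ltac:(lra)). specialize (H3 z Z1 ltac:(lra)).
  specialize (H2 e ltac:(lra)). rewrite Zm in H1.
  assert (2 * c * Rpower e theta <= eps / 2).
  { apply Rle_trans with (2 * c * (eps / (4 * c))).
    - apply Rmult_le_compat_l; lra.
    - right. field. lra. }
  replace (Psi (RtoC 1)) with (Psi z - (Psi z - Psi (RtoC 1)))%C by ring.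
  eapply Rle_trans; [apply Cmod_triangle|]. rewrite Cmod_opp. lra.
Qed.

(** Away from the corner the maximum M of |F| on the circle is at most (M / d^a) |z - 1|^a. The
    lemma serves the corner map with a = theta and its derivative with a = theta - 1. *)
Lemma corner_upper_circle (F : C -> C) (a C1 d : R) :
  0 <= a -> 0 < C1 -> 0 < d ->
  continuous_on (T := C_UniformSpace) (U := C_UniformSpace) (fun z => 1 <= Cmod z) F ->
  (forall z, 1 <= Cmod z -> z <> RtoC 1 -> Cmod (z - 1) < d ->
    Cmod (F z) <= C1 * Rpower (Cmod (z - 1)) a) ->
  exists K, 0 < K /\ forall s, 0 < s < 2 * PI ->
    Cmod (F (cis s)) <= K * Rpower (Rmin s (2 * PI - s)) a.
Proof.
  intros Ha HC1 Hd HF Hn. pose proof PI_RGT_0.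
  destruct (continuity_ab_maj (fun s => Cmod (F (cis s))) 0 (2 * PI) ltac:(lra)) as [s0 [Hmax _]].
  { intros s _. apply continuity_pt_of_continuous, continuous_Cmod_comp.
    now apply continuous_corner_circle. }
  set (M := Cmod (F (cis s0))) in *. assert (HM : 0 <= M) by apply Cmod_ge_0.
  pose proof (Rpower_pos d a) as Pd.
  assert (Q : 0 <= M / Rpower d a) by (apply Rdiv_le_0_compat; lra).
  exists (C1 + M / Rpower d a). split; [lra|]. intros s Hs.
  pose proof (Cmod_cis_minus_1_bounds s ltac:(lra)) as [B1 B2].
  pose proof (cis_neq_1 s Hs) as N. pose proof (Cmod_minus_1_pos _ N) as P.
  apply Rle_trans with ((C1 + M / Rpower d a) * Rpower (Cmod (cis s - 1)) a).
  2:{ apply Rmult_le_compat_l; [lra|]. apply Rpower_le_l; lra. }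
  pose proof (Rpower_pos (Cmod (cis s - 1)) a) as Pp.
  destruct (Rlt_le_dec (Cmod (cis s - 1)) d) as [L|L].
  - eapply Rle_trans; [apply (Hn (cis s)); auto; rewrite Cmod_cis; lra|].
    apply Rmult_le_compat_r; lra.
  - apply Rle_trans with M; [apply Hmax; lra|].
    apply Rle_trans with (M / Rpower d a * Rpower (Cmod (cis s - 1)) a).
    + apply Rle_trans with (M / Rpower d a * Rpower d a); [right; field; lra|].
      apply Rmult_le_compat_l; [lra|]. apply Rpower_le_l; lra.
    + apply Rmult_le_compat_r; lra.
Qed.

Lemma corner_estimates (lam : nat -> R) (Psi dPsi : C -> C) (theta c0 : R) :
  corner_map_with lam Psi dPsi theta c0 -> 0 < lam 0%nat ->
  exists c K, 0 < c /\ 0 < K /\ forall s, 0 < s < 2 * PI ->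
    Cmod (Psi (cis s)) <= K * Rpower (Rmin s (2 * PI - s)) theta /\
    Cmod (dPsi (cis s)) <= K * Rpower (Rmin s (2 * PI - s)) (theta - 1) /\
    forall h, 0 < h -> Rpower h theta <= lam 0%nat ->
      c * Rpower (Rmin s (2 * PI - s) + h) theta <= Cmod (Psi (cis s) - RtoC (Rpower h theta)).
Proof.
  intros H Hl. pose proof (cm_theta _ _ _ _ _ H) as Ht. pose proof (cm_c _ _ _ _ _ H) as Hc0.
  pose proof PI_RGT_0 as HPI.
  destruct (corner_upper_near _ _ _ _ _ H) as [d1 [Hd1 H1]].
  destruct (corner_upper_circle Psi theta (2 * c0) d1 ltac:(lra) ltac:(lra) Hd1
    (cm_cont _ _ _ _ _ H) H1) as [K1 [HK1 B1]].
  destruct (cm_deriv_bound _ _ _ _ _ H) as [M HM]. apply at_corner_iff in HM.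
  destruct HM as [d2 [Hd2 H2]].
  assert (H2' : forall z, 1 <= Cmod z -> z <> RtoC 1 -> Cmod (z - 1) < d2 ->
    Cmod (dPsi z) <= Rmax M 1 * Rpower (Cmod (z - 1)) (theta - 1)).
  { intros z Z1 Z2 Z3. specialize (H2 z Z1 Z2 Z3).
    change (Cmod (dPsi z) <= M * Rabs (Rpower (Cmod (z - 1)) (theta - 1))) in H2.
    rewrite Rabs_pos_eq in H2 by (left; apply Rpower_pos).
    eapply Rle_trans; [exact H2|]. apply Rmult_le_compat_r; [left; apply Rpower_pos | apply Rmax_l]. }
  destruct (corner_upper_circle dPsi (theta - 1) (Rmax M 1) d2 ltac:(lra)
    ltac:(pose proof (Rmax_r M 1); lra) Hd2 (cm_C1 _ _ _ _ _ H) H2') as [K2 [HK2 B2]].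
  destruct (corner_distance_near _ _ _ _ _ H) as [k [d3 [Hk [Hd3 H3]]]].
  destruct (corner_distance_far _ _ _ _ _ d3 H ltac:(lra) Hd3) as [m0 [Hm0 H4]].
  pose proof (Rpower_pos 2 theta) as P2.
  (* 2^theta + [lam 0] bounds d^theta + h^theta, so the constant distance m0 far from the corner is
     put in the same form as the bound near it. *)
  set (k' := Rmin k (m0 / (Rpower 2 theta + lam 0%nat))).
  assert (Hk'2 : 0 < m0 / (Rpower 2 theta + lam 0%nat)) by (apply Rdiv_lt_0_compat; lra).
  assert (Hk' : 0 < k') by (now apply Rmin_pos).
  pose proof (Rpower_pos (/ 4) theta) as P4.
  exists (k' * Rpower (/ 4) theta), (K1 + K2).
  split; [nra|]. split; [lra|]. intros s Hs.
  set (m := Rmin s (2 * PI - s)).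
  assert (Hm : 0 < m) by (apply Rmin_pos; lra).
  split; [|split].
  - eapply Rle_trans; [apply B1, Hs|]. apply Rmult_le_compat_r; [left; apply Rpower_pos | lra].
  - eapply Rle_trans; [apply B2, Hs|]. apply Rmult_le_compat_r; [left; apply Rpower_pos | lra].
  - intros h Hh Hhl.
    pose proof (Cmod_cis_minus_1_bounds s ltac:(lra)) as [D1 D2]. fold m in D1, D2.
    pose proof (cis_neq_1 s Hs) as N. pose proof (Cmod_minus_1_pos _ N) as P.
    set (d := Cmod (cis s - 1)) in *.
    pose proof (Rpower_pos d theta) as Pd. pose proof (Rpower_pos h theta) as Ph.
    assert (X : k' * (Rpower d theta + Rpower h theta) <=
      Cmod (Psi (cis s) - RtoC (Rpower h theta))).
    { destruct (Rlt_le_dec d d3) as [L|L].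
      - apply Rle_trans with (k * (Rpower d theta + Rpower h theta)).
        + apply Rmult_le_compat_r; [lra | apply Rmin_l].
        + apply H3; auto. lra.
      - apply Rle_trans with m0; [|apply H4; auto; lra].
        apply Rle_trans with (m0 / (Rpower 2 theta + lam 0%nat) * (Rpower 2 theta + lam 0%nat));
          [|right; field; lra].
        apply Rmult_le_compat; [lra | lra | apply Rmin_r |].
        assert (d <= 2).
        { unfold d. eapply Rle_trans; [apply Cmod_triangle|].
          rewrite Cmod_cis, Cmod_opp, Cmod_R, Rabs_R1. lra. }
        pose proof (Rpower_le_l d 2 theta ltac:(lra) ltac:(lra)). lra. }
    eapply Rle_trans; [|exact X]. rewrite Rmult_assoc. apply Rmult_le_compat_l; [lra|].
    rewrite Rpower_mult_distr by lra.
    (* Since m <= 2 d, the larger of d and h is at least (m + h) / 4; this is the origin of the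
       factor (1/4)^theta. *)
    destruct (Rle_lt_dec d h) as [L|L].
    + pose proof (Rpower_le_l (/ 4 * (m + h)) h theta ltac:(lra) ltac:(lra)). lra.
    + pose proof (Rpower_le_l (/ 4 * (m + h)) d theta ltac:(lra) ltac:(lra)). lra.
Qed.

(** * Explicit primitives *)

Lemma Rpower_minus (x a b : R) : Rpower x (a - b) = Rpower x a / Rpower x b.
Proof. unfold Rminus. rewrite Rpower_plus, Rpower_Ropp. reflexivity. Qed.

Lemma is_derive_Rpower (x a : R) : 0 < x ->
  is_derive (fun y => Rpower y a) x (a * Rpower x (a - 1)).
Proof.
  intros Hx. rewrite Rpower_minus, Rpower_1 by lra. unfold Rpower.
  auto_derive; [lra|]. field. lra.
Qed.

Lemma continuous_Rpower (x a : R) : 0 < x -> continuous (fun y => Rpower y a) x.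
Proof.
  intros Hx. apply (ex_derive_continuous (V := R_NormedModule)).
  eexists. now apply is_derive_Rpower.
Qed.

Lemma continuous_Rpower_comp {T : UniformSpace} (f : T -> R) (x : T) (a : R) :
  0 < f x -> continuous f x -> continuous (fun y => Rpower (f y) a) x.
Proof.
  intros H0 H. apply (continuous_comp f (fun y => Rpower y a) x H). now apply continuous_Rpower.
Qed.

Lemma is_derive_comp_affine (f : R -> R) (a b x l : R) :
  is_derive f (a * x + b) l -> is_derive (fun y => f (a * y + b)) x (a * l).
Proof.
  intros H. apply (is_derive_comp f (fun y => a * y + b)); [exact H|].
  auto_derive; auto. ring.
Qed.

Lemma continuous_comp_affine (f : R -> R) (a b x : R) :
  continuous f (a * x + b) -> continuous (fun y => f (a * y + b)) x.
Proof.
  intros H. apply (continuous_comp (fun y => a * y + b) f); [|exact H].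
  apply (ex_derive_continuous (V := R_NormedModule) (fun y => a * y + b)). auto_derive; auto.
Qed.

(** The counterpart of [fourier_decay] without integration by parts; again the majorant is
    differentiated and integrated only inside the open interval. *)
Lemma Cmod_RInt_primitive_le (f : R -> C) (g G : R -> R) (a b M : R) :
  a < b -> (forall s, continuous (U := C_UniformSpace) f s) ->
  (forall s, a < s < b -> Cmod (f s) <= g s) ->
  (forall s, a < s < b -> is_derive G s (g s)) ->
  (forall s, a < s < b -> continuous g s) ->
  (forall s, a < s < b -> Rabs (G s) <= M) ->
  Cmod (RInt (V := C_R_CompleteNormedModule) f a b) <= 2 * M.
Proof.
  intros Hab Cf Bf DG Cg BG.
  set (W := fun x => RInt (V := C_R_CompleteNormedModule) f a x : C).
  assert (If : forall x y, ex_RInt (V := C_R_CompleteNormedModule) f x y).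
  { intros x y. apply (ex_RInt_continuous (V := C_R_CompleteNormedModule)). intros z _. apply Cf. }
  assert (DW : forall s, is_derive_curve W s (f s)).
  { intros s. apply (is_derive_RInt (V := C_R_NormedModule) f W a s).
    - apply filter_forall. intros x. apply (RInt_correct (V := C_R_CompleteNormedModule)), If.
    - apply Cf. }
  assert (W0 : W a = RtoC 0) by exact (RInt_point (V := C_R_CompleteNormedModule) a f).
  assert (E : W b = (W b - W a)%C) by (rewrite W0; ring).
  fold (W b). rewrite E.
  apply (Cmod_increment_limit W a b); [lra | | |];
    try exact (is_derive_curve_continuous _ _ _ (DW _)).
  intros x y Hxy Hy. apply Rle_trans with (G y - G x).
  - apply (Cmod_RInt_le f g x y); [lra | intros; apply Bf; lra | |].
    + apply (is_RInt_derive (V := C_R_CompleteNormedModule) W); intros z _; [apply DW | apply Cf].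
    + apply (is_RInt_derive (V := R_CompleteNormedModule) G);
        rewrite Rmin_left, Rmax_right by lra; intros z Hz; [apply DG | apply Cg]; lra.
  - pose proof (BG x ltac:(lra)) as A1. pose proof (BG y ltac:(lra)) as A2.
    apply Rabs_le_between in A1. apply Rabs_le_between in A2. lra.
Qed.

(* A decreasing bound in the distance [Rmin s (2 * PI - s)] to the corner is
   dominated by its symmetrisation, which has an explicit primitive. *)
Lemma symmetrised_bound (p P : R -> R) (L : R) :
  (forall s, 0 < s < 2 * PI -> is_derive P s (p s)) ->
  (forall s, 0 < s < 2 * PI -> continuous p s) ->
  (forall s, 0 < s < 2 * PI -> 0 <= p s) ->
  (forall s s', 0 < s < 2 * PI -> 0 < s' < 2 * PI -> Rabs (P s - P s') <= L) ->
  let g := fun s => p s + p (2 * PI - s) in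
  let G := fun s => P s - P (2 * PI - s) in
  (forall s, 0 < s < 2 * PI -> p (Rmin s (2 * PI - s)) <= g s) /\
  (forall s, 0 < s < 2 * PI -> is_derive G s (g s)) /\
  (forall s, 0 < s < 2 * PI -> continuous g s) /\
  (forall s, 0 < s < 2 * PI -> Rabs (G s) <= L).
Proof.
  intros DP Cp Pp BP g G.
  assert (E : forall s, -1 * s + 2 * PI = 2 * PI - s) by (intros; ring).
  split; [|split; [|split]]; intros s Hs.
  - unfold g, Rmin. pose proof (Pp s Hs). pose proof (Pp (2 * PI - s) ltac:(lra)).
    destruct Rle_dec; lra.
  - unfold G, g. replace (p s + p (2 * PI - s)) with (p s - -1 * p (2 * PI - s)) by ring.
    apply (is_derive_minus (V := R_NormedModule) P (fun s => P (2 * PI - s))); [now apply DP|].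
    apply (is_derive_ext (fun s => P (-1 * s + 2 * PI))); [intros; now rewrite E|].
    rewrite <- E. apply is_derive_comp_affine. rewrite E. apply DP. lra.
  - apply (continuous_plus (V := R_NormedModule)); [now apply Cp|].
    apply (continuous_ext (fun s => p (-1 * s + 2 * PI))); [intros; now rewrite E|].
    apply continuous_comp_affine. rewrite E. apply Cp. lra.
  - apply BP; lra.
Qed.

(** The majorant for the noise coefficient, with b = theta directly and b = theta + 1 after
    integration by parts. As b > 1, the primitive lies between a multiple of h^(1-b) and 0 whatever
    the length of the interval. *)
Lemma bound_shifted_power (A b h : R) : 0 <= A -> 1 < b -> 0 < h ->
  let p := fun s => A * Rpower (s + h) (- b) in
  let P := fun s => A / (1 - b) * Rpower (s + h) (1 - b) in
  (forall s, 0 < s < 2 * PI -> is_derive P s (p s)) /\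
  (forall s, 0 < s < 2 * PI -> continuous p s) /\
  (forall s, 0 < s < 2 * PI -> 0 <= p s) /\
  (forall s s', 0 < s < 2 * PI -> 0 < s' < 2 * PI ->
    Rabs (P s - P s') <= A / (b - 1) * Rpower h (1 - b)).
Proof.
  intros HA Hb Hh p P. split; [|split; [|split]].
  - intros s Hs. unfold P, p.
    replace (A * Rpower (s + h) (- b)) with
      (A / (1 - b) * ((1 - b) * Rpower (s + h) (1 - b - 1)))
      by (replace (1 - b - 1) with (- b) by ring; field; lra).
    apply (is_derive_scal (fun s => Rpower (s + h) (1 - b)) s (A / (1 - b))).
    apply (is_derive_ext (fun s => Rpower (1 * s + h) (1 - b))).
    { intros; now rewrite Rmult_1_l. }
    replace ((1 - b) * Rpower (s + h) (1 - b - 1)) with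
      (1 * ((1 - b) * Rpower (1 * s + h) (1 - b - 1))) by (rewrite !Rmult_1_l; reflexivity).
    apply (is_derive_comp_affine (fun y => Rpower y (1 - b))). apply is_derive_Rpower. lra.
  - intros s Hs. apply (continuous_mult (K := R_AbsRing)); [apply continuous_const|].
    apply continuous_Rpower_comp; [lra|].
    apply (continuous_plus (V := R_NormedModule)); [apply continuous_id | apply continuous_const].
  - intros s Hs. apply Rmult_le_pos; [lra | left; apply Rpower_pos].
  - assert (B : forall s, 0 < s < 2 * PI -> - (A / (b - 1) * Rpower h (1 - b)) <= P s <= 0).
    { intros s Hs. unfold P.
      replace (A / (1 - b)) with (- (A / (b - 1))) by (field; lra).
      pose proof (Rpower_pos (s + h) (1 - b)).
      pose proof (Rpower_le_l_neg h (s + h) (1 - b) ltac:(lra) ltac:(lra)).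
      assert (0 <= A / (b - 1)) by (apply Rdiv_le_0_compat; lra).
      split; nra. }
    intros s s' Hs Hs'. pose proof (B s Hs). pose proof (B s' Hs'). apply Rabs_le. lra.
Qed.

(** The majorant for the derivative of [transfer]: singular at the corner but integrable since theta
    > 1. The primitive comes from s/(s + h), which has derivative h/(s + h)^2 and stays in (0,
    1]. *)
Lemma bound_corner_power (A th h : R) : 0 <= A -> 1 < th -> 0 < h ->
  let p := fun s => A * (Rpower s (th - 2) * Rpower (s + h) (- th)) in
  let P := fun s => A / ((th - 1) * h) * Rpower (s / (s + h)) (th - 1) in
  (forall s, 0 < s < 2 * PI -> is_derive P s (p s)) /\
  (forall s, 0 < s < 2 * PI -> continuous p s) /\
  (forall s, 0 < s < 2 * PI -> 0 <= p s) /\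
  (forall s s', 0 < s < 2 * PI -> 0 < s' < 2 * PI ->
    Rabs (P s - P s') <= A / ((th - 1) * h)).
Proof.
  intros HA Hth Hh p P. split; [|split; [|split]].
  - intros s Hs. unfold P, p.
    assert (Q : 0 < s / (s + h)) by (apply Rdiv_lt_0_compat; lra).
    replace (A * (Rpower s (th - 2) * Rpower (s + h) (- th))) with
      (A / ((th - 1) * h) * (h / (s + h) ^ 2 *
        ((th - 1) * Rpower (s / (s + h)) (th - 1 - 1)))).
    + apply (is_derive_scal (fun s => Rpower (s / (s + h)) (th - 1)) s).
      apply (is_derive_comp (fun y => Rpower y (th - 1)) (fun s => s / (s + h))).
      * now apply is_derive_Rpower.
      * auto_derive; [lra|]. field. lra.
    + replace (th - 1 - 1) with (th - 2) by ring.
      unfold Rdiv at 3. rewrite <- Rpower_mult_distr by (try apply Rinv_0_lt_compat; lra).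
      replace (Rpower (/ (s + h)) (th - 2)) with (Rpower (s + h) (- (th - 2))).
      2:{ rewrite <- (Rpower_1 (s + h)) at 2 by lra. rewrite <- Rpower_Ropp, Rpower_mult.
          f_equal. ring. }
      replace (- th) with (- (th - 2) + - (1 + 1)) by ring.
      rewrite (Rpower_plus (- (th - 2))), (Rpower_Ropp _ (1 + 1)), (Rpower_plus 1 1),
        Rpower_1 by lra.
      field. repeat split; lra.
  - intros s Hs. apply (continuous_mult (K := R_AbsRing)); [apply continuous_const|].
    apply (continuous_mult (K := R_AbsRing)).
    + apply continuous_Rpower. lra.
    + apply continuous_Rpower_comp; [lra|].
      apply (continuous_plus (V := R_NormedModule)); [apply continuous_id | apply continuous_const].
  - intros s Hs. apply Rmult_le_pos; [lra|]. left. apply Rmult_lt_0_compat; apply Rpower_pos.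
  - assert (B : forall s, 0 < s < 2 * PI -> 0 <= P s <= A / ((th - 1) * h)).
    { intros s Hs. unfold P.
      assert (Q : 0 < s / (s + h) <= 1).
      { split; [apply Rdiv_lt_0_compat; lra|]. apply Rmult_le_reg_r with (s + h); [lra|].
        unfold Rdiv. rewrite Rmult_assoc, Rinv_l; lra. }
      pose proof (Rpower_pos (s / (s + h)) (th - 1)).
      pose proof (Rpower_le_l (s / (s + h)) 1 (th - 1) ltac:(lra) Q) as X.
      assert (Y : Rpower 1 (th - 1) = 1).
      { unfold Rpower. rewrite ln_1, Rmult_0_r. apply exp_0. }
      rewrite Y in X.
      assert (0 <= A / ((th - 1) * h)) by (apply Rdiv_le_0_compat; nra).
      split; nra. }
    intros s s' Hs Hs'. pose proof (B s Hs). pose proof (B s' Hs'). apply Rabs_le. lra.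
Qed.

(** * Noise and signal coefficients *)

Definition resolvent (Psi : C -> C) (l : R) (z : C) : C := (/ (Psi z - RtoC l))%C.

Definition resolvent' (Psi dPsi : C -> C) (l : R) (z : C) : C :=
  (- dPsi z / ((Psi z - RtoC l) * (Psi z - RtoC l)))%C.

Definition transfer (Psi : C -> C) (l : R) (z : C) : C :=
  (Psi z / ((Psi z - RtoC l) * (z - RtoC 1)))%C.

(** The derivative of Psi/(Psi - l) is taken in the form -l Psi'/(Psi - l)^2: the factor l is what
    later cancels one power of the distance to l. *)
Definition transfer' (Psi dPsi : C -> C) (l : R) (z : C) : C :=
  (- (RtoC l * dPsi z / ((Psi z - RtoC l) * (Psi z - RtoC l) * (z - RtoC 1)))
   - Psi z / ((Psi z - RtoC l) * ((z - RtoC 1) * (z - RtoC 1))))%C.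

Lemma Cinv_0 : (/ RtoC 0)%C = RtoC 0.
Proof. apply C_ext; simpl; unfold Rdiv; ring. Qed.

Lemma Cminus_neq_0 (x y : C) : x <> y -> (x - y)%C <> RtoC 0.
Proof. intros H E. apply H. rewrite <- (Cplus_0_r y), <- E. ring. Qed.

(** The circle condition omits the corner; there the value of the map is 0, which differs from l >
    0. *)
Lemma corner_avoids (lam : nat -> R) (Psi dPsi : C -> C) (theta c l : R) :
  corner_map_with lam Psi dPsi theta c -> 0 < l <= lam 0%nat ->
  (forall z, 1 < Cmod z -> Psi z <> RtoC l) ->
  forall z, 1 <= Cmod z -> (Psi z - RtoC l)%C <> RtoC 0.
Proof.
  intros H Hl Hs z Hz. apply Cminus_neq_0. destruct Hz as [Hz|Hz]; [now apply Hs|].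
  destruct (Ceq_dec z (RtoC 1)) as [->|N].
  - rewrite (corner_value _ _ _ _ _ H). intros E. apply RtoC_inj in E. lra.
  - apply (cm_boundary _ _ _ _ _ H); auto. lra.
Qed.

Lemma is_derive_curve_resolvent (Psi dPsi : C -> C) (g : R -> C) (s l : R) (dg : C) :
  is_derive_curve (fun x => Psi (g x)) s (dg * dPsi (g s))%C ->
  (Psi (g s) - RtoC l)%C <> RtoC 0 ->
  is_derive_curve (fun x => resolvent Psi l (g x)) s (dg * resolvent' Psi dPsi l (g s))%C.
Proof.
  intros H H0. unfold resolvent, resolvent'.
  replace (dg * (- dPsi (g s) / ((Psi (g s) - RtoC l) * (Psi (g s) - RtoC l))))%C with
    (- (dg * dPsi (g s) - RtoC 0) / ((Psi (g s) - RtoC l) * (Psi (g s) - RtoC l)))%C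
    by (field; exact H0).
  apply (is_derive_curve_inv (fun x => Psi (g x) - RtoC l)%C); [exact H0|].
  apply is_derive_curve_minus; [exact H | apply is_derive_curve_const].
Qed.

Lemma is_derive_curve_transfer (Psi dPsi : C -> C) (g : R -> C) (s l : R) (dg : C) :
  is_derive_curve g s dg ->
  is_derive_curve (fun x => Psi (g x)) s (dg * dPsi (g s))%C ->
  (Psi (g s) - RtoC l)%C <> RtoC 0 -> g s <> RtoC 1 ->
  is_derive_curve (fun x => transfer Psi l (g x)) s (dg * transfer' Psi dPsi l (g s))%C.
Proof.
  intros Hg H H0 H1. apply Cminus_neq_0 in H1. unfold transfer, transfer'.
  set (P := Psi (g s)) in *.
  replace (dg * _)%C with ((dg * dPsi (g s)) * / ((P - RtoC l) * (g s - RtoC 1)) +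
    P * (- ((dg * dPsi (g s) - RtoC 0) * (g s - RtoC 1) + (P - RtoC l) * (dg - RtoC 0)) /
      (((P - RtoC l) * (g s - RtoC 1)) * ((P - RtoC l) * (g s - RtoC 1)))))%C
    by (field; split; assumption).
  apply (is_derive_curve_mult (fun x => Psi (g x))
    (fun x => / ((Psi (g x) - RtoC l) * (g x - RtoC 1)))%C); [exact H|].
  apply (is_derive_curve_inv (fun x => (Psi (g x) - RtoC l) * (g x - RtoC 1))%C).
  - now apply Cmult_neq_0.
  - apply (is_derive_curve_mult (fun x => Psi (g x) - RtoC l)%C (fun x => g x - RtoC 1)%C);
      apply is_derive_curve_minus; auto; apply is_derive_curve_const.
Qed.

(** * Continuity of the integrands along an arbitrary map into the closed exterior of the disk *)

Section Continuity.

Variables (lam : nat -> R) (Psi dPsi : C -> C) (theta c l : R).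
Hypothesis (H : corner_map_with lam Psi dPsi theta c) (Hl : 0 < l <= lam 0%nat).
Hypothesis (Hs : forall z, 1 < Cmod z -> Psi z <> RtoC l).
Variables (T : UniformSpace) (g : T -> C) (x : T).
Hypothesis (Hg1 : forall y, 1 <= Cmod (g y)).
Hypothesis (Hg : continuous (U := C_UniformSpace) g x).

Lemma continuous_corner_comp : continuous (U := C_UniformSpace) (fun y => Psi (g y)) x.
Proof. exact (continuous_on_comp _ Psi g x (cm_cont _ _ _ _ _ H) Hg1 Hg). Qed.

Lemma continuous_corner'_comp : continuous (U := C_UniformSpace) (fun y => dPsi (g y)) x.
Proof. exact (continuous_on_comp _ dPsi g x (cm_C1 _ _ _ _ _ H) Hg1 Hg). Qed.

Lemma continuous_shifted_comp :
  continuous (U := C_UniformSpace) (fun y => Psi (g y) - RtoC l)%C x.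
Proof. apply continuous_Cminus; [apply continuous_corner_comp | apply continuous_const]. Qed.

Let avoid := corner_avoids _ _ _ _ _ _ H Hl Hs _ (Hg1 x).

Lemma continuous_resolvent_comp :
  continuous (U := C_UniformSpace) (fun y => resolvent Psi l (g y)) x.
Proof. apply continuous_Cinv; [exact avoid | apply continuous_shifted_comp]. Qed.

Lemma continuous_resolvent'_comp :
  continuous (U := C_UniformSpace) (fun y => resolvent' Psi dPsi l (g y)) x.
Proof.
  apply continuous_Cdiv.
  - now apply Cmult_neq_0.
  - apply continuous_Copp, continuous_corner'_comp.
  - apply continuous_Cmult; apply continuous_shifted_comp.
Qed.

Lemma continuous_transfer'_comp : g x <> RtoC 1 ->
  continuous (U := C_UniformSpace) (fun y => transfer' Psi dPsi l (g y)) x.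
Proof.
  intros N. apply Cminus_neq_0 in N.
  assert (N1 : continuous (U := C_UniformSpace) (fun y => g y - RtoC 1)%C x).
  { apply continuous_Cminus; [exact Hg | apply continuous_const]. }
  apply continuous_Cminus; [apply continuous_Copp|]; apply continuous_Cdiv.
  - repeat apply Cmult_neq_0; auto.
  - apply continuous_Cmult; [apply continuous_const | apply continuous_corner'_comp].
  - apply continuous_Cmult; [apply continuous_Cmult; apply continuous_shifted_comp | exact N1].
  - repeat apply Cmult_neq_0; auto.
  - apply continuous_corner_comp.
  - apply continuous_Cmult; [apply continuous_shifted_comp | apply continuous_Cmult; exact N1].
Qed.

(** Near the corner |[transfer]| <= (4 c / l) |z - 1|^(theta - 1), which tends to 0 as theta > 1 and
    so agrees with the value 0 produced by [/ 0 = 0]. *)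
Lemma continuous_transfer_comp :
  continuous (U := C_UniformSpace) (fun y => transfer Psi l (g y)) x.
Proof.
  destruct (Ceq_dec (g x) (RtoC 1)) as [E|N].
  2:{ apply Cminus_neq_0 in N. apply continuous_Cdiv.
      - now apply Cmult_neq_0.
      - apply continuous_corner_comp.
      - apply continuous_Cmult; [apply continuous_shifted_comp|].
        apply continuous_Cminus; [exact Hg | apply continuous_const]. }
  assert (F1 : transfer Psi l (RtoC 1) = RtoC 0).
  { unfold transfer. replace (RtoC 1 - RtoC 1)%C with (RtoC 0) by ring.
    rewrite Cmult_0_r. unfold Cdiv. rewrite Cinv_0. ring. }
  pose proof (cm_theta _ _ _ _ _ H) as Ht. pose proof (cm_c _ _ _ _ _ H) as Hc.
  apply continuous_Cmod_eps. intros eps He.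
  destruct (corner_upper_near _ _ _ _ _ H) as [d1 [Hd1 H1]].
  (* Within d2 of the corner |Psi| <= l/2, hence |Psi - l| >= l/2. *)
  destruct (Rpower_eventually_lt theta (l / 2 / (2 * c)) ltac:(lra)) as [d2 [Hd2 H2]].
  { repeat apply Rdiv_lt_0_compat; lra. }
  destruct (Rpower_eventually_lt (theta - 1) (eps * l / (4 * c)) ltac:(lra)) as [d3 [Hd3 H3]].
  { apply Rdiv_lt_0_compat; [apply Rmult_lt_0_compat; lra | lra]. }
  set (d := Rmin d1 (Rmin d2 d3)).
  assert (Hd : 0 < d /\ d <= d1 /\ d <= d2 /\ d <= d3).
  { unfold d, Rmin. repeat destruct Rle_dec; lra. }
  generalize (proj1 (continuous_Cmod_eps _ _) Hg d (proj1 Hd)). apply filter_imp.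
  intros y Hy. rewrite E in Hy |- *. rewrite F1.
  replace (transfer Psi l (g y) - RtoC 0)%C with (transfer Psi l (g y)) by ring.
  destruct (Ceq_dec (g y) (RtoC 1)) as [E'|N'].
  { rewrite E', F1, Cmod_0. exact He. }
  pose proof (Cmod_minus_1_pos _ N') as P. set (r := Cmod (g y - 1)) in *.
  specialize (H1 _ (Hg1 y) N' ltac:(fold r; lra)). fold r in H1.
  specialize (H2 r ltac:(lra)). specialize (H3 r ltac:(lra)).
  assert (X : 2 * c * Rpower r theta <= l / 2).
  { apply Rle_trans with (2 * c * (l / 2 / (2 * c))); [|right; field; lra].
    apply Rmult_le_compat_l; lra. }
  assert (Y : l / 2 <= Cmod (Psi (g y) - RtoC l)).
  { rewrite Cmod_sub_sym. pose proof (Cmod_minus_ge (RtoC l) (Psi (g y))) as M.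
    rewrite Cmod_R, Rabs_pos_eq in M by lra. lra. }
  unfold transfer. rewrite Cmod_div.
  2:{ apply Cmult_neq_0; [|now apply Cminus_neq_0].
      exact (corner_avoids _ _ _ _ _ _ H Hl Hs _ (Hg1 y)). }
  rewrite Cmod_mult. fold r.
  apply Rle_lt_trans with (2 * c * Rpower r theta / (l / 2 * r)).
  - apply Rmult_le_compat.
    + apply Cmod_ge_0.
    + left. apply Rinv_0_lt_compat, Rmult_lt_0_compat; lra.
    + exact H1.
    + apply Rinv_le_contravar; [apply Rmult_lt_0_compat; lra|].
      apply Rmult_le_compat_r; lra.
  - replace (2 * c * Rpower r theta / (l / 2 * r)) with (4 * c / l * Rpower r (theta - 1)).
    2:{ rewrite Rpower_minus, Rpower_1 by lra. field. lra. }
    apply Rlt_le_trans with (4 * c / l * (eps * l / (4 * c))); [|right; field; lra].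
    apply Rmult_lt_compat_l; [apply Rdiv_lt_0_compat; lra | exact H3].
Qed.

End Continuity.

Notation CInt f a b := (RInt (V := C_R_CompleteNormedModule) f a b).

(** Integrands are compared in the carrier of a normed module; the goal is restated at type [C] for
    [ring]. *)
Ltac eq_in_C := match goal with |- @eq _ ?a ?b => change (@eq C a b) end.

Lemma ex_CInt (f : R -> C) (a b : R) :
  (forall s, continuous (U := C_UniformSpace) f s) -> ex_RInt (V := C_R_CompleteNormedModule) f a b.
Proof. intros H. apply (ex_RInt_continuous (V := C_R_CompleteNormedModule)). intros z _. apply H. Qed.

Lemma is_CInt_Cmult_l (k : C) (f : R -> C) (a b : R) (l : C) :
  is_RInt (V := C_R_NormedModule) f a b l ->
  is_RInt (V := C_R_NormedModule) (fun s => k * f s)%C a b (k * l)%C.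
Proof.
  intros H. assert (H1 := is_RInt_fct_extend_fst _ _ _ _ H).
  assert (H2 := is_RInt_fct_extend_snd _ _ _ _ H).
  apply (is_RInt_fct_extend_pair (U := R_NormedModule) (V := R_NormedModule)
    (fun s => k * f s)%C a b (fst (k * l)%C) (snd (k * l)%C)); simpl.
  - apply (is_RInt_minus (V := R_NormedModule) (fun s => fst k * fst (f s)) (fun s => snd k * snd (f s)));
      apply (is_RInt_scal (V := R_NormedModule)); assumption.
  - apply (is_RInt_plus (V := R_NormedModule) (fun s => fst k * snd (f s)) (fun s => snd k * fst (f s)));
      apply (is_RInt_scal (V := R_NormedModule)); assumption.
Qed.

Lemma Ci_neq_0 : Ci <> RtoC 0.
Proof. intros E. apply (f_equal snd) in E. simpl in E. lra. Qed.

Lemma two_PI_Ci_neq_0 : (RtoC (2 * PI) * Ci)%C <> RtoC 0.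
Proof.
  pose proof PI_RGT_0. apply Cmult_neq_0.
  - intros E. apply RtoC_inj in E. lra.
  - exact Ci_neq_0.
Qed.

Lemma Cmod_inv_two_PI_Ci : Cmod (/ (RtoC (2 * PI) * Ci)) = / (2 * PI).
Proof.
  pose proof PI_RGT_0. rewrite Cmod_inv by apply two_PI_Ci_neq_0.
  rewrite Cmod_mult, Cmod_R, Cmod_Ci, Rabs_pos_eq by lra. f_equal. ring.
Qed.

Lemma cis_pow_shift (t : nat) (s : R) : (1 <= t)%nat ->
  (cis s ^ (t - 1) * cis s)%C = cis (INR t * s).
Proof.
  intros Ht. rewrite <- cis_pow. replace t with (S (t - 1)) at 2 by lia. simpl. ring.
Qed.

(** On mu = [cis s] the differential contributes one more factor [cis s], so the exponent t - 1
    becomes the frequency t. *)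
Lemma Ucoef_fourier (Psi : C -> C) (t : nat) (l : R) : (1 <= t)%nat ->
  Ucoef Psi t l = (/ (RtoC (2 * PI) * Ci) *
    CInt (fun s => resolvent Psi l (cis s) * (Ci * cis (INR t * s)))%C 0 (2 * PI))%C.
Proof.
  intros Ht. unfold Ucoef, circle_integral. f_equal. apply RInt_ext. intros s _.
  unfold resolvent. rewrite <- cis_pow_shift by exact Ht. unfold Cdiv. eq_in_C. ring.
Qed.

Lemma Vcoef_fourier (Psi : C -> C) (t : nat) (l : R) : (1 <= t)%nat ->
  Vcoef Psi t l = (/ (RtoC (2 * PI) * Ci) *
    CInt (fun s => transfer Psi l (cis s) * (Ci * cis (INR t * s)))%C 0 (2 * PI))%C.
Proof.
  intros Ht. unfold Vcoef, circle_integral. f_equal. apply RInt_ext. intros s _.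
  unfold transfer. rewrite <- cis_pow_shift by exact Ht. unfold Cdiv. eq_in_C. ring.
Qed.

Lemma CInt_cis (t : nat) : (1 <= t)%nat -> CInt (fun s => Ci * cis (INR t * s))%C 0 (2 * PI) = RtoC 0.
Proof.
  intros Ht. assert (Ht0 : 0 < INR t) by (apply lt_0_INR; lia).
  apply is_RInt_unique.
  assert (E : is_RInt (V := C_R_NormedModule) (fun s => Ci * cis (INR t * s))%C 0 (2 * PI)
    (RtoC (/ INR t) * cis (INR t * (2 * PI)) - RtoC (/ INR t) * cis (INR t * 0))%C).
  { apply (is_RInt_derive (V := C_R_CompleteNormedModule)
      (fun s => RtoC (/ INR t) * cis (INR t * s))%C).
    - intros s _. apply is_derive_curve_iff. split; simpl; auto_derive; auto; field; lra.
    - intros s _. apply continuous_curve, continuous_Cmult; [apply continuous_const|].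
      apply continuous_cis, (continuous_mult (K := R_AbsRing));
        [apply continuous_const | apply continuous_id]. }
  replace (RtoC 0) with (RtoC (/ INR t) * cis (INR t * (2 * PI)) - RtoC (/ INR t) * cis (INR t * 0))%C;
    [exact E|].
  rewrite <- !cis_pow, cis_2PI, cis_0. ring.
Qed.

Section Coefficients.

Variables (lam : nat -> R) (Psi dPsi : C -> C) (theta c l : R).
Hypothesis (H : corner_map_with lam Psi dPsi theta c) (Hl : 0 < l <= lam 0%nat).
Hypothesis (Hs : forall z, 1 < Cmod z -> Psi z <> RtoC l).

Lemma continuous_resolvent_circle (s : R) :
  continuous (U := C_UniformSpace) (fun x => resolvent Psi l (cis x)) s.
Proof.
  apply (continuous_resolvent_comp _ _ _ _ _ _ H Hl Hs R_UniformSpace cis).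
  - intros y. rewrite Cmod_cis. lra.
  - apply continuous_cis, continuous_id.
Qed.

Lemma continuous_transfer_circle (s : R) :
  continuous (U := C_UniformSpace) (fun x => transfer Psi l (cis x)) s.
Proof.
  apply (continuous_transfer_comp _ _ _ _ _ _ H Hl Hs R_UniformSpace cis).
  - intros y. rewrite Cmod_cis. lra.
  - apply continuous_cis, continuous_id.
Qed.

Lemma continuous_fourier_kernel (t : nat) (s : R) :
  continuous (U := C_UniformSpace) (fun x => Ci * cis (INR t * x))%C s.
Proof.
  apply continuous_Cmult; [apply continuous_const|].
  apply continuous_cis, (continuous_mult (K := R_AbsRing));
    [apply continuous_const | apply continuous_id].
Qed.

Lemma continuous_scal_cis (z : R * R) :
  continuous (U := C_UniformSpace) (fun z : R * R => RtoC (Rmax 1 (fst z)) * cis (snd z))%C z.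
Proof.
  destruct z as [a b]. apply continuous_Cmult.
  - apply continuous_RtoC, continuous_Rmax; [apply continuous_const|].
    apply (continuous_fst (U := R_UniformSpace) (V := R_UniformSpace)).
  - apply continuous_cis, (continuous_snd (U := R_UniformSpace) (V := R_UniformSpace)).
Qed.

Lemma Vcoef_1 : Vcoef Psi 1 l = RtoC 1.
Proof.
  set (F := fun z => (z * transfer Psi l z)%C).
  (* The radial derivative of F. The coefficient at time 1 is the circle mean of F = z [transfer],
     because d mu = i mu ds. *)
  set (a := fun r s => (cis s * transfer Psi l (RtoC r * cis s) +
    RtoC r * cis s * (cis s * transfer' Psi dPsi l (RtoC r * cis s)))%C).
  assert (M1 : forall y, 1 <= Cmod (RtoC (Rmax 1 y)) ).
  { intros y. pose proof (Rmax_l 1 y). rewrite Cmod_R, Rabs_pos_eq; lra. }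
  assert (Hg1 : forall z : R * R, 1 <= Cmod (RtoC (Rmax 1 (fst z)) * cis (snd z))).
  { intros z. rewrite Cmod_mult, Cmod_cis, Rmult_1_r. apply M1. }
  assert (N : forall r s, 1 < r -> (RtoC r * cis s)%C <> RtoC 1).
  { intros r s Hr E. assert (X := Cmod_scal_cis r s ltac:(lra)).
    rewrite E, Cmod_R, Rabs_R1 in X. lra. }
  assert (Hd : forall g s dg, is_derive_curve g s dg -> 1 < Cmod (g s) -> g s <> RtoC 1 ->
    is_derive_curve (fun x => F (g x)) s
      (dg * transfer Psi l (g s) + g s * (dg * transfer' Psi dPsi l (g s)))%C).
  { intros g s dg Dg G1 G2. apply is_derive_curve_mult; [exact Dg|].
    apply is_derive_curve_transfer; auto.
    - apply is_derive_curve_comp; [apply (cm_holomorphic _ _ _ _ _ H); exact G1 | exact Dg].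
    - apply (corner_avoids _ _ _ _ _ _ H Hl Hs). lra. }
  assert (E : is_RInt (V := C_R_NormedModule) (fun s => F (cis s)) 0 (2 * PI) (RtoC (2 * PI))).
  { apply (exterior_mean F a).
    - intros r s Hr. unfold a.
      apply (Hd (fun x => RtoC x * cis s)%C r); [|rewrite Cmod_scal_cis; lra | now apply N].
      apply is_derive_curve_iff. split; simpl; auto_derive; auto; ring.
    - intros r s Hr. replace (Ci * RtoC r * a r s)%C with
        ((Ci * RtoC r * cis s) * transfer Psi l (RtoC r * cis s) + RtoC r * cis s *
          ((Ci * RtoC r * cis s) * transfer' Psi dPsi l (RtoC r * cis s)))%C by (unfold a; ring).
      apply (Hd (fun x => RtoC r * cis x)%C s); [|rewrite Cmod_scal_cis; lra | now apply N].
      apply is_derive_curve_iff. split; simpl; auto_derive; auto; ring.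
    - intros r s Hr.
      pose proof (continuous_scal_cis (r, s)) as Cg.
      assert (G : continuous (U := C_UniformSpace) (fun z : R * R =>
        (cis (snd z) * transfer Psi l (RtoC (Rmax 1 (fst z)) * cis (snd z)) +
         RtoC (Rmax 1 (fst z)) * cis (snd z) * (cis (snd z) *
         transfer' Psi dPsi l (RtoC (Rmax 1 (fst z)) * cis (snd z))))%C) (r, s)).
      { assert (Cc : continuous (U := C_UniformSpace) (fun z : R * R => cis (snd z)) (r, s)).
        { apply continuous_cis, (continuous_snd (U := R_UniformSpace) (V := R_UniformSpace)). }
        apply continuous_Cplus; apply continuous_Cmult; auto.
        - apply (continuous_transfer_comp _ _ _ _ _ _ H Hl Hs); auto.
        - apply continuous_Cmult; auto.
          apply (continuous_transfer'_comp _ _ _ _ _ _ H Hl Hs); auto.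
          simpl. rewrite Rmax_right by lra. now apply N. }
      (* [Rmax 1] makes the map total into the closed exterior; near a radius r > 1 it changes
         nothing. *)
      revert G. apply (continuous_ext_loc (T := prod_UniformSpace R_UniformSpace R_UniformSpace)).
      assert (Hr' : 0 < r - 1) by lra. exists (mkposreal _ Hr'). intros [x y] [Hx _].
      assert (Hx' : Rabs (x - r) < r - 1) by exact Hx. apply Rabs_lt_between in Hx'.
      simpl. rewrite Rmax_right by lra. reflexivity.
    - intros s. apply continuous_Cmult; [apply continuous_scal_cis|].
      apply (continuous_transfer_comp _ _ _ _ _ _ H Hl Hs); [exact Hg1|].
      apply continuous_scal_cis.
    - intros eps He.
      set (e := Rmin 1 (eps / 4)). assert (He' : 0 < e /\ e <= 1 /\ e <= eps / 4).
      { unfold e, Rmin. destruct Rle_dec; lra. }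
      assert (Ie : 0 < / e) by (apply Rinv_0_lt_compat; lra).
      destruct (cm_infty _ _ _ _ _ H (l + l / e)) as [r0 Hr0].
      exists (Rmax r0 (1 + / e)). intros z Hz.
      pose proof (Rmax_l r0 (1 + / e)). pose proof (Rmax_r r0 (1 + / e)).
      assert (Z1 : 1 < Cmod z) by lra.
      specialize (Hr0 z Z1 ltac:(lra)).
      assert (A0 := corner_avoids _ _ _ _ _ _ H Hl Hs z ltac:(lra)).
      assert (A1 : l / e < Cmod (Psi z - RtoC l)).
      { pose proof (Cmod_minus_ge (Psi z) (RtoC l)) as M. rewrite (Cmod_R l), Rabs_pos_eq in M by lra.
        lra. }
      assert (A2 : / e < Cmod (z - RtoC 1)).
      { pose proof (Cmod_minus_ge z (RtoC 1)) as M. rewrite (Cmod_R 1), Rabs_R1 in M. lra. }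
      assert (N1 : (z - RtoC 1)%C <> RtoC 0).
      { intros E. rewrite E, Cmod_0 in A2. lra. }
      (* F factors as (1 + u) (1 + v), since Psi/(Psi - l) = 1 + u and z/(z - 1) = 1 + v; both u and
         v vanish at infinity. *)
      set (u := (RtoC l / (Psi z - RtoC l))%C). set (v := (/ (z - RtoC 1))%C).
      assert (U : Cmod u <= e).
      { unfold u. rewrite Cmod_div, Cmod_R, Rabs_pos_eq by (exact A0 || lra).
        apply Rmult_le_reg_r with (Cmod (Psi z - RtoC l)); [apply Cmod_gt_0; exact A0|].
        unfold Rdiv. rewrite Rmult_assoc, Rinv_l, Rmult_1_r by (apply Rgt_not_eq, Cmod_gt_0; exact A0).
        apply Rle_trans with (e * (l / e)); [right; field; lra|].
        apply Rmult_le_compat_l; lra. }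
      assert (V : Cmod v <= e).
      { unfold v. rewrite Cmod_inv by exact N1. rewrite <- (Rinv_inv e).
        left. apply Rinv_lt_contravar; [apply Rmult_lt_0_compat; lra | exact A2]. }
      replace (F z - 1)%C with (u + (v + u * v))%C.
      2:{ unfold F, transfer, u, v. field. split; assumption. }
      eapply Rle_trans; [apply Cmod_triangle|].
      eapply Rle_trans; [apply Rplus_le_compat_l, Cmod_triangle|].
      rewrite Cmod_mult. pose proof (Cmod_ge_0 u). pose proof (Cmod_ge_0 v).
      assert (Cmod u * Cmod v <= e * 1) by (apply Rmult_le_compat; lra). lra. }
  rewrite Vcoef_fourier by lia.
  assert (E2 : CInt (fun s => transfer Psi l (cis s) * (Ci * cis (INR 1 * s)))%C 0 (2 * PI) =
    (Ci * RtoC (2 * PI))%C).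
  { apply is_RInt_unique. eapply is_RInt_ext; [|apply (is_CInt_Cmult_l Ci _ _ _ _ E)].
    intros s _. unfold F. simpl INR. rewrite Rmult_1_l. eq_in_C. ring. }
  rewrite E2. field. split; [exact Ci_neq_0|]. pose proof PI_RGT_0.
  intros X. apply RtoC_inj in X. lra.
Qed.

(** Multiplying [transfer] by mu - 1 leaves Psi/(Psi - l) = 1 + l/(Psi - l). The constant 1
    integrates to 0 against [cis (INR t * s)] because t >= 1, and the rest is l times the noise
    integrand. *)
Lemma Vcoef_S (t : nat) : (1 <= t)%nat ->
  (Vcoef Psi (S t) l = Vcoef Psi t l + RtoC l * Ucoef Psi t l)%C.
Proof.
  intros Ht. rewrite !Vcoef_fourier, Ucoef_fourier by lia.
  set (k := fun s => (Ci * cis (INR t * s))%C).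
  set (f := fun s => (transfer Psi l (cis s) * k s)%C).
  set (g := fun s => (resolvent Psi l (cis s) * k s)%C).
  assert (Cf : forall s, continuous (U := C_UniformSpace) f s).
  { intros s. apply continuous_Cmult; [apply continuous_transfer_circle | apply continuous_fourier_kernel]. }
  assert (Cg : forall s, continuous (U := C_UniformSpace) g s).
  { intros s. apply continuous_Cmult; [apply continuous_resolvent_circle | apply continuous_fourier_kernel]. }
  assert (If := RInt_correct (V := C_R_CompleteNormedModule) f 0 (2 * PI) (ex_CInt f _ _ Cf)).
  assert (Ig := RInt_correct (V := C_R_CompleteNormedModule) g 0 (2 * PI) (ex_CInt g _ _ Cg)).
  assert (Ik := RInt_correct (V := C_R_CompleteNormedModule) k 0 (2 * PI)
    (ex_CInt k _ _ (continuous_fourier_kernel t))).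
  unfold k in Ik at 2. rewrite (CInt_cis t Ht) in Ik.
  apply (is_CInt_Cmult_l (RtoC l)) in Ig.
  assert (E := is_RInt_plus (V := C_R_NormedModule) _ _ _ _ _ _ If
    (is_RInt_plus (V := C_R_NormedModule) _ _ _ _ _ _ Ik Ig)).
  assert (X : CInt (fun s => transfer Psi l (cis s) * (Ci * cis (INR (S t) * s)))%C 0 (2 * PI) =
    (CInt f 0 (2 * PI) + (RtoC 0 + RtoC l * CInt g 0 (2 * PI)))%C).
  { apply is_RInt_unique. eapply is_RInt_ext; [|exact E].
    rewrite Rmin_left, Rmax_right by (pose proof PI_RGT_0; lra). intros s Hs0.
    assert (A0 := corner_avoids _ _ _ _ _ _ H Hl Hs (cis s) ltac:(rewrite Cmod_cis; lra)).
    assert (N1 := Cminus_neq_0 _ _ (cis_neq_1 s Hs0)).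
    rewrite S_INR. replace ((INR t + 1) * s) with (s + INR t * s) by ring.
    rewrite cis_plus.
    change ((f s + (k s + RtoC l * g s))%C = (transfer Psi l (cis s) * (Ci * (cis s * cis (INR t * s))))%C).
    unfold f, g, k, transfer, resolvent. field. split; assumption. }
  rewrite X.
  change (CInt (fun s => transfer Psi l (cis s) * (Ci * cis (INR t * s)))%C 0 (2 * PI))
    with (CInt f 0 (2 * PI)).
  change (CInt (fun s => resolvent Psi l (cis s) * (Ci * cis (INR t * s)))%C 0 (2 * PI))
    with (CInt g 0 (2 * PI)).
  generalize (CInt f 0 (2 * PI)) (CInt g 0 (2 * PI)). intros a b.
  change C in a, b. ring.
Qed.

End Coefficients.

Lemma Cmod_fourier_kernel (z : C) (t : nat) (s : R) : Cmod (z * (Ci * cis (INR t * s))) = Cmod z.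
Proof. rewrite !Cmod_mult, Cmod_Ci, Cmod_cis. ring. Qed.

(** The normalisation 1/(2 PI) absorbs the factor 2 in the bounds through primitives. *)
Lemma Cmod_coef_le (z w : C) (L : R) : z = (/ (RtoC (2 * PI) * Ci) * w)%C ->
  0 <= L -> Cmod w <= 2 * L -> Cmod z <= L.
Proof.
  intros -> HL Hw. rewrite Cmod_mult, Cmod_inv_two_PI_Ci. pose proof PI2_1.
  apply Rmult_le_reg_l with (2 * PI); [lra|]. rewrite <- Rmult_assoc, Rinv_r by lra. nra.
Qed.

Lemma inv_Rpower_le (c x a y : R) : 0 < c -> c * Rpower x a <= y -> / y <= / c * Rpower x (- a).
Proof.
  intros Hc H. pose proof (Rpower_pos x a). rewrite Rpower_Ropp, <- Rinv_mult.
  apply Rinv_le_contravar; [nra | exact H].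
Qed.

(** * Bounds on the coefficients for a single eigenvalue l = h^theta *)

Section Bounds.

Variables (lam : nat -> R) (Psi dPsi : C -> C) (theta c0 h c K : R).
Hypothesis (H : corner_map_with lam Psi dPsi theta c0).
Hypothesis (Hh : 0 < h) (Hc : 0 < c) (HK : 0 < K).
Let l := Rpower h theta.
Hypothesis (Hl : l <= lam 0%nat).
Hypothesis (Hs : forall z, 1 < Cmod z -> Psi z <> RtoC l).
Hypothesis (E1 : forall s, 0 < s < 2 * PI ->
  Cmod (Psi (cis s)) <= K * Rpower (Rmin s (2 * PI - s)) theta).
Hypothesis (E2 : forall s, 0 < s < 2 * PI ->
  Cmod (dPsi (cis s)) <= K * Rpower (Rmin s (2 * PI - s)) (theta - 1)).
Hypothesis (E3 : forall s, 0 < s < 2 * PI ->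
  c * Rpower (Rmin s (2 * PI - s) + h) theta <= Cmod (Psi (cis s) - RtoC l)).

Let Hl' : 0 < l <= lam 0%nat := conj (Rpower_pos h theta) Hl.
Let Ht : 1 < theta < 2 := cm_theta _ _ _ _ _ H.

Lemma Rmin_corner_pos (s : R) : 0 < s < 2 * PI -> 0 < Rmin s (2 * PI - s).
Proof. intros. apply Rmin_pos; lra. Qed.

Lemma circle_avoids (s : R) : (Psi (cis s) - RtoC l)%C <> RtoC 0.
Proof. apply (corner_avoids _ _ _ _ _ _ H Hl' Hs). rewrite Cmod_cis. lra. Qed.

Lemma Cmod_resolvent_le (s : R) : 0 < s < 2 * PI ->
  Cmod (resolvent Psi l (cis s)) <= / c * Rpower (Rmin s (2 * PI - s) + h) (- theta).
Proof.
  intros Hs0. unfold resolvent. rewrite Cmod_inv by apply circle_avoids.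
  apply inv_Rpower_le; [exact Hc | now apply E3].
Qed.

(** The majorant (d + h)^(-theta) / c has integral of order h^(1 - theta) = h / l. *)
Lemma Ucoef_le (t : nat) : (1 <= t)%nat ->
  Cmod (Ucoef Psi t l) <= / c / (theta - 1) * Rpower h (1 - theta).
Proof.
  intros Ht1. assert (Ic : 0 < / c) by now apply Rinv_0_lt_compat.
  destruct (bound_shifted_power (/ c) theta h ltac:(lra) ltac:(lra) Hh) as [B1 [B2 [B3 B4]]].
  destruct (symmetrised_bound _ _ _ B1 B2 B3 B4) as [S1 [S2 [S3 S4]]].
  apply (Cmod_coef_le _ _ _ (Ucoef_fourier Psi t l Ht1)).
  - pose proof (Rpower_pos h (1 - theta)). apply Rmult_le_pos; [|lra].
    apply Rdiv_le_0_compat; lra.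
  - eapply Cmod_RInt_primitive_le.
    + pose proof PI_RGT_0. lra.
    + intros s. apply continuous_Cmult; [|apply continuous_fourier_kernel].
      exact (continuous_resolvent_circle _ _ _ _ _ _ H Hl' Hs s).
    + intros s Hs0. rewrite Cmod_fourier_kernel.
      eapply Rle_trans; [apply Cmod_resolvent_le, Hs0 | apply (S1 s Hs0)].
    + exact S2.
    + exact S3.
    + exact S4.
Qed.

Lemma is_derive_boundary (s : R) :
  is_derive_curve (fun x => Psi (cis x)) s (Ci * cis s * dPsi (cis s))%C.
Proof.
  exact (boundary_derive _ _ s (cm_holomorphic _ _ _ _ _ H) (cm_cont _ _ _ _ _ H)
    (cm_C1 _ _ _ _ _ H)).
Qed.

(** The derivative of the resolvent is at most (K/c^2) d^(theta-1) (d + h)^(-2 theta), hence at most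
    (K/c^2) (d + h)^(-theta-1), with integral of order h^(-theta) = 1/l; integration by parts
    supplies 1/t. *)
Lemma Ucoef_decay (t : nat) : (1 <= t)%nat ->
  Cmod (Ucoef Psi t l) <= K / c ^ 2 / theta / (INR t * l).
Proof.
  intros Ht1. assert (Ht0 : 0 < INR t) by (apply lt_0_INR; lia).
  assert (HA : 0 < K / c ^ 2) by (apply Rdiv_lt_0_compat; [lra | apply pow_lt; lra]).
  destruct (bound_shifted_power (K / c ^ 2) (theta + 1) h ltac:(lra) ltac:(lra) Hh)
    as [B1 [B2 [B3 B4]]].
  destruct (symmetrised_bound _ _ _ B1 B2 B3 B4) as [S1 [S2 [S3 S4]]].
  assert (X : K / c ^ 2 / (theta + 1 - 1) * Rpower h (1 - (theta + 1)) = K / c ^ 2 / theta / l).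
  { replace (1 - (theta + 1)) with (- theta) by ring. rewrite Rpower_Ropp. fold l.
    replace (theta + 1 - 1) with theta by ring. reflexivity. }
  assert (P : 0 < K / c ^ 2 / theta / l).
  { apply Rdiv_lt_0_compat; [apply Rdiv_lt_0_compat; lra | apply Hl']. }
  apply (Cmod_coef_le _ _ _ (Ucoef_fourier Psi t l Ht1)).
  - left. replace (K / c ^ 2 / theta / (INR t * l)) with (K / c ^ 2 / theta / l / INR t)
      by (field; pose proof (proj1 Hl'); repeat split; lra).
    apply Rdiv_lt_0_compat; lra.
  - replace (2 * (K / c ^ 2 / theta / (INR t * l))) with
      (2 * (K / c ^ 2 / (theta + 1 - 1) * Rpower h (1 - (theta + 1))) / INR t)
      by (rewrite X; field; pose proof (proj1 Hl'); repeat split; lra).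
    eapply (fourier_decay (fun s => resolvent Psi l (cis s))
      (fun s => (Ci * cis s * resolvent' Psi dPsi l (cis s))%C));
      [exact Ht1 | | | | | | exact S2 | exact S3 | exact S4].
    + now rewrite cis_0, cis_2PI.
    + exact (continuous_resolvent_circle _ _ _ _ _ _ H Hl' Hs).
    + intros s Hs0. apply is_derive_curve_resolvent; [apply is_derive_boundary | apply circle_avoids].
    + intros s Hs0. apply continuous_Cmult.
      * apply continuous_Cmult; [apply continuous_const | apply continuous_cis, continuous_id].
      * apply (continuous_resolvent'_comp _ _ _ _ _ _ H Hl' Hs R_UniformSpace cis).
        -- intros y. rewrite Cmod_cis. lra.
        -- apply continuous_cis, continuous_id.
    + intros s Hs0. eapply Rle_trans; [|apply (S1 s Hs0)].
      pose proof (Rmin_corner_pos s Hs0) as Hm. set (m := Rmin s (2 * PI - s)) in *.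
      unfold resolvent'. rewrite !Cmod_mult, Cmod_Ci, Cmod_cis, !Rmult_1_l.
      rewrite Cmod_div by (apply Cmult_neq_0; apply circle_avoids).
      rewrite Cmod_opp, Cmod_mult. unfold Rdiv at 1. rewrite Rinv_mult.
      assert (R1 := inv_Rpower_le c _ theta _ Hc (E3 s Hs0)). fold m in R1.
      assert (R0 : 0 <= / Cmod (Psi (cis s) - RtoC l)).
      { left. apply Rinv_0_lt_compat, Cmod_gt_0, circle_avoids. }
      assert (R2 := E2 s Hs0). fold m in R2.
      assert (R3 : Rpower m (theta - 1) <= Rpower (m + h) (theta - 1)) by (apply Rpower_le_l; lra).
      apply Rle_trans with (K * Rpower (m + h) (theta - 1) *
        ((/ c * Rpower (m + h) (- theta)) * (/ c * Rpower (m + h) (- theta)))).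
      * apply Rmult_le_compat; [apply Cmod_ge_0 | nra | |].
        -- eapply Rle_trans; [exact R2|]. apply Rmult_le_compat_l; lra.
        -- apply Rmult_le_compat; lra.
      * right. replace (- (theta + 1)) with ((theta - 1) + (- theta + - theta)) by ring.
        rewrite !Rpower_plus. field. lra.
Qed.

(** Both terms of [transfer'] are bounded by multiples of d^(theta-2) (d + h)^(-theta), whose
    integral is of order 1/h: the first because l <= (d + h)^theta, the second by the bound on Psi
    itself. The factors 2 and 4 come from |[cis s] - 1| >= d/2. *)
Lemma Vcoef_decay (t : nat) : (1 <= t)%nat ->
  Cmod (Vcoef Psi t l) <= (2 * K / c ^ 2 + 4 * K / c) / (theta - 1) / (INR t * h).
Proof.
  intros Ht1. assert (Ht0 : 0 < INR t) by (apply lt_0_INR; lia).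
  set (A := 2 * K / c ^ 2 + 4 * K / c).
  assert (Pc : 0 < c ^ 2) by (apply pow_lt; lra).
  assert (HA : 0 < A).
  { apply Rplus_lt_0_compat; apply Rdiv_lt_0_compat; lra. }
  destruct (bound_corner_power A theta h ltac:(lra) ltac:(lra) Hh) as [B1 [B2 [B3 B4]]].
  destruct (symmetrised_bound _ _ _ B1 B2 B3 B4) as [S1 [S2 [S3 S4]]].
  apply (Cmod_coef_le _ _ _ (Vcoef_fourier Psi t l Ht1)).
  - left. repeat apply Rdiv_lt_0_compat; try lra. apply Rmult_lt_0_compat; lra.
  - replace (2 * (A / (theta - 1) / (INR t * h))) with (2 * (A / ((theta - 1) * h)) / INR t)
      by (field; repeat split; lra).
    eapply (fourier_decay (fun s => transfer Psi l (cis s))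
      (fun s => (Ci * cis s * transfer' Psi dPsi l (cis s))%C));
      [exact Ht1 | | | | | | exact S2 | exact S3 | exact S4].
    + now rewrite cis_0, cis_2PI.
    + exact (continuous_transfer_circle _ _ _ _ _ _ H Hl' Hs).
    + intros s Hs0. apply is_derive_curve_transfer.
      * apply is_derive_curve_cis.
      * apply is_derive_boundary.
      * apply circle_avoids.
      * now apply cis_neq_1.
    + intros s Hs0. apply continuous_Cmult.
      * apply continuous_Cmult; [apply continuous_const | apply continuous_cis, continuous_id].
      * apply (continuous_transfer'_comp _ _ _ _ _ _ H Hl' Hs R_UniformSpace cis).
        -- intros y. rewrite Cmod_cis. lra.
        -- apply continuous_cis, continuous_id.
        -- now apply cis_neq_1.
    + intros s Hs0. eapply Rle_trans; [|apply (S1 s Hs0)].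
      pose proof (Rmin_corner_pos s Hs0) as Hm.
      pose proof (Cmod_cis_minus_1_bounds s ltac:(lra)) as [D1 _].
      assert (R1 := inv_Rpower_le c _ theta _ Hc (E3 s Hs0)).
      assert (R2 := E2 s Hs0). assert (R4 := E1 s Hs0).
      set (m := Rmin s (2 * PI - s)) in *.
      pose proof (circle_avoids s) as A0.
      pose proof (Cminus_neq_0 _ _ (cis_neq_1 s Hs0)) as N1.
      unfold transfer'. rewrite !Cmod_mult, Cmod_Ci, Cmod_cis, !Rmult_1_l.
      assert (R0 : 0 <= / Cmod (Psi (cis s) - RtoC l)).
      { left. apply Rinv_0_lt_compat, Cmod_gt_0, A0. }
      assert (Rd : 0 <= / Cmod (cis s - RtoC 1)).
      { left. apply Rinv_0_lt_compat, Cmod_gt_0, N1. }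
      assert (Rd' : / Cmod (cis s - RtoC 1) <= 2 * Rpower m (- (1))).
      { rewrite Rpower_Ropp, Rpower_1 by lra.
        replace (2 * / m) with (/ (m / 2)) by (field; lra).
        apply Rinv_le_contravar; lra. }
      assert (Pm := Rpower_pos m (- (1))).
      assert (Ph := Rpower_pos (m + h) (- theta)).
      assert (Pm1 := Rpower_pos m (theta - 1)). assert (Pmt := Rpower_pos m theta).
      assert (R3 : l <= Rpower (m + h) theta) by (apply Rpower_le_l; lra).
      pose proof (proj1 Hl') as Hl0.
      set (r := / c * Rpower (m + h) (- theta)) in *.
      assert (Pr : 0 < r) by (apply Rmult_lt_0_compat; [now apply Rinv_0_lt_compat | exact Ph]).
      apply Rle_trans with (Rpower (m + h) theta * (K * Rpower m (theta - 1)) *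
        (r * r * (2 * Rpower m (- (1)))) +
        K * Rpower m theta * (r * ((2 * Rpower m (- (1))) * (2 * Rpower m (- (1)))))).
      * eapply Rle_trans; [apply Cmod_triangle|]. rewrite !Cmod_opp.
        apply Rplus_le_compat.
        -- rewrite Cmod_div by (repeat apply Cmult_neq_0; assumption).
           rewrite !Cmod_mult, Cmod_R, (Rabs_pos_eq l) by lra.
           unfold Rdiv. rewrite !Rinv_mult.
           apply Rmult_le_compat.
           ++ apply Rmult_le_pos; [lra | apply Cmod_ge_0].
           ++ repeat apply Rmult_le_pos; assumption.
           ++ apply Rmult_le_compat; [lra | apply Cmod_ge_0 | exact R3 | exact R2].
           ++ apply Rmult_le_compat; [nra | assumption | | exact Rd'].
              apply Rmult_le_compat; assumption.
        -- rewrite Cmod_div by (repeat apply Cmult_neq_0; assumption).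
           rewrite !Cmod_mult. unfold Rdiv. rewrite !Rinv_mult.
           apply Rmult_le_compat.
           ++ apply Cmod_ge_0.
           ++ repeat apply Rmult_le_pos; assumption.
           ++ exact R4.
           ++ apply Rmult_le_compat; [assumption | nra | exact R1 |].
              apply Rmult_le_compat; assumption.
      * right. unfold r, A.
        replace (Rpower m (theta - 2)) with (Rpower m theta * (Rpower m (- (1)) * Rpower m (- (1)))).
        2:{ rewrite <- !Rpower_plus. f_equal. ring. }
        replace (Rpower m (theta - 1)) with (Rpower m theta * Rpower m (- (1))).
        2:{ rewrite <- !Rpower_plus. f_equal. }
        replace (Rpower (m + h) theta) with (/ Rpower (m + h) (- theta)).
        2:{ now rewrite Rpower_Ropp, Rinv_inv. }
        field. split; lra.
Qed.

End Bounds.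

(** The point is uniformity: with h = l^(1/theta) one constant K serves all eigenvalues and all
    times. The rest of the argument uses the corner map only through these five facts. *)
Lemma coefficient_bounds (lam : nat -> R) (Psi dPsi : C -> C) (theta c0 : R) :
  corner_map_with lam Psi dPsi theta c0 -> (forall k, 0 < lam k <= lam 0%nat) ->
  exists K, 0 < K /\ forall k t, (1 <= t)%nat ->
    Cmod (Ucoef Psi t (lam k)) <= K * Rpower (lam k) (/ theta - 1) /\
    Cmod (Ucoef Psi t (lam k)) <= K / (INR t * lam k) /\
    Cmod (Vcoef Psi t (lam k)) <= K / (INR t * Rpower (lam k) (/ theta)) /\
    Vcoef Psi 1 (lam k) = RtoC 1 /\
    (Vcoef Psi (S t) (lam k) = Vcoef Psi t (lam k) + RtoC (lam k) * Ucoef Psi t (lam k))%C.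
Proof.
  intros H Hlam. pose proof (cm_theta _ _ _ _ _ H) as Ht.
  destruct (corner_estimates _ _ _ _ _ H (proj1 (Hlam 0%nat))) as [c [K [Hc [HK E]]]].
  set (K1 := / c / (theta - 1)). set (K2 := K / c ^ 2 / theta).
  set (K3 := (2 * K / c ^ 2 + 4 * K / c) / (theta - 1)).
  assert (Pc : 0 < c ^ 2) by (apply pow_lt; lra).
  assert (P1 : 0 < K1).
  { apply Rdiv_lt_0_compat; [now apply Rinv_0_lt_compat | lra]. }
  assert (P2 : 0 < K2) by (repeat apply Rdiv_lt_0_compat; lra).
  assert (P3 : 0 < K3).
  { apply Rdiv_lt_0_compat; [|lra]. apply Rplus_lt_0_compat; apply Rdiv_lt_0_compat; lra. }
  exists (K1 + K2 + K3). split; [lra|]. intros k t Ht1.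
  assert (Ht0 : 0 < INR t) by (apply lt_0_INR; lia).
  set (h := Rpower (lam k) (/ theta)). destruct (Hlam k) as [Hk1 Hk2].
  assert (Hh : 0 < h) by apply Rpower_pos.
  assert (Eh : Rpower h theta = lam k).
  { unfold h. rewrite Rpower_mult, Rinv_l, Rpower_1 by lra. reflexivity. }
  assert (Hs : forall z, 1 < Cmod z -> Psi z <> RtoC (lam k)) by apply (cm_stable _ _ _ _ _ H k).
  rewrite <- Eh in Hs, Hk1, Hk2.
  assert (E1 := fun s Hs => proj1 (E s Hs)).
  assert (E2 := fun s Hs => proj1 (proj2 (E s Hs))).
  assert (E3 := fun s Hs => proj2 (proj2 (E s Hs)) h Hh Hk2).
  assert (A1 := Ucoef_le _ _ _ _ _ _ _ H Hh Hc Hk2 Hs E3 t Ht1).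
  assert (A2 := Ucoef_decay _ _ _ _ _ _ _ _ H Hh Hc HK Hk2 Hs E2 E3 t Ht1).
  assert (A3 := Vcoef_decay _ _ _ _ _ _ _ _ H Hh Hc HK Hk2 Hs E1 E2 E3 t Ht1).
  assert (A4 := Vcoef_1 _ _ _ _ _ _ H (conj Hk1 Hk2) Hs).
  assert (A5 := Vcoef_S _ _ _ _ _ _ H (conj Hk1 Hk2) Hs t Ht1).
  rewrite Eh in *. fold K1 in A1. fold K2 in A2. fold K3 in A3.
  split; [|split; [|split; [|split]]]; [| | |exact A4 | exact A5].
  - eapply Rle_trans; [exact A1|]. apply Rmult_le_compat.
    + lra.
    + left; apply Rpower_pos.
    + lra.
    + right. unfold h. rewrite Rpower_mult. f_equal. field. lra.
  - eapply Rle_trans; [exact A2|]. apply Rmult_le_compat_r; [|lra].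
    left. apply Rinv_0_lt_compat, Rmult_lt_0_compat; lra.
  - eapply Rle_trans; [exact A3|]. apply Rmult_le_compat_r; [|lra].
    left. apply Rinv_0_lt_compat, Rmult_lt_0_compat; lra.
Qed.

(** * Series and power laws *)

(** Sums over i < n, so that the empty sum occurs; [sum_n] includes its upper index. *)
Fixpoint psum (f : nat -> R) (n : nat) : R :=
  match n with
  | O => 0
  | S n => psum f n + f n
  end.

Lemma psum_le (f g : nat -> R) (n : nat) :
  (forall i, (i < n)%nat -> f i <= g i) -> psum f n <= psum g n.
Proof.
  induction n as [|n IH]; simpl; intros H; [lra|].
  assert (psum f n <= psum g n) by (apply IH; intros; apply H; lia).
  assert (f n <= g n) by (apply H; lia). lra.
Qed.

Lemma psum_ext (f g : nat -> R) (n : nat) :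
  (forall i, (i < n)%nat -> f i = g i) -> psum f n = psum g n.
Proof. intros H. apply Rle_antisym; apply psum_le; intros; rewrite H; auto; lra. Qed.

Lemma psum_const (a : R) (n : nat) : psum (fun _ => a) n = INR n * a.
Proof. induction n as [|n IH]; [simpl; ring|]. rewrite S_INR. simpl. rewrite IH. ring. Qed.

Lemma psum_nonneg (f : nat -> R) (n : nat) : (forall i, 0 <= f i) -> 0 <= psum f n.
Proof. intros H. induction n; simpl; [lra|]. specialize (H n). lra. Qed.

Lemma psum_scal (a : R) (f : nat -> R) (n : nat) : psum (fun i => a * f i) n = a * psum f n.
Proof. induction n as [|n IH]; simpl; [ring|]. rewrite IH. ring. Qed.

Lemma psum_plus (f g : nat -> R) (n : nat) : psum (fun i => f i + g i) n = psum f n + psum g n.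
Proof. induction n as [|n IH]; simpl; [ring|]. rewrite IH. ring. Qed.

Lemma psum_split (f : nat -> R) (m n : nat) :
  psum f (m + n) = psum f m + psum (fun i => f (m + i)%nat) n.
Proof.
  induction n as [|n IH]; simpl; [rewrite Nat.add_0_r; ring|].
  rewrite Nat.add_succ_r. simpl. rewrite IH. ring.
Qed.

Lemma psum_switch (f : nat -> nat -> R) (m n : nat) :
  psum (fun i => psum (f i) n) m = psum (fun j => psum (fun i => f i j) m) n.
Proof.
  induction m as [|m IH]; simpl.
  - rewrite psum_const. ring.
  - rewrite IH. symmetry. apply psum_plus.
Qed.

(** By induction; the cross term 2 a f(n) is controlled by (a - n f(n))^2 >= 0 after division by n,
    and n = 0 is separate. *)
Lemma psum_Cauchy_Schwarz (f : nat -> R) (n : nat) :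
  psum f n ^ 2 <= INR n * psum (fun i => f i ^ 2) n.
Proof.
  induction n as [|n IH]; [simpl; lra|]. rewrite S_INR. cbn [psum].
  assert (Q : 0 <= psum (fun i => f i ^ 2) n) by (apply psum_nonneg; intros; apply pow2_ge_0).
  pose proof (pos_INR n) as Hn. set (a := psum f n) in *. set (q := psum (fun i => f i ^ 2) n) in *.
  assert (X : 2 * a * f n <= q + INR n * f n ^ 2).
  { destruct (Req_dec (INR n) 0) as [E|E].
    - rewrite E in IH |- *. pose proof (pow2_ge_0 a).
      assert (A : a = 0) by (apply Rsqr_0_uniq; unfold Rsqr; lra). rewrite A. lra.
    - assert (P : 0 < INR n) by lra.
      assert (0 <= (a - INR n * f n) ^ 2) by apply pow2_ge_0.
      apply Rmult_le_reg_l with (INR n); [exact P|]. nra. }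
  nra.
Qed.

Lemma sum_n_psum (f : nat -> R) (n : nat) : sum_n f n = psum f (S n).
Proof.
  induction n as [|n IH].
  - rewrite sum_O. simpl. ring.
  - rewrite sum_Sn, IH. reflexivity.
Qed.

Lemma psum_le_Series (u : nat -> R) (n : nat) :
  (forall k, 0 <= u k) -> ex_series u -> psum u n <= Series u.
Proof.
  intros Hu Hs. apply Rle_trans with (sum_n u n).
  - rewrite sum_n_psum. simpl. specialize (Hu n). lra.
  - apply (is_lim_seq_incr_compare (sum_n u)).
    + apply Series_correct in Hs. exact Hs.
    + intros k. rewrite !sum_n_psum. simpl. specialize (Hu (S k)). lra.
Qed.

Lemma ex_series_bounded (u : nat -> R) (B : R) :
  (forall k, 0 <= u k) -> (forall n, psum u n <= B) -> ex_series u /\ Series u <= B.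
Proof.
  intros Hu HB.
  assert (Hinc : forall n, sum_n u n <= sum_n u (S n)).
  { intros n. rewrite !sum_n_psum. simpl. specialize (Hu (S n)). lra. }
  assert (Hb : forall n, sum_n u n <= B) by (intros n; rewrite sum_n_psum; apply HB).
  assert (E : ex_series u).
  { destruct (ex_finite_lim_seq_incr _ B Hinc Hb) as [l Hl]. now exists l. }
  split; [exact E|]. apply Series_correct in E.
  apply (is_lim_seq_le (sum_n u) (fun _ => B) (Series u) B Hb E). apply is_lim_seq_const.
Qed.

Lemma ex_series_nonneg_le (u v : nat -> R) :
  (forall k, 0 <= u k <= v k) -> ex_series v -> ex_series u.
Proof.
  intros H Hv. apply (ex_series_le (V := R_CompleteNormedModule) u v); [|exact Hv].
  intros n. specialize (H n). change (Rabs (u n) <= v n). rewrite Rabs_pos_eq; lra.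
Qed.

(* [Series] of a divergent nonnegative sequence is 0. *)
Lemma ex_series_of_Series_neq_0 (u : nat -> R) :
  (forall k, 0 <= u k) -> Series u <> 0 -> ex_series u.
Proof.
  intros Hu H.
  assert (Hinc : forall n, sum_n u n <= sum_n u (S n)).
  { intros n. rewrite !sum_n_psum. simpl. specialize (Hu (S n)). lra. }
  assert (L := Lim_seq_correct _ (ex_lim_seq_incr _ Hinc)).
  unfold Series in H. destruct (Lim_seq (sum_n u)) as [l| |].
  - exists l. exact L.
  - now exfalso.
  - now exfalso.
Qed.

Lemma Rpower_telescope (x p : R) : 0 < x -> 1 < p ->
  (p - 1) * Rpower (x + 1) (- p) <= Rpower x (1 - p) - Rpower (x + 1) (1 - p).
Proof.
  intros Hx Hp.
  destruct (MVT_gen (fun y => Rpower y (1 - p)) x (x + 1)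
    (fun y => (1 - p) * Rpower y (1 - p - 1))) as [y [Hy E]].
  - rewrite Rmin_left, Rmax_right by lra. intros y Hy. apply is_derive_Rpower. lra.
  - rewrite Rmin_left, Rmax_right by lra. intros y Hy.
    apply continuity_pt_of_continuous, continuous_Rpower. lra.
  - rewrite Rmin_left, Rmax_right in Hy by lra.
    replace (1 - p - 1) with (- p) in E by ring.
    pose proof (Rpower_le_l_neg y (x + 1) (- p) ltac:(lra) ltac:(lra)). nra.
Qed.

(** Comparison with the integral from y, in telescoped form. The shift y is the index at which the
    noise changes regime, which makes the sum of order y^(1 - p). *)
Lemma shifted_p_series (p y : R) : 1 < p -> 0 < y ->
  ex_series (fun k => Rpower (INR k + 1 + y) (- p)) /\
  Series (fun k => Rpower (INR k + 1 + y) (- p)) <= Rpower y (1 - p) / (p - 1).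
Proof.
  intros Hp Hy. apply ex_series_bounded.
  - intros k. left. apply Rpower_pos.
  - intros n. apply Rle_trans with ((Rpower y (1 - p) - Rpower (INR n + y) (1 - p)) / (p - 1)).
    + induction n as [|n IH].
      * simpl. rewrite Rplus_0_l. unfold Rminus. rewrite Rplus_opp_r. unfold Rdiv. lra.
      * cbn [psum]. pose proof (pos_INR n).
        pose proof (Rpower_telescope (INR n + y) p ltac:(lra) Hp) as T.
        rewrite S_INR. replace (INR n + 1 + y) with (INR n + y + 1) by ring.
        set (A := Rpower (INR n + y + 1) (- p)) in *.
        set (D := Rpower (INR n + y + 1) (1 - p)) in *.
        assert (A <= (Rpower (INR n + y) (1 - p) - D) / (p - 1)).
        { apply Rmult_le_reg_l with (p - 1); [lra|]. field_simplify; lra. }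
        replace ((Rpower y (1 - p) - D) / (p - 1)) with
          ((Rpower y (1 - p) - Rpower (INR n + y) (1 - p)) / (p - 1) +
           (Rpower (INR n + y) (1 - p) - D) / (p - 1)) by (field; lra).
        lra.
    + apply Rmult_le_compat_r; [left; apply Rinv_0_lt_compat; lra|].
      pose proof (Rpower_pos (INR n + y) (1 - p)). lra.
Qed.

(** The larger of x and y is at least (x + y)/2. Two regimes, before and after a crossover, thus
    merge into one shifted power. *)
Lemma min_power_le (A x y z p : R) : 0 <= A -> 0 < p -> 0 < x -> 0 < y ->
  z <= A * Rpower x (- p) -> z <= A * Rpower y (- p) ->
  z <= A * Rpower 2 p * Rpower (x + y) (- p).
Proof.
  intros HA Hp Hx Hy H1 H2.
  assert (K : forall w, 0 < w -> x + y <= 2 * w ->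
    Rpower w (- p) <= Rpower 2 p * Rpower (x + y) (- p)).
  { intros w Hw Hle. replace (Rpower w (- p)) with (Rpower 2 p * Rpower (2 * w) (- p)).
    - apply Rmult_le_compat_l; [left; apply Rpower_pos|].
      apply Rpower_le_l_neg; lra.
    - rewrite <- Rpower_mult_distr, <- Rmult_assoc, <- Rpower_plus, Rplus_opp_r, Rpower_O by lra.
      ring. }
  rewrite Rmult_assoc. destruct (Rle_lt_dec x y) as [L|L].
  - eapply Rle_trans; [exact H2|]. apply Rmult_le_compat_l; [exact HA | apply K; lra].
  - eapply Rle_trans; [exact H1|]. apply Rmult_le_compat_l; [exact HA | apply K; lra].
Qed.

(** The finitely many exceptional indices are absorbed in the constant, as v is positive. *)
Lemma eventually_le_scaled (u v : nat -> R) (C : R) :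
  (forall k, 0 < v k) -> eventually (fun k => u k <= C * v k) ->
  exists C', 0 < C' /\ forall k, u k <= C' * v k.
Proof.
  intros Hv [N HN].
  assert (E : forall n, exists C', 0 < C' /\ C <= C' /\
    forall k, ((k < n)%nat \/ (N <= k)%nat) -> u k <= C' * v k).
  { induction n as [|n [C' [HC' [HC IH]]]].
    - exists (Rmax 1 C). pose proof (Rmax_l 1 C). pose proof (Rmax_r 1 C).
      split; [lra|]. split; [lra|]. intros k [Hk|Hk]; [lia|].
      eapply Rle_trans; [apply HN, Hk|]. apply Rmult_le_compat_r; [left; apply Hv | lra].
    - exists (Rmax C' (u n / v n)). pose proof (Rmax_l C' (u n / v n)). pose proof (Rmax_r C' (u n / v n)).
      split; [lra|]. split; [lra|]. intros k Hk.
      pose proof (Hv k). destruct (Nat.eq_dec k n) as [->|Nk].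
      + apply Rle_trans with (u n / v n * v n); [right; field; lra|].
        apply Rmult_le_compat_r; lra.
      + eapply Rle_trans; [apply IH; lia|]. apply Rmult_le_compat_r; lra. }
  destruct (E N) as [C' [HC' [_ H]]]. exists C'. split; [exact HC'|].
  intros k. apply H. lia.
Qed.

Lemma eigenvalue_bounds (lam : nat -> R) (Lambda nu : R) :
  0 < Lambda -> (forall k, 0 < lam k) -> power_law_eigenvalues lam Lambda nu ->
  exists c1 c2, 0 < c1 /\ 0 < c2 /\ forall k,
    c1 * Rpower (INR k + 1) (- nu) <= lam k <= c2 * Rpower (INR k + 1) (- nu).
Proof.
  intros HL Hpos H. assert (He : 0 < / 2) by lra. specialize (H (mkposreal _ He)).
  set (v := fun k => Rpower (INR k + 1) (- nu)).
  assert (Hv : forall k, 0 < v k) by (intros; apply Rpower_pos).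
  assert (X : eventually (fun k => Rabs (Lambda * v k - lam k) <= / 2 * (Lambda * v k))).
  { revert H. apply filter_imp. intros k Hk.
    change (Rabs (Lambda * Rpower (INR (S k)) (- nu) - lam k) <=
      / 2 * Rabs (Lambda * Rpower (INR (S k)) (- nu))) in Hk.
    rewrite S_INR in Hk. fold (v k) in Hk.
    rewrite (Rabs_pos_eq (Lambda * v k)) in Hk; [exact Hk|].
    specialize (Hv k). nra. }
  destruct (eventually_le_scaled lam v (2 * Lambda) Hv) as [c2 [Hc2 B2]].
  { revert X. apply filter_imp. intros k Hk. apply Rabs_le_between in Hk.
    specialize (Hv k). nra. }
  destruct (eventually_le_scaled v lam (2 / Lambda) Hpos) as [c1 [Hc1 B1]].
  { revert X. apply filter_imp. intros k Hk. apply Rabs_le_between in Hk.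
    apply Rmult_le_reg_l with (Lambda / 2); [lra|].
    replace (Lambda / 2 * (2 / Lambda * lam k)) with (lam k) by (field; lra). lra. }
  exists (/ c1), c2. split; [now apply Rinv_0_lt_compat|]. split; [exact Hc2|].
  intros k. split; [|apply B2]. fold (v k).
  apply Rmult_le_reg_l with c1; [exact Hc1|]. rewrite <- Rmult_assoc, Rinv_r, Rmult_1_l by lra.
  apply B1.
Qed.

Definition tail_sum (lam a : nat -> R) (x : R) : R :=
  Series (fun k => if Rlt_dec (lam k) x then a k else 0).

(** The upper bound extends to all x > 0, since beyond x0 the tail is at most the total mass. The
    lower bound has to stay local: the tail is bounded while x^zeta is not. *)
Lemma target_bounds (lam w : nat -> R) (Q zeta : R) :
  0 < Q -> (forall k, 0 < lam k) -> is_lim_seq lam 0 -> power_law_target lam w Q zeta -> 0 < zeta ->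
  let a := fun k => lam k * w k ^ 2 in
  ex_series a /\ exists c C x0, 0 < c /\ 0 < C /\ 0 < x0 /\
    (forall x, 0 < x < x0 -> c * Rpower x zeta <= tail_sum lam a x) /\
    (forall x, 0 < x -> tail_sum lam a x <= C * Rpower x zeta).
Proof.
  intros HQ Hpos Hlim H Hz a.
  assert (Ha : forall k, 0 <= a k).
  { intros k. apply Rmult_le_pos; [left; apply Hpos | apply pow2_ge_0]. }
  assert (Hi : forall x k, 0 <= (if Rlt_dec (lam k) x then a k else 0)).
  { intros x k. destruct Rlt_dec; [apply Ha | lra]. }
  assert (He : 0 < / 2) by lra. specialize (H (mkposreal _ He)).
  destruct H as [x0 H]. simpl in H.
  assert (X : forall x, 0 < x < x0 -> Rabs (Q * Rpower x zeta - tail_sum lam a x)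
    <= / 2 * (Q * Rpower x zeta)).
  { intros x Hx. assert (B : ball (M := R_UniformSpace) 0 x0 x).
    { change (Rabs (x - 0) < x0). rewrite Rminus_0_r, Rabs_pos_eq; lra. }
    specialize (H x B (proj1 Hx)).
    change (Rabs (Q * Rpower x zeta - tail_sum lam a x) <= / 2 * Rabs (Q * Rpower x zeta)) in H.
    rewrite (Rabs_pos_eq (Q * Rpower x zeta)) in H; [exact H|].
    pose proof (Rpower_pos x zeta). nra. }
  assert (L : forall x, 0 < x < x0 -> Q / 2 * Rpower x zeta <= tail_sum lam a x <= 2 * Q * Rpower x zeta).
  { intros x Hx. specialize (X x Hx). apply Rabs_le_between in X.
    pose proof (Rpower_pos x zeta). nra. }
  pose proof (cond_pos x0) as Hx0.
  assert (Ea : ex_series a).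
  { set (x := x0 / 2). assert (Hx : 0 < x < x0) by (unfold x; lra).
    (* The tail has a nonzero [Series], hence converges; as the eigenvalues tend to 0, it differs
       from the full series in finitely many terms. *)
    assert (Es : ex_series (fun k => if Rlt_dec (lam k) x then a k else 0)).
    { apply ex_series_of_Series_neq_0; [apply Hi|]. change (tail_sum lam a x <> 0).
      pose proof (proj1 (L x Hx)). pose proof (Rpower_pos x zeta).
      assert (0 < Q / 2 * Rpower x zeta) by (apply Rmult_lt_0_compat; lra). intros E0. lra. }
    destruct (proj2 (is_lim_seq_spec _ _) Hlim (mkposreal x (proj1 Hx))) as [N HN]. simpl in HN.
    apply (ex_series_incr_n (V := R_NormedModule) a N).
    apply (ex_series_incr_n (V := R_NormedModule) _ N) in Es.
    revert Es. apply ex_series_ext. intros k.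
    specialize (HN (N + k)%nat ltac:(lia)). rewrite Rminus_0_r, Rabs_pos_eq in HN by (left; apply Hpos).
    destruct Rlt_dec; [reflexivity | lra]. }
  split; [exact Ea|].
  assert (Sa : 0 <= Series a).
  { apply (psum_le_Series a 0) in Ea; [exact Ea | exact Ha]. }
  pose proof (Rpower_pos x0 zeta) as Px0.
  exists (Q / 2), (2 * Q + Series a / Rpower x0 zeta), x0.
  assert (Q0 : 0 <= Series a / Rpower x0 zeta) by (apply Rdiv_le_0_compat; lra).
  split; [lra|]. split; [lra|]. split; [exact Hx0|]. split; [intros x Hx; apply L, Hx|].
  intros x Hx. pose proof (Rpower_pos x zeta) as Px.
  destruct (Rlt_le_dec x x0) as [B|B].
  - eapply Rle_trans; [apply L; lra|]. apply Rmult_le_compat_r; lra.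
  - apply Rle_trans with (Series a).
    + apply Series_le; [|exact Ea]. intros k. split; [apply Hi|].
      destruct Rlt_dec; [lra | apply Ha].
    + apply Rle_trans with (Series a / Rpower x0 zeta * Rpower x zeta).
      * apply Rle_trans with (Series a / Rpower x0 zeta * Rpower x0 zeta); [right; field; lra|].
        apply Rmult_le_compat_l; [lra|]. apply Rpower_le_l; lra.
      * apply Rmult_le_compat_r; lra.
Qed.

(** * The renewal equation of the loss *)

Definition lsum {A : Type} (f : A -> R) (l : list A) : R := fold_right Rplus 0 (map f l).

Lemma lsum_app {A : Type} (f : A -> R) (l l' : list A) :
  lsum f (l ++ l') = lsum f l + lsum f l'.
Proof. unfold lsum. induction l as [|x l IH]; simpl; [ring|]. rewrite IH. ring. Qed.

Lemma lsum_map {A B : Type} (g : A -> B) (f : B -> R) (l : list A) :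
  lsum f (map g l) = lsum (fun x => f (g x)) l.
Proof. unfold lsum. now rewrite map_map. Qed.

Lemma lsum_scal {A : Type} (a : R) (f : A -> R) (l : list A) :
  lsum (fun x => a * f x) l = a * lsum f l.
Proof. unfold lsum. induction l as [|x l IH]; simpl; [ring|]. rewrite IH. ring. Qed.

Lemma lsum_ext {A : Type} (f g : A -> R) (l : list A) :
  (forall x, f x = g x) -> lsum f l = lsum g l.
Proof. intros H. unfold lsum. now rewrite (map_ext _ _ H). Qed.

(** [sublists] decides about the head of the list first, whereas the renewal equation singles out
    the last time: subsets are split by whether they contain the last element. *)
Lemma lsum_sublists_snoc {A : Type} (l : list A) (x : A) : forall f : list A -> R,
  lsum f (sublists (l ++ [x])) = lsum f (sublists l) + lsum (fun s => f (s ++ [x])) (sublists l).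
Proof.
  induction l as [|y l IH]; intros f.
  - unfold lsum. simpl. ring.
  - simpl. rewrite !lsum_app, !lsum_map, !IH. simpl. ring.
Qed.

Lemma lsum_by_length {A : Type} (f : list A -> R) (L : list (list A)) (n : nat) :
  (forall l, In l L -> (length l < n)%nat) ->
  lsum f L = psum (fun m => lsum f (filter (fun l => Nat.eqb (length l) m) L)) n.
Proof.
  induction L as [|l L IH]; intros H.
  - unfold lsum. simpl. rewrite psum_const. ring.
  - unfold lsum at 1. simpl. fold (lsum f L). rewrite IH by (intros; apply H; now right).
    rewrite (psum_ext (fun m => lsum f (if Nat.eqb (length l) m then _ else _))
      (fun m => (if Nat.eqb (length l) m then f l else 0) +
        lsum f (filter (fun l => Nat.eqb (length l) m) L))).
    2:{ intros m _. destruct Nat.eqb; unfold lsum; simpl; ring. }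
    rewrite psum_plus. f_equal.
    assert (E : forall k, psum (fun m => if Nat.eqb (length l) m then f l else 0) k =
      if Nat.ltb (length l) k then f l else 0).
    { induction k as [|k IHk]; simpl; [reflexivity|]. rewrite IHk.
      destruct (Nat.ltb_spec (length l) k), (Nat.ltb_spec (length l) (S k)),
        (Nat.eqb_spec (length l) k); try lia; ring. }
    rewrite E. specialize (H l (or_introl eq_refl)).
    destruct (Nat.ltb_spec (length l) n); [reflexivity | lia].
Qed.

Lemma sublists_length {A : Type} (l s : list A) : In s (sublists l) -> (length s <= length l)%nat.
Proof.
  revert s. induction l as [|x l IH]; simpl; intros s H.
  - destruct H as [<-|[]]. simpl. lia.
  - apply in_app_or in H. destruct H as [H|H].
    + apply in_map_iff in H. destruct H as [s' [<- H]]. simpl. specialize (IH _ H). lia.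
    + specialize (IH _ H). lia.
Qed.

Lemma filter_sublists_0 {A : Type} (l : list A) :
  filter (fun s => Nat.eqb (length s) 0) (sublists l) = [[]].
Proof.
  induction l as [|x l IH]; [reflexivity|]. simpl. rewrite filter_app, IH.
  replace (filter _ (map (cons x) (sublists l))) with (@nil (list A)); [reflexivity|].
  clear IH. induction (sublists l) as [|s L IH]; [reflexivity | exact IH].
Qed.

Lemma chain_snoc (U : nat -> R) (l : list nat) (q n : nat) : forall p,
  chain U p (l ++ [q]) n = U (n - q)%nat * chain U p l q.
Proof. induction l as [|x l IH]; intros p; simpl; [ring|]. rewrite IH. ring. Qed.

Lemma path_weight_snoc (U V : nat -> R) (l : list nat) (q n : nat) :
  path_weight U V (l ++ [q]) n = U (n - q)%nat * path_weight U V l q.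
Proof. destruct l as [|x l]; simpl; [ring|]. rewrite chain_snoc. ring. Qed.

Lemma sum_n_m_psum (f : nat -> R) (t : nat) : sum_n_m f 1 t = psum f (S t) - f 0%nat.
Proof.
  induction t as [|t IH].
  - rewrite sum_n_m_zero by lia. simpl. unfold zero; simpl. ring.
  - rewrite sum_n_Sm by lia. rewrite IH. unfold plus. simpl. ring.
Qed.

(** The double sum over m and over increasing m-tuples runs over all subsets of the times; the
    isolated signal term is the empty subset, m = 0. *)
Lemma loss_sublists (U V : nat -> R) (t : nat) :
  loss U V t = / 2 * lsum (fun l => path_weight U V l (t + 1)) (sublists (seq 1 t)).
Proof.
  unfold loss. f_equal. unfold increasing_tuples.
  rewrite (lsum_by_length _ _ (S t)).
  2:{ intros l Hl. apply sublists_length in Hl. rewrite length_seq in Hl. lia. }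
  rewrite (sum_n_m_psum (fun m => lsum (fun l => path_weight U V l (t + 1))
    (filter (fun l => Nat.eqb (length l) m) (sublists (seq 1 t))))).
  rewrite filter_sublists_0. unfold lsum at 2. simpl. ring.
Qed.

Lemma loss_renewal (U V : nat -> R) (t : nat) :
  loss U V t = / 2 * V (S t) + psum (fun s => U (t - s)%nat * loss U V s) t.
Proof.
  (* The range t of the intermediate times is decoupled from the endpoint n. Adding the time t + 1
     to the range contributes the paths whose last stop is t + 1, and these factor through the paths
     ending there. *)
  set (T := fun t n => lsum (fun l => path_weight U V l n) (sublists (seq 1 t))).
  assert (E : forall t n, T t n = V n + psum (fun s => U (n - S s)%nat * T s (S s)) t).
  { clear t. intros t n. induction t as [|t IH].
    - unfold T, lsum. simpl. ring.
    - cbn [psum]. rewrite <- Rplus_assoc, <- IH. unfold T at 1. rewrite seq_S, lsum_sublists_snoc.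
      fold (T t n). f_equal. simpl (1 + t)%nat.
      rewrite (lsum_ext _ (fun s => U (n - S t)%nat * path_weight U V s (S t)))
        by (intros; apply path_weight_snoc).
      apply lsum_scal. }
  assert (L : forall s, loss U V s = / 2 * T s (S s)).
  { intros s. rewrite loss_sublists. unfold T. now rewrite Nat.add_1_r. }
  rewrite L, E, Rmult_plus_distr_l, <- psum_scal. f_equal. apply psum_ext. intros s Hs.
  rewrite L. simpl. ring.
Qed.

(** * Rates of the noise and of the signal *)

Lemma Rpower_1_l (a : R) : Rpower 1 a = 1.
Proof. unfold Rpower. rewrite ln_1, Rmult_0_r. apply exp_0. Qed.

Lemma Rpower_sq (x a : R) : Rpower x a ^ 2 = Rpower x (2 * a).
Proof. replace (2 * a) with (a + a) by ring. rewrite Rpower_plus. ring. Qed.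

Lemma Rpower_2_pow (x : R) : 0 < x -> Rpower x 2 = x ^ 2.
Proof. intros. replace 2 with (1 + 1) at 1 by ring. rewrite Rpower_plus, Rpower_1 by lra. ring. Qed.

(* Each halving of [x] replaces the weights beyond [2 x] by [2^-p] times those at scale [2 x]. *)
Lemma weighted_series_le (lam a : nat -> R) (C p zeta : R) :
  (forall k, 0 < lam k) -> (forall k, 0 <= a k) -> ex_series a ->
  (forall x, 0 < x -> tail_sum lam a x <= C * Rpower x zeta) -> 0 < C -> 0 < zeta < p ->
  exists C', 0 < C' /\ forall x, 0 < x <= 1 ->
    ex_series (fun k => a k * Rmin 1 (Rpower (x / lam k) p)) /\
    Series (fun k => a k * Rmin 1 (Rpower (x / lam k) p)) <= C' * Rpower x zeta.
Proof.
  intros Hlam Ha Ea HT HC Hp.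
  set (S := fun x => Series (fun k => a k * Rmin 1 (Rpower (x / lam k) p))).
  assert (Hw : forall x k, 0 <= a k * Rmin 1 (Rpower (x / lam k) p) <= a k).
  { intros x k. pose proof (Rpower_pos (x / lam k) p). pose proof (Rmin_l 1 (Rpower (x / lam k) p)).
    assert (0 < Rmin 1 (Rpower (x / lam k) p)) by (apply Rmin_pos; lra).
    specialize (Ha k). split; nra. }
  assert (Es : forall x, ex_series (fun k => a k * Rmin 1 (Rpower (x / lam k) p))).
  { intros x. apply (ex_series_nonneg_le _ a (Hw x) Ea). }
  assert (Et : forall x, ex_series (fun k => if Rlt_dec (lam k) x then a k else 0)).
  { intros x. apply (ex_series_nonneg_le _ a); [|exact Ea]. intros k. specialize (Ha k).
    destruct Rlt_dec; lra. }
  set (q := Rpower 2 (- p)).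
  assert (Hq : 0 < q) by apply Rpower_pos.
  assert (Step : forall x, 0 < x -> S x <= C * Rpower (2 * x) zeta + q * S (2 * x)).
  { intros x Hx. unfold S. rewrite <- Series_scal_l.
    eapply Rle_trans; [|apply Rplus_le_compat_r, HT; lra].
    unfold tail_sum. rewrite <- Series_plus.
    - apply Series_le.
      + intros k. split; [apply Hw|]. specialize (Ha k).
        pose proof (Hlam k) as Hk. pose proof (Hw (2 * x) k).
        destruct Rlt_dec as [L|L].
        * pose proof (Hw x k). assert (0 <= q * (a k * Rmin 1 (Rpower (2 * x / lam k) p))) by nra. lra.
        * assert (B : 0 < 2 * x / lam k <= 1).
          { split; [apply Rdiv_lt_0_compat; lra|]. apply Rmult_le_reg_r with (lam k); [lra|].
            unfold Rdiv. rewrite Rmult_assoc, Rinv_l; lra. }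
          assert (B2 : Rpower (2 * x / lam k) p <= 1).
          { rewrite <- (Rpower_1_l p). apply Rpower_le_l; lra. }
          rewrite (Rmin_right 1 (Rpower (2 * x / lam k) p)) by exact B2.
          assert (E : Rpower (x / lam k) p = q * Rpower (2 * x / lam k) p).
          { replace (2 * x / lam k) with (2 * (x / lam k)) by (field; lra).
            unfold q. rewrite <- Rpower_mult_distr, <- Rmult_assoc, <- Rpower_plus by
              (try apply Rdiv_lt_0_compat; lra).
            replace (- p + p) with 0 by ring. rewrite Rpower_O by lra. ring. }
          rewrite Rplus_0_l. replace (q * (a k * Rpower (2 * x / lam k) p)) with
            (a k * Rpower (x / lam k) p) by (rewrite E; ring).
          apply Rmult_le_compat_l; [exact Ha | apply Rmin_r].
      + apply (ex_series_plus (V := R_NormedModule)); [apply Et|].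
        apply (ex_series_scal (V := R_NormedModule) q), Es.
    - apply Et.
    - apply (ex_series_scal (V := R_NormedModule) q), Es. }
  assert (Sa : forall x, S x <= Series a).
  { intros x. apply Series_le; [apply Hw | exact Ea]. }
  assert (A0 : 0 <= Series a) by (apply (psum_le_Series a 0); assumption).
  set (z2 := Rpower 2 zeta). assert (Hz2 : 1 < z2).
  { unfold z2. rewrite <- (Rpower_O 2) by lra. apply Rpower_lt; lra. }
  set (r := q * z2). assert (Hr : 0 < r < 1).
  { unfold r, q, z2. rewrite <- Rpower_plus. split; [apply Rpower_pos|].
    rewrite <- (Rpower_O 2) by lra. apply Rpower_lt; lra. }
  (* The second summand solves C z2 + r C' = C', so the bound reproduces itself when x is halved (r
     < 1 because zeta < p); the first handles x >= 1. *)
  set (C' := Series a + C * z2 / (1 - r)).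
  assert (Q0 : 0 < C * z2 / (1 - r)) by (apply Rdiv_lt_0_compat; nra).
  assert (HC' : 0 < C') by (unfold C'; lra).
  exists C'. split; [exact HC'|].
  (* The induction is on the number of doublings that bring x above 1. *)
  assert (Ind : forall n x, 1 <= 2 ^ n * x -> 0 < x -> S x <= C' * Rpower x zeta).
  { induction n as [|n IH]; intros x Hn Hx.
    - simpl in Hn. apply Rle_trans with (C' * 1).
      + specialize (Sa x). unfold C'. lra.
      + apply Rmult_le_compat_l; [lra|]. rewrite <- (Rpower_1_l zeta). apply Rpower_le_l; lra.
    - assert (I2 := IH (2 * x) ltac:(simpl in Hn; lra) ltac:(lra)).
      eapply Rle_trans; [apply Step, Hx|].
      rewrite <- Rpower_mult_distr in * by lra. fold z2 in I2 |- *.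
      pose proof (Rpower_pos x zeta) as Px.
      apply Rle_trans with (C * (z2 * Rpower x zeta) + q * (C' * (z2 * Rpower x zeta))).
      + apply Rplus_le_compat_l, Rmult_le_compat_l; lra.
      + replace (C * (z2 * Rpower x zeta) + q * (C' * (z2 * Rpower x zeta))) with
          ((C * z2 + r * C') * Rpower x zeta) by (unfold r; ring).
        apply Rmult_le_compat_r; [lra|].
        assert (C * z2 = (1 - r) * (C * z2 / (1 - r))) by (field; lra).
        unfold C' in *. nra. }
  intros x Hx. split; [apply Es|].
  destruct (Pow_x_infinity 2 ltac:(rewrite Rabs_pos_eq; lra) (/ x)) as [n Hn].
  apply (Ind n); [|lra]. specialize (Hn n (Nat.le_refl n)).
  rewrite Rabs_pos_eq in Hn by (apply pow_le; lra).
  apply Rmult_le_reg_r with (/ x); [apply Rinv_0_lt_compat; lra|].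
  rewrite Rmult_1_l, Rmult_assoc, Rinv_r, Rmult_1_r by lra. lra.
Qed.

Section Rates.

Variables (lam w : nat -> R) (Psi : C -> C) (theta K c1 c2 nu : R).
Hypothesis (Ht : 1 < theta < 2) (HK : 0 < K) (Hlam : forall k, 0 < lam k <= lam 0%nat).
Hypothesis (HC : forall k t, (1 <= t)%nat ->
    Cmod (Ucoef Psi t (lam k)) <= K * Rpower (lam k) (/ theta - 1) /\
    Cmod (Ucoef Psi t (lam k)) <= K / (INR t * lam k) /\
    Cmod (Vcoef Psi t (lam k)) <= K / (INR t * Rpower (lam k) (/ theta)) /\
    Vcoef Psi 1 (lam k) = RtoC 1 /\
    (Vcoef Psi (S t) (lam k) = Vcoef Psi t (lam k) + RtoC (lam k) * Ucoef Psi t (lam k))%C).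

(** The increments of the signal coefficient telescope from its value 1 at time 1. The form with the
    sum is kept because the lower bound on the noise reads it backwards. *)
Lemma Vcoef_sub_1_le_psum (k n : nat) :
  Cmod (Vcoef Psi (S n) (lam k) - RtoC 1) <=
  lam k * psum (fun s => Cmod (Ucoef Psi (S s) (lam k))) n.
Proof.
  pose proof (proj1 (Hlam k)) as Hk. induction n as [|n IH].
  - destruct (HC k 1 (Nat.le_refl 1)) as [_ [_ [_ [-> _]]]].
    replace (RtoC 1 - RtoC 1)%C with (RtoC 0) by ring. rewrite Cmod_0. simpl. lra.
  - destruct (HC k (S n) ltac:(lia)) as [_ [_ [_ [_ ->]]]].
    replace (Vcoef Psi (S n) (lam k) + RtoC (lam k) * Ucoef Psi (S n) (lam k) - RtoC 1)%C with
      ((Vcoef Psi (S n) (lam k) - RtoC 1) + RtoC (lam k) * Ucoef Psi (S n) (lam k))%C by ring.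
    eapply Rle_trans; [apply Cmod_triangle|].
    rewrite Cmod_mult, Cmod_R, Rabs_pos_eq by lra. cbn [psum]. lra.
Qed.

Lemma psum_Ucoef_le (k n : nat) :
  lam k * psum (fun s => Cmod (Ucoef Psi (S s) (lam k))) n <= K * INR n * Rpower (lam k) (/ theta).
Proof.
  pose proof (proj1 (Hlam k)) as Hk.
  apply Rle_trans with (lam k * (INR n * (K * Rpower (lam k) (/ theta - 1)))).
  - apply Rmult_le_compat_l; [lra|]. rewrite <- psum_const. apply psum_le. intros i _.
    apply (HC k (S i)). lia.
  - right. rewrite Rpower_minus, Rpower_1 by lra. field. lra.
Qed.

Lemma Vcoef_sub_1_le (k t : nat) : (1 <= t)%nat ->
  Cmod (Vcoef Psi t (lam k) - RtoC 1) <= K * INR t * Rpower (lam k) (/ theta).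
Proof.
  intros H1. destruct t as [|n]; [lia|].
  eapply Rle_trans; [apply Vcoef_sub_1_le_psum|]. eapply Rle_trans; [apply psum_Ucoef_le|].
  rewrite S_INR. pose proof (Rpower_pos (lam k) (/ theta)). nra.
Qed.

Lemma Vcoef_le (k t : nat) : (1 <= t)%nat ->
  Cmod (Vcoef Psi t (lam k)) <= 1 + K * INR t * Rpower (lam k) (/ theta).
Proof.
  intros H1. pose proof (Vcoef_sub_1_le k t H1) as A.
  pose proof (Cmod_minus_ge (Vcoef Psi t (lam k)) (RtoC 1)) as B.
  rewrite (Cmod_R 1), Rabs_R1 in B. lra.
Qed.

Lemma Vcoef_ge (k t : nat) : (1 <= t)%nat ->
  1 - K * INR t * Rpower (lam k) (/ theta) <= Cmod (Vcoef Psi t (lam k)).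
Proof.
  intros H1. pose proof (Vcoef_sub_1_le k t H1) as A. rewrite Cmod_sub_sym in A.
  pose proof (Cmod_minus_ge (RtoC 1) (Vcoef Psi t (lam k))) as B.
  rewrite (Cmod_R 1), Rabs_R1 in B. lra.
Qed.

Lemma signal_summand_nonneg (k t : nat) : 0 <= lam k * w k ^ 2 * Cmod (Vcoef Psi t (lam k)) ^ 2.
Proof.
  pose proof (proj1 (Hlam k)). pose proof (pow2_ge_0 (w k)).
  pose proof (pow2_ge_0 (Cmod (Vcoef Psi t (lam k)))).
  apply Rmult_le_pos; [apply Rmult_le_pos; lra | lra].
Qed.

Lemma signal_ex_series (t : nat) : (1 <= t)%nat -> ex_series (fun k => lam k * w k ^ 2) ->
  ex_series (fun k => lam k * w k ^ 2 * Cmod (Vcoef Psi t (lam k)) ^ 2).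
Proof.
  intros H1 Ea. set (M := 1 + K * INR t * Rpower (lam 0%nat) (/ theta)).
  apply (ex_series_nonneg_le _ (fun k => M ^ 2 * (lam k * w k ^ 2))).
  - intros k. split; [apply signal_summand_nonneg|].
    pose proof (proj1 (Hlam k)). pose proof (pow2_ge_0 (w k)).
    rewrite Rmult_comm. apply Rmult_le_compat_r; [apply Rmult_le_pos; lra|].
    apply pow_incr. split; [apply Cmod_ge_0|].
    eapply Rle_trans; [apply Vcoef_le, H1|]. unfold M. apply Rplus_le_compat_l, Rmult_le_compat_l.
    + pose proof (pos_INR t). nra.
    + assert (0 < / theta) by (apply Rinv_0_lt_compat; lra). apply Rpower_le_l; [lra | apply Hlam].
  - apply (ex_series_scal (V := R_NormedModule) (M ^ 2)), Ea.
Qed.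

(** Eigenvalues below a small multiple of t^(-theta) have not been learned by time t: their
    coefficient is still at least 1/2, so a quarter of the corresponding tail survives. *)
Lemma signal_lower (zeta c x0 : R) :
  let a := fun k => lam k * w k ^ 2 in
  ex_series a -> 0 < c -> 0 < x0 -> 0 < zeta ->
  (forall x, 0 < x < x0 -> c * Rpower x zeta <= tail_sum lam a x) ->
  exists c', 0 < c' /\ forall t, (1 <= t)%nat ->
    c' * Rpower (INR t) (- (theta * zeta)) <= Vt lam w Psi t.
Proof.
  intros a Ea Hc Hx0 Hz HT.
  (* Chosen so that K t x^(1/theta) <= 1/2 for x = x1 t^(-theta), with x inside the range of the
     tail estimate. *)
  set (x1 := Rmin (x0 / 2) (Rpower (2 * K) (- theta))).
  assert (Hx1 : 0 < x1) by (apply Rmin_pos; [lra | apply Rpower_pos]).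
  exists (/ 4 * (c * Rpower x1 zeta)). pose proof (Rpower_pos x1 zeta) as Px1.
  split; [nra|]. intros t H1.
  assert (Ht1 : 1 <= INR t) by (apply (le_INR 1); exact H1).
  set (x := x1 * Rpower (INR t) (- theta)).
  assert (Ptt := Rpower_pos (INR t) (- theta)).
  assert (Pt1 : Rpower (INR t) (- theta) <= 1).
  { rewrite <- (Rpower_1_l (- theta)). apply Rpower_le_l_neg; lra. }
  assert (Hx : 0 < x < x0).
  { unfold x. pose proof (Rmin_l (x0 / 2) (Rpower (2 * K) (- theta))). fold x1 in H. split; nra. }
  assert (Hxt : Rpower x (/ theta) <= / (2 * K) * / INR t).
  { apply Rle_trans with (Rpower (Rpower (2 * K) (- theta) * Rpower (INR t) (- theta)) (/ theta)).
    - apply Rpower_le_l; [left; apply Rinv_0_lt_compat; lra|]. split; [apply Hx|].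
      apply Rmult_le_compat_r; [lra | apply Rmin_r].
    - right. rewrite <- Rpower_mult_distr, !Rpower_mult by (try apply Rpower_pos; lra).
      replace (- theta * / theta) with (- (1)) by (field; lra).
      rewrite !Rpower_Ropp, !Rpower_1 by lra. reflexivity. }
  apply Rle_trans with (/ 4 * tail_sum lam a x).
  - specialize (HT x Hx). unfold x in HT at 1.
    rewrite <- Rpower_mult_distr, Rpower_mult in HT by (try apply Rpower_pos; lra).
    replace (- theta * zeta) with (- (theta * zeta)) in HT by ring. lra.
  - unfold Vt, tail_sum. rewrite <- Series_scal_l. apply Series_le; [|now apply signal_ex_series].
    intros k. pose proof (proj1 (Hlam k)) as Hk. pose proof (pow2_ge_0 (w k)) as Hw.
    assert (Hak : 0 <= a k) by (apply Rmult_le_pos; lra).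
    destruct Rlt_dec as [L|L].
    + split; [lra|]. rewrite Rmult_comm. fold (a k). apply Rmult_le_compat_l; [exact Hak|].
      replace (/ 4) with ((/ 2) ^ 2) by field. apply pow_incr. split; [lra|].
      eapply Rle_trans; [|apply Vcoef_ge, H1].
      assert (Rpower (lam k) (/ theta) <= / (2 * K) * / INR t).
      { eapply Rle_trans; [|exact Hxt].
        apply Rpower_le_l; [left; apply Rinv_0_lt_compat; lra | lra]. }
      assert (K * INR t * Rpower (lam k) (/ theta) <= K * INR t * (/ (2 * K) * / INR t)).
      { apply Rmult_le_compat_l; [nra | assumption]. }
      replace (K * INR t * (/ (2 * K) * / INR t)) with (/ 2) in * by (field; lra). lra.
    + rewrite Rmult_0_r. split; [lra | apply signal_summand_nonneg].
Qed.

(** The squared coefficient is at most (1 + K)^2 min(1, (t h)^(-2)), and (t h)^(-2) =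
    (x/l)^(2/theta) for x = t^(-theta). The weighted tail estimate applies with p = 2/theta, and its
    condition zeta < p is theta zeta < 2. *)
Lemma signal_upper (zeta C0 : R) :
  let a := fun k => lam k * w k ^ 2 in
  ex_series a -> 0 < C0 -> 0 < zeta -> theta * zeta < 2 ->
  (forall x, 0 < x -> tail_sum lam a x <= C0 * Rpower x zeta) ->
  exists C', 0 < C' /\ forall t, (1 <= t)%nat ->
    0 <= Vt lam w Psi t <= C' * Rpower (INR t) (- (theta * zeta)).
Proof.
  intros a Ea HC0 Hz Htz HT.
  assert (Ha : forall k, 0 <= a k).
  { intros k. apply Rmult_le_pos; [left; apply Hlam | apply pow2_ge_0]. }
  destruct (weighted_series_le lam a C0 (2 / theta) zeta (fun k => proj1 (Hlam k)) Ha Ea HT HC0)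
    as [C1 [HC1 H]].
  { split; [lra|]. apply Rmult_lt_reg_r with theta; [lra|].
    unfold Rdiv. rewrite Rmult_assoc, Rinv_l; lra. }
  exists ((1 + K) ^ 2 * C1). assert (PK : 0 < (1 + K) ^ 2) by (apply pow_lt; lra).
  split; [nra|]. intros t H1.
  assert (Ht1 : 1 <= INR t) by (apply (le_INR 1); exact H1).
  set (x := Rpower (INR t) (- theta)).
  assert (Hx : 0 < x <= 1).
  { split; [apply Rpower_pos|]. rewrite <- (Rpower_1_l (- theta)). apply Rpower_le_l_neg; lra. }
  destruct (H x Hx) as [E B]. split.
  - apply (psum_le_Series _ 0); [intros; apply signal_summand_nonneg | now apply signal_ex_series].
  - apply Rle_trans with ((1 + K) ^ 2 * Series (fun k => a k * Rmin 1 (Rpower (x / lam k) (2 / theta)))).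
    + rewrite <- Series_scal_l. apply Series_le.
      2:{ apply (ex_series_scal (V := R_NormedModule) ((1 + K) ^ 2)), E. }
      intros k. split; [apply signal_summand_nonneg|]. fold (a k).
      rewrite <- Rmult_assoc, (Rmult_comm _ (a k)), Rmult_assoc.
      apply Rmult_le_compat_l; [apply Ha|].
      pose proof (proj1 (Hlam k)) as Hk.
      set (h := Rpower (lam k) (/ theta)). assert (Hh : 0 < h) by apply Rpower_pos.
      assert (Eh : Rpower (x / lam k) (2 / theta) = (/ (INR t * h)) ^ 2).
      { unfold Rdiv at 1. rewrite <- Rpower_mult_distr by (try apply Rinv_0_lt_compat; lra).
        unfold x. rewrite Rpower_mult.
        replace (- theta * (2 / theta)) with (- (2)) by (field; lra).
        rewrite Rpower_Ropp, Rpower_2_pow by lra.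
        replace (/ lam k) with (Rpower (lam k) (- (1))) by (rewrite Rpower_Ropp, Rpower_1; lra).
        rewrite Rpower_mult. replace (- (1) * (2 / theta)) with (- (2 * / theta)) by (field; lra).
        rewrite Rpower_Ropp, <- Rpower_sq. fold h. field. lra. }
      rewrite Eh. clear Eh.
      assert (Pth : 0 < INR t * h) by (apply Rmult_lt_0_compat; lra).
      destruct (Rle_lt_dec (INR t * h) 1) as [L|L].
      * rewrite Rmin_left.
        -- rewrite Rmult_1_r. apply pow_incr. split; [apply Cmod_ge_0|].
           eapply Rle_trans; [apply Vcoef_le, H1|]. fold h. nra.
        -- rewrite <- (pow1 2). apply pow_incr. split; [lra|]. rewrite <- Rinv_1.
           apply Rinv_le_contravar; lra.
      * rewrite Rmin_right.
        -- rewrite <- Rpow_mult_distr. apply pow_incr. split; [apply Cmod_ge_0|].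
           destruct (HC k t H1) as [_ [_ [A _]]]. fold h in A. eapply Rle_trans; [exact A|].
           apply Rmult_le_compat_r; [left; now apply Rinv_0_lt_compat | lra].
        -- rewrite <- (pow1 2). apply pow_incr. split; [left; now apply Rinv_0_lt_compat|].
           rewrite <- Rinv_1. apply Rinv_le_contravar; lra.
    + rewrite Rmult_assoc. apply Rmult_le_compat_l; [lra|].
      eapply Rle_trans; [exact B|]. right. f_equal. unfold x. rewrite Rpower_mult. f_equal. ring.
Qed.

Hypothesis (Hnu : 1 < nu) (Hc1 : 0 < c1) (Hc2 : 0 < c2).
Hypothesis (Heig : forall k,
  c1 * Rpower (INR k + 1) (- nu) <= lam k <= c2 * Rpower (INR k + 1) (- nu)).

Lemma noise_summand_nonneg (k t : nat) : 0 <= lam k ^ 2 * Cmod (Ucoef Psi t (lam k)) ^ 2.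
Proof. apply Rmult_le_pos; apply pow2_ge_0. Qed.

(** Here l |U| <= K min(h, 1/t) with h at most of order (k+1)^(-nu/theta); the two bounds cross at k
    of order y = t^(theta/nu). Squaring gives p = 2 nu/theta > 1 and the sum y^(1-p) = t^(theta/nu -
    2). Summability is recorded because [Series] has a default value on divergent series. *)
Lemma noise_upper : exists C', 0 < C' /\ forall t, (1 <= t)%nat ->
  ex_series (fun k => lam k ^ 2 * Cmod (Ucoef Psi t (lam k)) ^ 2) /\
  Series (fun k => lam k ^ 2 * Cmod (Ucoef Psi t (lam k)) ^ 2) <=
    C' * Rpower (INR t) (theta / nu - 2).
Proof.
  set (p := 2 * nu / theta).
  assert (Hp : 1 < p).
  { unfold p. apply Rmult_lt_reg_r with theta; [lra|]. unfold Rdiv.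
    rewrite Rmult_assoc, Rinv_l; lra. }
  set (A := K ^ 2 * (1 + Rpower c2 (2 / theta))).
  pose proof (Rpower_pos c2 (2 / theta)) as Pc2.
  assert (PK : 0 < K ^ 2) by (apply pow_lt; lra).
  assert (HA : 0 < A) by (apply Rmult_lt_0_compat; lra).
  pose proof (Rpower_pos 2 p) as P2.
  exists (A * Rpower 2 p * / (p - 1)).
  assert (Ip : 0 < / (p - 1)) by (apply Rinv_0_lt_compat; lra).
  split; [repeat apply Rmult_lt_0_compat; lra|]. intros t H1.
  assert (Ht1 : 1 <= INR t) by (apply (le_INR 1); exact H1).
  set (y := Rpower (INR t) (theta / nu)). assert (Hy : 0 < y) by apply Rpower_pos.
  destruct (shifted_p_series p y Hp Hy) as [E B].
  assert (T : forall k, 0 <= lam k ^ 2 * Cmod (Ucoef Psi t (lam k)) ^ 2 <=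
    A * Rpower 2 p * Rpower (INR k + 1 + y) (- p)).
  { intros k. split; [apply noise_summand_nonneg|].
    pose proof (proj1 (Hlam k)) as Hk. pose proof (pos_INR k) as Hk0.
    destruct (HC k t H1) as [A1 [A2 _]]. rewrite <- Rpow_mult_distr.
    apply min_power_le; [lra | lra | lra | exact Hy | |].
    - apply Rle_trans with ((K * Rpower (lam k) (/ theta)) ^ 2).
      + apply pow_incr. split; [apply Rmult_le_pos; [lra | apply Cmod_ge_0]|].
        apply Rle_trans with (lam k * (K * Rpower (lam k) (/ theta - 1))).
        * apply Rmult_le_compat_l; lra.
        * right. rewrite Rpower_minus, Rpower_1 by lra. field. lra.
      + rewrite Rpow_mult_distr, Rpower_sq. unfold A. rewrite Rmult_assoc.
        apply Rmult_le_compat_l; [lra|].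
        apply Rle_trans with (Rpower (c2 * Rpower (INR k + 1) (- nu)) (2 * / theta)).
        * apply Rpower_le_l; [|split; [lra | apply Heig]].
          assert (0 < / theta) by (apply Rinv_0_lt_compat; lra). lra.
        * rewrite <- Rpower_mult_distr, Rpower_mult by (try apply Rpower_pos; lra).
          replace (- nu * (2 * / theta)) with (- p) by (unfold p; field; lra).
          fold (2 / theta). pose proof (Rpower_pos (INR k + 1) (- p)). nra.
    - apply Rle_trans with ((K * / INR t) ^ 2).
      + apply pow_incr. split; [apply Rmult_le_pos; [lra | apply Cmod_ge_0]|].
        apply Rle_trans with (lam k * (K / (INR t * lam k))).
        * apply Rmult_le_compat_l; lra.
        * right. field. lra.
      + rewrite Rpow_mult_distr. unfold A. rewrite Rmult_assoc. apply Rmult_le_compat_l; [lra|].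
        unfold y. rewrite Rpower_mult. replace (theta / nu * - p) with (- (2)) by (unfold p; field; lra).
        rewrite Rpower_Ropp, Rpower_2_pow by lra.
        replace ((/ INR t) ^ 2) with (/ INR t ^ 2) by (field; lra).
        assert (0 < / INR t ^ 2) by (apply Rinv_0_lt_compat, pow_lt; lra). nra. }
  assert (E' : ex_series (fun k => A * Rpower 2 p * Rpower (INR k + 1 + y) (- p))).
  { apply (ex_series_scal (V := R_NormedModule) (A * Rpower 2 p)), E. }
  split; [exact (ex_series_nonneg_le _ _ T E')|].
  eapply Rle_trans; [apply (Series_le _ _ T E')|]. rewrite Series_scal_l, Rmult_assoc.
  rewrite (Rmult_assoc (A * Rpower 2 p)). rewrite (Rmult_assoc A (Rpower 2 p)).
  apply Rmult_le_compat_l; [lra|]. apply Rmult_le_compat_l; [lra|].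
  eapply Rle_trans; [exact B|]. right. unfold Rdiv. rewrite Rmult_comm. f_equal.
  unfold y. rewrite Rpower_mult. f_equal. unfold p. field. lra.
Qed.

(* For [lam k] of order [t^-theta] the signal coefficient has to drop from 1 to 1/2 by time
   [O(t)], and [lam k * U] is its increment; Cauchy-Schwarz turns this into a lower bound on the
   noise.  The first [D] steps are too few to contribute. *)
Lemma noise_lower : exists c eta C3, 0 < c /\ 0 < eta /\ 0 < C3 /\
  forall M, (1 <= M)%nat -> let y := Rpower (INR M) (nu / theta) in
  exists D n, eta * y <= INR (S D) /\ INR n <= C3 * y /\
    c * INR M / y <= psum (fun i =>
      Series (fun k => lam k ^ 2 * Cmod (Ucoef Psi (S (D + i)) (lam k)) ^ 2)) n.
Proof.
  assert (It : 0 < / theta) by (apply Rinv_0_lt_compat; lra).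
  (* For the M eigenvalues with indices M + j, j < M, these constants give e1/y <= h <= e2/y; the 3
     comes from k + 1 <= 3 M. *)
  set (e1 := Rpower (c1 * Rpower 3 (- nu)) (/ theta)). set (e2 := Rpower c2 (/ theta)).
  assert (He1 : 0 < e1) by apply Rpower_pos. assert (He2 : 0 < e2) by apply Rpower_pos.
  set (C3 := 2 * K / e1 + 1).
  assert (Q1 : 0 < 2 * K / e1) by (apply Rdiv_lt_0_compat; lra).
  assert (Q2 : 0 < / (4 * K * e2)) by (apply Rinv_0_lt_compat; nra).
  exists (/ (16 * C3)), (/ (4 * K * e2)), C3.
  split; [apply Rinv_0_lt_compat; unfold C3; lra|]. split; [exact Q2|].
  split; [unfold C3; lra|]. intros M HM y.
  assert (HM1 : 1 <= INR M) by (apply (le_INR 1); exact HM).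
  assert (Hnt : 0 < nu / theta) by (apply Rdiv_lt_0_compat; lra).
  assert (Hy : 1 <= y).
  { unfold y. rewrite <- (Rpower_1_l (nu / theta)). apply Rpower_le_l; lra. }
  assert (Ey : Rpower (Rpower (INR M) (- nu)) (/ theta) = / y).
  { rewrite Rpower_mult. unfold y. rewrite <- Rpower_Ropp. f_equal. field. lra. }
  (* During the first D steps the signal coefficient moves by at most K D h <= 1/4. The number n0 is
     chosen next so that at time D + n + 1 its bound K/(t h) is at most 1/2. *)
  destruct (nfloor_ex (/ (4 * K * e2) * y) ltac:(nra)) as [D [HD1 HD2]].
  destruct (nfloor_ex (2 * K / e1 * y) ltac:(nra)) as [n0 [Hn1 Hn2]].
  set (n := S n0). exists D, n.
  assert (Hn : 0 < INR n <= C3 * y).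
  { unfold n, C3. rewrite S_INR. pose proof (pos_INR n0). nra. }
  split; [rewrite S_INR; lra|]. split; [lra|].
  set (u := fun t k => lam k ^ 2 * Cmod (Ucoef Psi t (lam k)) ^ 2).
  (* Of the total change of at least 1/2, at least 1/4 falls in the window of n steps, so the
     squares l^2 |U|^2 sum to at least 1/(16 n) there. *)
  assert (Key : forall j, (j < M)%nat -> / (16 * INR n) <= psum (fun i => u (S (D + i)) (M + j)%nat) n).
  { intros j Hj. set (k := (M + j)%nat). set (h := Rpower (lam k) (/ theta)).
    pose proof (proj1 (Hlam k)) as Hk.
    assert (Hj' : INR j <= INR M) by (apply le_INR; lia). pose proof (pos_INR j) as Hj0.
    assert (Hkr : INR k + 1 = INR M + INR j + 1) by (unfold k; now rewrite plus_INR).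
    assert (Hh : e1 * / y <= h <= e2 * / y).
    { rewrite <- Ey. unfold e1, e2. split.
      - rewrite Rpower_mult_distr by (repeat apply Rmult_lt_0_compat; try apply Rpower_pos; lra).
        pose proof (Rpower_pos 3 (- nu)). pose proof (Rpower_pos (INR M) (- nu)).
        apply Rpower_le_l; [lra|]. split; [repeat apply Rmult_lt_0_compat; lra|].
        eapply Rle_trans; [|apply Heig]. rewrite Rmult_assoc. apply Rmult_le_compat_l; [lra|].
        rewrite Rpower_mult_distr by lra. apply Rpower_le_l_neg; lra.
      - rewrite Rpower_mult_distr by (try apply Rpower_pos; lra).
        apply Rpower_le_l; [lra|]. split; [exact Hk|]. eapply Rle_trans; [apply Heig|].
        apply Rmult_le_compat_l; [lra|]. apply Rpower_le_l_neg; lra. }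
    assert (Iy : 0 < / y) by (apply Rinv_0_lt_compat; lra).
    assert (Hh0 : 0 < h) by apply Rpower_pos.
    assert (A : Cmod (Vcoef Psi (S (D + n)) (lam k)) <= / 2).
    { destruct (HC k (S (D + n)) ltac:(lia)) as [_ [_ [A _]]]. fold h in A.
      eapply Rle_trans; [exact A|].
      assert (N1 : 2 * K / e1 * y <= INR (S (D + n))).
      { rewrite S_INR, plus_INR. unfold n. rewrite S_INR. pose proof (pos_INR D). lra. }
      assert (N2 : 2 * K <= INR (S (D + n)) * h).
      { apply Rle_trans with ((2 * K / e1 * y) * (e1 * / y)); [right; field; lra|].
        apply Rmult_le_compat; [nra | nra | exact N1 | apply Hh]. }
      apply Rmult_le_reg_r with (INR (S (D + n)) * h); [lra|].
      unfold Rdiv. rewrite Rmult_assoc, Rinv_l by lra. lra. }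
    assert (B := Vcoef_sub_1_le_psum k (D + n)).
    assert (B' : / 2 <= Cmod (Vcoef Psi (S (D + n)) (lam k) - RtoC 1)).
    { rewrite Cmod_sub_sym. pose proof (Cmod_minus_ge (RtoC 1) (Vcoef Psi (S (D + n)) (lam k))) as X.
      rewrite (Cmod_R 1), Rabs_R1 in X. lra. }
    rewrite psum_split, Rmult_plus_distr_l in B.
    assert (B2 : lam k * psum (fun s => Cmod (Ucoef Psi (S s) (lam k))) D <= / 4).
    { eapply Rle_trans; [apply psum_Ucoef_le|]. fold h.
      apply Rle_trans with (K * (/ (4 * K * e2) * y) * (e2 * / y)); [|right; field; repeat split; lra].
      apply Rmult_le_compat; [pose proof (pos_INR D); nra | lra | nra | apply Hh]. }
    set (q := psum (fun i => Cmod (Ucoef Psi (S (D + i)) (lam k))) n) in *.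
    assert (Q : / 4 <= lam k * q) by lra.
    assert (CS := psum_Cauchy_Schwarz (fun i => Cmod (Ucoef Psi (S (D + i)) (lam k))) n).
    fold q in CS. unfold u. rewrite psum_scal.
    set (r := psum (fun i => Cmod (Ucoef Psi (S (D + i)) (lam k)) ^ 2) n) in *.
    assert (F : / 16 <= lam k ^ 2 * (INR n * r)).
    { apply Rle_trans with ((lam k * q) ^ 2).
      - replace (/ 16) with ((/ 4) ^ 2) by field. apply pow_incr. lra.
      - rewrite Rpow_mult_distr. apply Rmult_le_compat_l; [apply pow2_ge_0 | exact CS]. }
    apply Rmult_le_reg_l with (INR n); [lra|].
    replace (INR n * / (16 * INR n)) with (/ 16) by (field; lra). lra. }
  (* The M eigenvalues together contribute M/(16 n), with n <= C3 y; exchanging the sums compares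
     this with the full noise series at each time. *)
  apply Rle_trans with (psum (fun j => psum (fun i => u (S (D + i)) (M + j)%nat) n) M).
  - apply Rle_trans with (psum (fun _ => / (16 * INR n)) M).
    + rewrite psum_const. unfold Rdiv. rewrite (Rmult_comm _ (INR M)), Rmult_assoc.
      apply Rmult_le_compat_l; [lra|]. rewrite <- Rinv_mult. apply Rinv_le_contravar; nra.
    + now apply psum_le.
  - rewrite psum_switch. apply psum_le. intros i _.
    destruct noise_upper as [C' [_ HU]]. destruct (HU (S (D + i)) ltac:(lia)) as [E _].
    apply Rle_trans with (psum (u (S (D + i))) (M + M)).
    + rewrite psum_split. pose proof (psum_nonneg (u (S (D + i))) M
        (fun k => noise_summand_nonneg k (S (D + i)))). lra.
    + apply psum_le_Series; [intros k; apply noise_summand_nonneg | exact E].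
Qed.

End Rates.

(** * Consequences of the renewal equation *)

(** Reads an inequality of exponents off an inequality of powers: if a > b, an n with n^(a-b) >= C/c
    + 1 contradicts it. *)
Lemma power_compare (c C a b : R) (N : nat) : 0 < c ->
  (forall n, (N <= n)%nat -> (1 <= n)%nat -> c * Rpower (INR n) a <= C * Rpower (INR n) b) -> a <= b.
Proof.
  intros Hc H. destruct (Rle_lt_dec a b) as [L|L]; [exact L|exfalso].
  set (z := Rpower (Rmax 1 (C / c + 1)) (/ (a - b))).
  assert (Hz : 0 < z) by apply Rpower_pos.
  destruct (nfloor_ex z ltac:(lra)) as [n0 [_ Hn0]].
  set (n := (n0 + 1 + N)%nat).
  assert (Hn : z < INR n).
  { unfold n. rewrite !plus_INR. simpl. pose proof (pos_INR N). lra. }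
  specialize (H n ltac:(unfold n; lia) ltac:(unfold n; lia)).
  assert (Ia : 0 < / (a - b)) by (apply Rinv_0_lt_compat; lra).
  assert (X : Rmax 1 (C / c + 1) <= Rpower (INR n) (a - b)).
  { apply Rle_trans with (Rpower z (a - b)); [|apply Rpower_le_l; lra].
    unfold z. rewrite Rpower_mult, Rinv_l, Rpower_1 by
      (try lra; pose proof (Rmax_l 1 (C / c + 1)); lra). lra. }
  pose proof (Rmax_r 1 (C / c + 1)) as Y.
  replace a with (b + (a - b)) in H by ring. rewrite Rpower_plus in H.
  pose proof (Rpower_pos (INR n) b) as P.
  assert (Q : c * Rpower (INR n) (a - b) <= C).
  { apply Rmult_le_reg_r with (Rpower (INR n) b); [exact P|]. lra. }
  assert (c * (C / c + 1) <= C).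
  { eapply Rle_trans; [|exact Q]. apply Rmult_le_compat_l; lra. }
  replace (c * (C / c + 1)) with (C + c) in H0 by (field; lra). lra.
Qed.

Lemma psum_rev (f : nat -> R) (n : nat) : psum (fun i => f (n - i)%nat) n = psum (fun i => f (S i)) n.
Proof.
  induction n as [|n IH]; [reflexivity|].
  rewrite (psum_split _ 1 n). cbn [psum]. rewrite <- IH, Rplus_comm, Rplus_0_l. f_equal.
Qed.

Section Renewal.

Variables (U V : nat -> R).
Hypothesis (HU : forall t, (1 <= t)%nat -> 0 <= U t) (HV : forall t, (1 <= t)%nat -> 0 <= V t).

Lemma loss_nonneg (t : nat) : 0 <= loss U V t.
Proof.
  induction t as [t IH] using (well_founded_induction Nat.lt_wf_0). rewrite loss_renewal.
  assert (0 <= psum (fun s => U (t - s)%nat * loss U V s) t).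
  { rewrite <- (Rmult_0_r (INR t)), <- psum_const. apply psum_le. intros s Hs.
    apply Rmult_le_pos; [apply HU; lia | now apply IH]. }
  specialize (HV (S t) ltac:(lia)). lra.
Qed.

Lemma loss_ge_signal (t : nat) : V (S t) <= 2 * loss U V t.
Proof.
  rewrite loss_renewal.
  assert (0 <= psum (fun s => U (t - s)%nat * loss U V s) t).
  { rewrite <- (Rmult_0_r (INR t)), <- psum_const. apply psum_le. intros s Hs.
    apply Rmult_le_pos; [apply HU; lia | apply loss_nonneg]. }
  lra.
Qed.

(** Only the last j terms of the renewal sum are kept: all of them for the noise bound, a fixed
    number for the bound from below. *)
Lemma loss_ge_psum_tail (t j : nat) : (j <= t)%nat ->
  psum (fun i => U (j - i)%nat * loss U V (t - j + i)) j <= loss U V t.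
Proof.
  intros Hj. rewrite (loss_renewal U V t).
  replace (psum (fun s => U (t - s)%nat * loss U V s) t) with
    (psum (fun s => U (t - s)%nat * loss U V s) (t - j + j)) by (f_equal; lia).
  rewrite psum_split.
  assert (A : 0 <= psum (fun s => U (t - s)%nat * loss U V s) (t - j)).
  { rewrite <- (Rmult_0_r (INR (t - j))), <- psum_const. apply psum_le. intros s Hs.
    apply Rmult_le_pos; [apply HU; lia | apply loss_nonneg]. }
  specialize (HV (S t) ltac:(lia)).
  rewrite (psum_ext (fun i => U (t - (t - j + i))%nat * loss U V (t - j + i))
    (fun i => U (j - i)%nat * loss U V (t - j + i))); [lra|].
  intros i Hi. do 2 f_equal. lia.
Qed.

Lemma loss_ge_noise (t : nat) : (1 <= t)%nat -> U t * (V 1%nat / 2) <= loss U V t.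
Proof.
  intros Ht. eapply Rle_trans; [|apply (loss_ge_psum_tail t t); lia].
  destruct t as [|t]; [lia|]. rewrite (psum_split _ 1 t). cbn [psum].
  rewrite Nat.sub_diag, !Nat.add_0_l, Nat.sub_0_r.
  assert (E : loss U V 0 = V 1%nat / 2) by (rewrite loss_renewal; simpl; field). rewrite E.
  assert (0 <= psum (fun i => U (S t - (1 + i))%nat * loss U V (0 + (1 + i))) t).
  { rewrite <- (Rmult_0_r (INR t)), <- psum_const. apply psum_le. intros s Hs.
    apply Rmult_le_pos; [apply HU; lia | apply loss_nonneg]. }
  lra.
Qed.

(** Once the first J noise terms sum to at least 1, each loss is at least the minimum of the J
    preceding ones, so the positive minimum over the first J losses persists. *)
Lemma loss_bounded_below (J : nat) :
  1 <= psum (fun i => U (S i)) J -> (forall t, (1 <= t)%nat -> 0 < V t) ->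
  exists m, 0 < m /\ forall t, m <= loss U V t.
Proof.
  intros HJ HVp.
  assert (Hp : forall t, 0 < loss U V t).
  { intros t. pose proof (loss_ge_signal t). specialize (HVp (S t) ltac:(lia)). lra. }
  assert (Hmin : forall n, exists m, 0 < m /\ forall t, (t < n)%nat -> m <= loss U V t).
  { induction n as [|n [m [Hm IH]]].
    - exists 1. split; [lra | intros; lia].
    - exists (Rmin m (loss U V n)). split; [apply Rmin_pos; auto|]. intros t Ht.
      destruct (Nat.eq_dec t n) as [->|N]; [apply Rmin_r|].
      eapply Rle_trans; [apply Rmin_l | apply IH; lia]. }
  destruct (Hmin J) as [m [Hm HmJ]]. exists m. split; [exact Hm|].
  intros t. induction t as [t IH] using (well_founded_induction Nat.lt_wf_0).
  destruct (Compare_dec.le_lt_dec J t) as [L|L]; [|now apply HmJ].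
  eapply Rle_trans; [|apply (loss_ge_psum_tail t J L)].
  apply Rle_trans with (psum (fun i => m * U (J - i)%nat) J).
  - rewrite psum_scal, psum_rev. nra.
  - apply psum_le. intros i Hi. rewrite Rmult_comm. apply Rmult_le_compat_l; [apply HU; lia|].
    apply IH. lia.
Qed.

End Renewal.

Lemma achieved_rate_le (U V : nat -> R) (theta nu zeta tht c' c eta C3 : R) :
  1 < theta < 2 -> 1 < nu -> 0 < zeta -> 0 < c' -> 0 < c -> 0 < eta -> 0 < C3 ->
  (forall t, (1 <= t)%nat -> 0 <= U t) ->
  (forall t, (1 <= t)%nat -> c' * Rpower (INR t) (- (theta * zeta)) <= V t) ->
  (forall M, (1 <= M)%nat -> let y := Rpower (INR M) (nu / theta) in
    exists D n, eta * y <= INR (S D) /\ INR n <= C3 * y /\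
      c * INR M / y <= psum (fun i => U (S (D + i))) n) ->
  is_bigO eventually (loss U V) (fun t => Rpower (INR t) (- (tht * zeta))) ->
  tht <= 2 /\ tht <= nu /\ tht <= 2 / (zeta + 1 / nu).
Proof.
  intros Ht Hnu Hz Hc' Hc Heta HC3 HU HV HN [M0 [T HL]].
  assert (Inu : 0 < 1 / nu) by (apply Rdiv_lt_0_compat; lra).
  assert (P3 : 0 < 2 / (zeta + 1 / nu)) by (apply Rdiv_lt_0_compat; lra).
  destruct (Rle_lt_dec tht 0) as [Hneg|Htht]; [lra|].
  assert (HVp : forall t, (1 <= t)%nat -> 0 < V t).
  { intros t H1. specialize (HV t H1). pose proof (Rpower_pos (INR t) (- (theta * zeta))). nra. }
  assert (HV0 : forall t, (1 <= t)%nat -> 0 <= V t) by (intros t H1; left; auto).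
  assert (HL' : forall t, (T <= t)%nat -> loss U V t <= M0 * Rpower (INR t) (- (tht * zeta))).
  { intros t H1. specialize (HL t H1).
    change (Rabs (loss U V t) <= M0 * Rabs (Rpower (INR t) (- (tht * zeta)))) in HL.
    rewrite (Rabs_pos_eq (Rpower _ _)) in HL by (left; apply Rpower_pos).
    eapply Rle_trans; [apply Rle_abs | exact HL]. }
  set (a := tht * zeta) in *. assert (Ha : 0 < a) by (unfold a; nra).
  (* The loss at t dominates half the signal at t + 1, which is at least of order t^(-theta
     zeta). *)
  assert (S1 : tht <= theta).
  { apply Rmult_le_reg_r with zeta; [exact Hz|]. fold a. apply Ropp_le_cancel.
    apply (power_compare (c' * Rpower 2 (- (theta * zeta))) (2 * M0) _ _ T).
    - apply Rmult_lt_0_compat; [exact Hc' | apply Rpower_pos].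
    - intros t HtT Ht1. assert (Hr : 1 <= INR t) by (apply (le_INR 1); exact Ht1).
      rewrite Rmult_assoc, Rpower_mult_distr by lra.
      apply Rle_trans with (V (S t)).
      + eapply Rle_trans; [|apply HV; lia]. apply Rmult_le_compat_l; [lra|].
        rewrite S_INR. apply Rpower_le_l_neg; [nra | lra].
      + eapply Rle_trans; [exact (loss_ge_signal U V HU HV0 t)|].
        specialize (HL' t HtT). lra. }
  assert (HV1 : 0 < V 1%nat) by (apply HVp; lia).
  set (M1 := 2 * M0 / V 1%nat).
  assert (HU' : forall t, (T <= t)%nat -> (1 <= t)%nat -> U t <= M1 * Rpower (INR t) (- a)).
  { intros t HtT Ht1. pose proof (loss_ge_noise U V HU HV0 t Ht1) as X. specialize (HL' t HtT).
    apply Rmult_le_reg_r with (V 1%nat / 2); [lra|]. unfold M1.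
    replace (2 * M0 / V 1%nat * Rpower (INR t) (- a) * (V 1%nat / 2)) with
      (M0 * Rpower (INR t) (- a)) by (field; lra). lra. }
  assert (Hnt : 0 < nu / theta) by (apply Rdiv_lt_0_compat; lra).
  (* For M > N0 one has eta y >= T, so every time of the block lies where the assumed rate is in
     force. *)
  destruct (nfloor_ex (Rpower (INR T / eta + 1) (theta / nu)) (Rlt_le _ _ (Rpower_pos _ _)))
    as [N0 [_ HN0]].
  (* Over a block of n <= C3 y times, all at least eta y, the noise sums to at most a multiple of
     y^(1-a) and to at least c M/y. Hence M is at most a multiple of y^(2-a), and y is
     M^(nu/theta). *)
  assert (S2 : 1 <= nu / theta * (2 - a)).
  { apply (power_compare c (C3 * M1 * Rpower eta (- a)) _ _ (S N0)); [exact Hc|].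
    intros M HM HM1. assert (Hr : 1 <= INR M) by (apply (le_INR 1); exact HM1).
    destruct (HN M HM1) as [D [n [H1 [H2 H3]]]].
    set (y := Rpower (INR M) (nu / theta)) in *.
    assert (Hy : 0 < y) by apply Rpower_pos.
    assert (HTy : INR T <= eta * y).
    { assert (Q : 0 <= INR T / eta) by (apply Rdiv_le_0_compat; [apply pos_INR | exact Heta]).
      assert (X : INR T / eta + 1 <= y).
      { unfold y. rewrite <- (Rpower_1 (INR T / eta + 1)) by lra.
        replace 1 with (theta / nu * (nu / theta)) at 2 by (field; lra).
        rewrite <- Rpower_mult. apply Rpower_le_l; [lra|]. split; [apply Rpower_pos|].
        apply le_INR in HM. rewrite S_INR in HM. lra. }
      apply Rle_trans with (eta * (INR T / eta)); [right; field; lra|].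
      apply Rmult_le_compat_l; lra. }
    assert (HTD : (T <= S D)%nat) by (apply INR_le; lra).
    assert (M1pos : 0 <= M1).
    { specialize (HU' (S D) HTD ltac:(lia)). specialize (HU (S D) ltac:(lia)).
      pose proof (Rpower_pos (INR (S D)) (- a)). nra. }
    assert (X : psum (fun i => U (S (D + i))) n <= INR n * (M1 * Rpower (eta * y) (- a))).
    { rewrite <- psum_const. apply psum_le. intros i _.
      eapply Rle_trans; [apply HU'; lia|]. apply Rmult_le_compat_l; [exact M1pos|].
      apply Rpower_le_l_neg; [lra|]. split; [nra|].
      apply Rle_trans with (INR (S D)); [exact H1 | apply le_INR; lia]. }
    assert (Pe := Rpower_pos (eta * y) (- a)).
    assert (X2 : INR n * (M1 * Rpower (eta * y) (- a)) <= C3 * y * (M1 * Rpower (eta * y) (- a))).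
    { apply Rmult_le_compat_r; [apply Rmult_le_pos; lra | exact H2]. }
    assert (X3 : c * INR M <= C3 * y * (M1 * Rpower (eta * y) (- a)) * y).
    { apply Rle_trans with (c * INR M / y * y); [right; field; lra|].
      apply Rmult_le_compat_r; lra. }
    rewrite Rpower_1 by lra. eapply Rle_trans; [exact X3|]. right.
    rewrite <- Rpower_mult_distr by lra.
    replace (Rpower (INR M) (nu / theta * (2 - a))) with (y * y * Rpower y (- a)); [ring|].
    rewrite <- Rpower_mult. fold y. replace (2 - a) with (1 + 1 + - a) by ring.
    rewrite !Rpower_plus, Rpower_1 by exact Hy. ring. }
  assert (S2' : theta / nu <= 2 - a).
  { apply Rmult_le_reg_l with (nu / theta); [exact Hnt|].
    replace (nu / theta * (theta / nu)) with 1 by (field; lra). exact S2. }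
  split; [lra|]. split.
  (* If theta > nu, the block sums c M/y = c M^(1 - nu/theta) are unbounded. One of them reaches 1,
     and the loss then stays away from 0. *)
  - destruct (Rle_lt_dec theta nu) as [L|L]; [lra | exfalso].
    assert (E : exists J, 1 <= psum (fun i => U (S i)) J).
    { set (g := 1 - nu / theta). assert (Hg : 0 < g).
      { unfold g. assert (nu / theta < 1); [|lra]. apply Rmult_lt_reg_r with theta; [lra|].
        unfold Rdiv. rewrite Rmult_assoc, Rinv_l; lra. }
      destruct (nfloor_ex (Rpower (/ c) (/ g)) (Rlt_le _ _ (Rpower_pos _ _))) as [M [_ HM]].
      destruct (HN (S M) ltac:(lia)) as [D [n [_ [_ H3]]]].
      set (y := Rpower (INR (S M)) (nu / theta)) in *.
      exists (D + n)%nat. rewrite psum_split.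
      assert (0 <= psum (fun i => U (S i)) D).
      { apply psum_nonneg. intros i. apply HU. lia. }
      assert (X : 1 <= c * INR (S M) / y); [|lra].
      assert (HM' : Rpower (/ c) (/ g) <= INR (S M)) by (rewrite S_INR; lra).
      assert (Hr : 0 < INR (S M)) by (apply lt_0_INR; lia).
      replace (c * INR (S M) / y) with (c * Rpower (INR (S M)) g).
      2:{ unfold g, y. rewrite Rpower_minus, Rpower_1 by exact Hr. field.
          apply Rgt_not_eq, Rpower_pos. }
      apply Rle_trans with (c * / c); [right; field; lra|]. apply Rmult_le_compat_l; [lra|].
      rewrite <- (Rpower_1 (/ c)) by (apply Rinv_0_lt_compat; lra).
      replace 1 with (/ g * g) by (field; lra). rewrite <- Rpower_mult.
      apply Rpower_le_l; [lra|]. split; [apply Rpower_pos | exact HM']. }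
    destruct E as [J HJ]. destruct (loss_bounded_below U V HU HV0 J HJ HVp) as [m [Hm HmL]].
    assert (0 <= - a); [|lra].
    apply (power_compare m M0 _ _ T Hm). intros t HtT Ht1.
    assert (Hr : 1 <= INR t) by (apply (le_INR 1); exact Ht1).
    rewrite Rpower_O, Rmult_1_r by lra. eapply Rle_trans; [apply HmL | now apply HL'].
  - apply Rmult_le_reg_r with (zeta + 1 / nu); [lra|].
    unfold Rdiv at 2. rewrite Rmult_assoc, Rinv_l by lra.
    assert (tht * (1 / nu) <= theta * (1 / nu)) by (apply Rmult_le_compat_r; lra).
    unfold a, Rdiv in *. lra.
Qed.

(** Strong induction. For i + j = n one has j^(-q) i^(-b) <= 2^b n^(-b) (j^(-q) + i^(-q)), using b
    <= q when i < j, and Z bounds the sum of i^(-q). The signal accounts for half of the claimed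
    bound, and the smallness of u leaves the other half to the convolution. *)
Lemma loss_power_bound (U V : nat -> R) (u q b CV : R) :
  1 < q -> 0 < b <= q -> 0 <= u -> 0 < CV ->
  u * (2 * Rpower 2 b * (Rpower 2 q / (q - 1))) <= / 2 ->
  (forall t, (1 <= t)%nat -> 0 <= U t <= u * Rpower (INR t) (- q)) ->
  (forall t, (1 <= t)%nat -> 0 <= V t <= CV * Rpower (INR t) (- b)) ->
  forall t, loss U V t <= CV * Rpower (INR t + 1) (- b).
Proof.
  intros Hq Hb Hu HCV Hsmall HU HV. set (Z := Rpower 2 q / (q - 1)) in *.
  assert (HZ : forall n, psum (fun i => Rpower (INR (S i)) (- q)) n <= Z).
  { intros n. destruct (shifted_p_series q 1 Hq Rlt_0_1) as [E B]. rewrite Rpower_1_l in B.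
    apply Rle_trans with (psum (fun i => Rpower 2 q * Rpower (INR i + 1 + 1) (- q)) n).
    - apply psum_le. intros i _. pose proof (pos_INR i). rewrite S_INR.
      pose proof (min_power_le 1 (INR i + 1) 1 (Rpower (INR i + 1) (- q)) q) as X.
      rewrite !Rmult_1_l in X. apply X; try lra.
      apply Rpower_le_l_neg; lra.
    - rewrite psum_scal. unfold Z, Rdiv. apply Rmult_le_compat_l; [left; apply Rpower_pos|].
      eapply Rle_trans; [apply psum_le_Series; [intros; left; apply Rpower_pos | exact E]|].
      unfold Rdiv in B. lra. }
  intros t. induction t as [t IH] using (well_founded_induction Nat.lt_wf_0).
  rewrite loss_renewal. set (n := INR t + 1). pose proof (pos_INR t) as Ht0.
  pose proof (Rpower_pos n (- b)) as Pn.
  assert (A : V (S t) <= CV * Rpower n (- b)).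
  { destruct (HV (S t) ltac:(lia)) as [_ X]. rewrite S_INR in X. exact X. }
  set (W := u * CV * (Rpower 2 b * Rpower n (- b))).
  assert (P2 := Rpower_pos 2 b).
  assert (HW : 0 <= W).
  { unfold W. apply Rmult_le_pos; [nra | left; apply Rmult_lt_0_compat; lra]. }
  assert (X : psum (fun s => U (t - s)%nat * loss U V s) t <=
    psum (fun s => W * (Rpower (INR (t - s)) (- q) + Rpower (INR (S s)) (- q))) t).
  { apply psum_le. intros s Hs.
    destruct (HU (t - s)%nat ltac:(lia)) as [U0 U1]. specialize (IH s Hs).
    set (j := INR (t - s)) in *. set (i := INR (S s)) in *. rewrite <- S_INR in IH. fold i in IH.
    assert (Hj : 1 <= j) by (apply (le_INR 1); lia).
    assert (Hi : 1 <= i) by (apply (le_INR 1); lia).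
    assert (Hij : i + j = n).
    { unfold i, j, n. rewrite S_INR, minus_INR by lia. ring. }
    assert (Lp : 0 <= CV * Rpower i (- b)).
    { apply Rmult_le_pos; [lra | left; apply Rpower_pos]. }
    apply Rle_trans with (u * Rpower j (- q) * (CV * Rpower i (- b))).
    { apply Rle_trans with (U (t - s)%nat * (CV * Rpower i (- b))).
      - now apply Rmult_le_compat_l.
      - now apply Rmult_le_compat_r. }
    unfold W. replace (u * Rpower j (- q) * (CV * Rpower i (- b))) with
      (u * CV * (Rpower j (- q) * Rpower i (- b))) by ring.
    rewrite (Rmult_assoc (u * CV)). apply Rmult_le_compat_l; [nra|].
    pose proof (Rpower_pos i (- q)). pose proof (Rpower_pos j (- q)).
    assert (K : forall x, 0 < x -> n <= 2 * x -> Rpower x (- b) <= Rpower 2 b * Rpower n (- b)).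
    { intros x Hx Hnx. replace (Rpower x (- b)) with (Rpower 2 b * Rpower (2 * x) (- b)).
      - apply Rmult_le_compat_l; [lra|]. apply Rpower_le_l_neg; lra.
      - rewrite <- Rpower_mult_distr, <- Rmult_assoc, <- Rpower_plus, Rplus_opp_r, Rpower_O by lra.
        ring. }
    destruct (Rle_lt_dec j i) as [L|L].
    - specialize (K i ltac:(lra) ltac:(lra)).
      assert (0 < Rpower 2 b * Rpower n (- b)) by (apply Rmult_lt_0_compat; lra). nra.
    - specialize (K j ltac:(lra) ltac:(lra)).
      assert (0 < Rpower 2 b * Rpower n (- b)) by (apply Rmult_lt_0_compat; lra).
      (* j^-q i^-b = j^-b j^-(q-b) i^-b <= j^-b i^-q, as i < j *)
      assert (Y : Rpower j (- q) * Rpower i (- b) <= Rpower j (- b) * Rpower i (- q)).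
      { replace (Rpower j (- q)) with (Rpower j (- b) * Rpower j (- (q - b)))
          by (rewrite <- Rpower_plus; f_equal; ring).
        replace (Rpower i (- q)) with (Rpower i (- (q - b)) * Rpower i (- b))
          by (rewrite <- Rpower_plus; f_equal; ring).
        rewrite Rmult_assoc. apply Rmult_le_compat_l; [left; apply Rpower_pos|].
        apply Rmult_le_compat_r; [left; apply Rpower_pos|]. apply Rpower_le_l_neg; lra. }
      eapply Rle_trans; [exact Y|]. nra. }
  rewrite psum_scal, psum_plus in X.
  rewrite (psum_rev (fun m => Rpower (INR m) (- q))) in X.
  assert (Y : W * (2 * Z) <= / 2 * (CV * Rpower n (- b))).
  { replace (W * (2 * Z)) with (u * (2 * Rpower 2 b * Z) * (CV * Rpower n (- b)))
      by (unfold W; ring).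
    apply Rmult_le_compat_r; [nra | exact Hsmall]. }
  specialize (HZ t).
  assert (X2 : W * (psum (fun i => Rpower (INR (S i)) (- q)) t + psum (fun i => Rpower (INR (S i)) (- q)) t)
    <= W * (2 * Z)) by (apply Rmult_le_compat_l; lra).
  lra.
Qed.

(** * Powers in the right half-plane *)

Lemma cos_pos_lt_half_PI (x : R) : 0 <= x <= PI -> 0 < cos x -> x < PI / 2.
Proof.
  intros Hx Hc. destruct (Rlt_le_dec x (PI / 2)) as [L|L]; [exact L|].
  pose proof (cos_le_0 x L ltac:(lra)). lra.
Qed.

Lemma polar_form (z : C) : z <> RtoC 0 -> z = (RtoC (Cmod z) * cis (Carg z))%C.
Proof.
  intros Hz. pose proof (proj1 (Cmod_gt_0 z) Hz) as P.
  set (x := fst z / Cmod z).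
  assert (B : -1 <= x <= 1).
  { pose proof (Re_le_Cmod z) as H. apply Rabs_le_between in H. unfold x. split.
    - apply Rmult_le_reg_r with (Cmod z); [exact P|]. unfold Rdiv. rewrite Rmult_assoc, Rinv_l; lra.
    - apply Rmult_le_reg_r with (Cmod z); [exact P|]. unfold Rdiv. rewrite Rmult_assoc, Rinv_l; lra. }
  assert (Hs : sqrt (1 - Rsqr x) = Rabs (snd z) / Cmod z).
  { apply sqrt_lem_1.
    - assert (Rsqr x <= 1); [|lra]. rewrite <- Rsqr_1. apply Rsqr_le_abs_1.
      rewrite Rabs_R1. apply Rabs_le. lra.
    - apply Rdiv_le_0_compat; [apply Rabs_pos | exact P].
    - pose proof (Cmod_sq z) as E. unfold x, Rsqr.
      replace (Rabs (snd z) / Cmod z * (Rabs (snd z) / Cmod z)) with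
        (Rabs (snd z) ^ 2 / Cmod z ^ 2) by (field; lra).
      rewrite pow2_abs. replace (snd z ^ 2) with (Cmod z ^ 2 - fst z ^ 2) by lra. field. lra. }
  assert (Hcos : cos (Carg z) = x).
  { rewrite <- (Rmult_1_l (Carg z)), cos_Carg, Rmult_1_l. now apply cos_acos. }
  assert (Hsin : sin (Carg z) = snd z / Cmod z).
  { unfold Carg. fold (fst z). unfold Re. fold x. unfold Im. destruct Rle_dec as [L|L].
    - rewrite sin_acos, Hs, Rabs_pos_eq; auto.
    - rewrite sin_neg, sin_acos, Hs, Rabs_left by (auto; lra). field. lra. }
  apply C_ext; simpl; rewrite Hcos, Hsin; unfold x; field; lra.
Qed.

Lemma Carg_bound (z : C) : - PI <= Carg z <= PI.
Proof.
  unfold Carg. pose proof (acos_bound (Re z / Cmod z)). pose proof PI_RGT_0.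
  destruct Rle_dec; lra.
Qed.

Lemma Carg_right_half_plane (z : C) : 0 < fst z -> - (PI / 2) < Carg z < PI / 2.
Proof.
  intros Hz. pose proof PI_RGT_0.
  assert (N : z <> RtoC 0) by (intros E; rewrite E in Hz; simpl in Hz; lra).
  pose proof (proj1 (Cmod_gt_0 z) N) as P.
  assert (X : 0 < cos (Carg z)).
  { pose proof (f_equal fst (polar_form z N)) as E. simpl in E. nra. }
  pose proof (Carg_bound z). destruct (Rle_lt_dec 0 (Carg z)) as [L|L].
  - pose proof (cos_pos_lt_half_PI (Carg z) ltac:(lra) X). lra.
  - rewrite <- cos_neg in X. pose proof (cos_pos_lt_half_PI (- Carg z) ltac:(lra) X). lra.
Qed.

Lemma Carg_polar (r s : R) : 0 < r -> - PI < s < PI -> Carg (RtoC r * cis s) = s.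
Proof.
  intros Hr Hs. unfold Carg. rewrite Cmod_scal_cis by lra.
  assert (E1 : Re (RtoC r * cis s) / r = cos s) by (simpl; field; lra).
  assert (E2 : Im (RtoC r * cis s) = r * sin s) by (simpl; ring).
  rewrite E1, E2. destruct (Rle_lt_dec 0 s) as [L|L].
  - destruct Rle_dec as [Q|Q]; [apply acos_cos; lra|].
    exfalso. apply Q. apply Rmult_le_pos; [lra | apply sin_ge_0; lra].
  - destruct Rle_dec as [Q|Q].
    + exfalso. assert (0 < sin (- s)) by (apply sin_gt_0; lra). rewrite sin_neg in H. nra.
    + rewrite <- (cos_neg s), acos_cos by lra. ring.
Qed.

(** On the right half-plane this replaces the case distinction of [Carg] by a smooth formula, from
    which continuity and derivatives of powers follow. *)
Lemma Carg_atan (z : C) : 0 < fst z -> Carg z = atan (snd z / fst z).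
Proof.
  intros Hz. assert (N : z <> RtoC 0) by (intros E; rewrite E in Hz; simpl in Hz; lra).
  pose proof (proj1 (Cmod_gt_0 z) N) as P.
  pose proof (Carg_right_half_plane z Hz) as B.
  rewrite <- (atan_tan (Carg z)) at 1 by lra. f_equal. unfold tan.
  pose proof (f_equal fst (polar_form z N)) as E1. pose proof (f_equal snd (polar_form z N)) as E2.
  simpl in E1, E2. ring_simplify in E1. ring_simplify in E2. rewrite E1, E2 at 1.
  assert (0 < cos (Carg z)) by (apply cos_gt_0; lra). field. split; lra.
Qed.

(** Two arguments in (-PI/2, PI/2) have a sum in (-PI, PI), so no correction by 2 PI occurs. *)
Lemma Carg_mult (z w : C) : 0 < fst z -> 0 < fst w -> Carg (z * w) = Carg z + Carg w.
Proof.
  intros Hz Hw.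
  assert (Nz : z <> RtoC 0) by (intros E; rewrite E in Hz; simpl in Hz; lra).
  assert (Nw : w <> RtoC 0) by (intros E; rewrite E in Hw; simpl in Hw; lra).
  pose proof (Carg_right_half_plane z Hz). pose proof (Carg_right_half_plane w Hw).
  rewrite (polar_form z Nz) at 1. rewrite (polar_form w Nw) at 1.
  replace (RtoC (Cmod z) * cis (Carg z) * (RtoC (Cmod w) * cis (Carg w)))%C with
    (RtoC (Cmod z * Cmod w) * cis (Carg z + Carg w))%C by (rewrite cis_plus, RtoC_mult; ring).
  apply Carg_polar; [|lra]. apply Rmult_lt_0_compat; now apply Cmod_gt_0.
Qed.

Lemma Cpower_mult_base (z w : C) (a : R) : 0 < fst z -> 0 < fst w ->
  Cpower (z * w) a = (Cpower z a * Cpower w a)%C.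
Proof.
  intros Hz Hw.
  assert (Nz : z <> RtoC 0) by (intros E; rewrite E in Hz; simpl in Hz; lra).
  assert (Nw : w <> RtoC 0) by (intros E; rewrite E in Hw; simpl in Hw; lra).
  unfold Cpower. rewrite Carg_mult, Cmod_mult by assumption.
  rewrite <- Rpower_mult_distr by (now apply Cmod_gt_0).
  rewrite Rmult_plus_distr_l, cis_plus, RtoC_mult. ring.
Qed.

Lemma Cpower_minus_1 (z : C) (a : R) : z <> RtoC 0 -> (z * Cpower z (a - 1))%C = Cpower z a.
Proof.
  intros N. rewrite (polar_form z N) at 1. unfold Cpower.
  pose proof (proj1 (Cmod_gt_0 z) N) as P.
  rewrite Rpower_minus, Rpower_1 by exact P.
  replace (a * Carg z) with (Carg z + (a - 1) * Carg z) by ring. rewrite cis_plus.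
  rewrite RtoC_div by lra. field. intros E. apply RtoC_inj in E. lra.
Qed.

Lemma Cpower_conj (z : C) (a : R) : 0 < fst z -> Cpower (Cconj z) a = Cconj (Cpower z a).
Proof.
  intros Hz. unfold Cpower. rewrite Cmod_conj, !Carg_atan by (simpl; lra).
  replace (snd (Cconj z) / fst (Cconj z)) with (- (snd z / fst z)) by (simpl; field; lra).
  rewrite atan_opp. apply C_ext; simpl; rewrite Ropp_mult_distr_r_reverse, ?cos_neg, ?sin_neg; ring.
Qed.

Lemma locally_fst_pos {T : UniformSpace} (g : T -> C) (x : T) :
  0 < fst (g x) -> continuous (U := C_UniformSpace) g x -> locally x (fun y => 0 < fst (g y)).
Proof.
  intros H Hg. apply (continuous_C_fst _ _ Hg (fun u => 0 < u)).
  apply (open_gt 0). exact H.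
Qed.

Lemma continuous_Cpower_comp {T : UniformSpace} (g : T -> C) (x : T) (a : R) :
  0 < fst (g x) -> continuous (U := C_UniformSpace) g x ->
  continuous (U := C_UniformSpace) (fun y => Cpower (g y) a) x.
Proof.
  intros H Hg.
  assert (N : g x <> RtoC 0) by (intros E; rewrite E in H; simpl in H; lra).
  apply (continuous_ext_loc (U := C_UniformSpace) _
    (fun y => RtoC (Rpower (Cmod (g y)) a) * cis (a * atan (snd (g y) * / fst (g y))))%C).
  - generalize (locally_fst_pos g x H Hg). apply filter_imp. intros y Hy.
    unfold Cpower. now rewrite (Carg_atan _ Hy).
  - apply continuous_Cmult.
    + apply continuous_RtoC, continuous_Rpower_comp; [now apply Cmod_gt_0|].
      now apply continuous_Cmod_comp.
    + apply continuous_cis, (continuous_mult (K := R_AbsRing)); [apply continuous_const|].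
      apply (continuous_comp (fun y => snd (g y) * / fst (g y)) atan); [|apply continuous_atan].
      apply (continuous_mult (K := R_AbsRing)); [exact (continuous_C_snd _ _ Hg)|].
      apply (continuous_comp (fun y => fst (g y)) Rinv); [exact (continuous_C_fst _ _ Hg)|].
      apply continuous_Rinv. lra.
Qed.

Lemma is_derive_exp_cos (N T : R -> R) (s a n t : R) :
  is_derive N s n -> is_derive T s t ->
  is_derive (fun x => exp (a * N x) * cos (a * T x)) s
    (a * (exp (a * N s) * (n * cos (a * T s) - t * sin (a * T s)))) /\
  is_derive (fun x => exp (a * N x) * sin (a * T x)) s
    (a * (exp (a * N s) * (n * sin (a * T s) + t * cos (a * T s)))).
Proof.
  intros HN HT. assert (E1 : ex_derive N s) by (eexists; exact HN).
  assert (E2 : ex_derive T s) by (eexists; exact HT).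
  split; (auto_derive; [auto|]); change (Derive (fun x => N x) s) with (Derive N s);
    change (Derive (fun x => T x) s) with (Derive T s);
    rewrite (is_derive_unique _ _ _ HN), (is_derive_unique _ _ _ HT); ring.
Qed.

(** The two right-hand sides are the real and imaginary parts of (a + i b)/(x + i y), the derivative
    of the logarithm. *)
Lemma is_derive_log_modulus_argument (x y : R -> R) (s a b : R) :
  0 < x s -> is_derive x s a -> is_derive y s b ->
  is_derive (fun t => ln (sqrt (x t ^ 2 + y t ^ 2))) s ((x s * a + y s * b) / (x s ^ 2 + y s ^ 2)) /\
  is_derive (fun t => atan (y t / x t)) s ((x s * b - y s * a) / (x s ^ 2 + y s ^ 2)).
Proof.
  intros Hx Hdx Hdy. assert (E1 : ex_derive x s) by (eexists; exact Hdx).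
  assert (E2 : ex_derive y s) by (eexists; exact Hdy).
  assert (P : 0 < x s ^ 2 + y s ^ 2) by (pose proof (pow2_ge_0 (y s)); nra).
  assert (Q : 0 < sqrt (x s ^ 2 + y s ^ 2)) by (apply sqrt_lt_R0; exact P).
  assert (R : sqrt (x s ^ 2 + y s ^ 2) * sqrt (x s ^ 2 + y s ^ 2) = x s ^ 2 + y s ^ 2)
    by (apply sqrt_sqrt; lra).
  split.
  - auto_derive; [simpl in *; repeat split; auto|].
    change (Derive (fun t => x t) s) with (Derive x s).
    change (Derive (fun t => y t) s) with (Derive y s).
    rewrite (is_derive_unique _ _ _ Hdx), (is_derive_unique _ _ _ Hdy).
    change (x s * (x s * 1) + y s * (y s * 1)) with (x s ^ 2 + y s ^ 2).
    set (q := sqrt (x s ^ 2 + y s ^ 2)) in *. rewrite <- R. field. lra.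
  - auto_derive; [repeat split; auto; lra|].
    change (Derive (fun t => x t) s) with (Derive x s).
    change (Derive (fun t => y t) s) with (Derive y s).
    rewrite (is_derive_unique _ _ _ Hdx), (is_derive_unique _ _ _ Hdy). field.
    repeat split; try lra.
Qed.

Lemma is_derive_curve_Cpower (g : R -> C) (s a : R) (dg : C) :
  0 < fst (g s) -> is_derive_curve g s dg ->
  is_derive_curve (fun x => Cpower (g x) a) s (dg * (RtoC a * Cpower (g s) (a - 1)))%C.
Proof.
  intros H Hg. assert (Cg := is_derive_curve_continuous _ _ _ Hg).
  assert (N : g s <> RtoC 0) by (intros E; rewrite E in H; simpl in H; lra).
  pose proof (proj1 (is_derive_curve_iff _ _ _) Hg) as [G1 G2].
  destruct (is_derive_log_modulus_argument (fun t => fst (g t)) (fun t => snd (g t)) s _ _ H G1 G2)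
    as [L1 L2].
  destruct (is_derive_exp_cos _ _ s a _ _ L1 L2) as [D1 D2].
  assert (Loc : locally s (fun t => Cpower (g t) a =
    (exp (a * ln (sqrt (fst (g t) ^ 2 + snd (g t) ^ 2))) * cos (a * atan (snd (g t) / fst (g t))),
     exp (a * ln (sqrt (fst (g t) ^ 2 + snd (g t) ^ 2))) * sin (a * atan (snd (g t) / fst (g t)))))).
  { generalize (locally_fst_pos g s H Cg). apply filter_imp. intros t Hgt.
    unfold Cpower, Rpower, Cmod. rewrite (Carg_atan _ Hgt). apply C_ext; simpl; ring. }
  assert (Es := locally_singleton _ _ Loc). cbv beta in Es.
  set (E := exp (a * ln (sqrt (fst (g s) ^ 2 + snd (g s) ^ 2)))) in *.
  set (A := a * atan (snd (g s) / fst (g s))) in *.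
  assert (Ed : (dg * (RtoC a * Cpower (g s) (a - 1)))%C =
    (dg * (RtoC a * (((E * cos A)%R, (E * sin A)%R) * / g s)))%C).
  { rewrite <- Es, <- (Cpower_minus_1 _ a N). field. exact N. }
  rewrite Ed. pose proof (C_neq_0_sq _ N) as P. apply is_derive_curve_iff. split.
  - eapply is_derive_ext_loc; [|evar_last; [exact D1|]].
    + revert Loc. apply filter_imp. intros t ->. reflexivity.
    + simpl in *. field. lra.
  - eapply is_derive_ext_loc; [|evar_last; [exact D2|]].
    + revert Loc. apply filter_imp. intros t ->. reflexivity.
    + simpl in *. field. lra.
Qed.

(** Reduces complex differentiability to real calculus on segments through z: after the linear part
    is subtracted, the mean value inequality and the continuity of the candidate g bound the
    remainder. *)
Lemma is_derive_C_of_segments (F g : C -> C) (z : C) (d0 : R) :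
  0 < d0 -> continuous (T := C_UniformSpace) (U := C_UniformSpace) g z ->
  (forall (d : C) (t : R), Cmod (RtoC t * d) < d0 ->
    is_derive_curve (fun x => F (z + RtoC x * d)%C) t (d * g (z + RtoC t * d))%C) ->
  is_derive (K := C_AbsRing) (V := C_NormedModule) F z (g z).
Proof.
  intros Hd0 Hg HF. apply is_derive_C_eps. intros eps He.
  assert (L := proj1 (continuous_Cmod_eps _ _) Hg (eps / 2) ltac:(lra)).
  apply locally_Cmod in L. destruct L as [d1 [Hd1 L]].
  exists (Rmin d0 d1). split; [now apply Rmin_pos|]. intros w Hw.
  pose proof (Rmin_l d0 d1). pose proof (Rmin_r d0 d1). set (d := (w - z)%C) in *.
  assert (B : Cmod ((F (z + RtoC 1 * d) - RtoC 1 * (d * g z)) - (F (z + RtoC 0 * d) - RtoC 0 * (d * g z)))%C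
    <= 2 * ((Cmod d * (eps / 2)) * Rabs (1 - 0))).
  { apply (curve_increment_le (fun x => F (z + RtoC x * d) - RtoC x * (d * g z))%C
      (fun t => d * g (z + RtoC t * d)%C - d * g z)%C).
    intros t Ht. rewrite !Rminus_0_r, Rabs_R1 in Ht.
    assert (Q : Cmod (RtoC t * d) <= Cmod d).
    { rewrite Cmod_mult, Cmod_R. pose proof (Cmod_ge_0 d). nra. }
    split.
    - apply is_derive_curve_minus; [apply HF; lra|].
      apply is_derive_curve_iff. split; simpl; auto_derive; auto; ring.
    - replace (d * g (z + RtoC t * d)%C - d * g z)%C with (d * (g (z + RtoC t * d)%C - g z))%C by ring.
      rewrite Cmod_mult. apply Rmult_le_compat_l; [apply Cmod_ge_0|]. left. apply L.
      replace (z + RtoC t * d - z)%C with (RtoC t * d)%C by ring. lra. }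
  rewrite Rminus_0_r, Rabs_R1 in B.
  replace (z + RtoC 1 * d)%C with w in B by (unfold d; ring).
  replace (z + RtoC 0 * d)%C with z in B by ring.
  replace (F w - F z - d * g z)%C with ((F w - RtoC 1 * (d * g z)) - (F z - RtoC 0 * (d * g z)))%C
    by ring. lra.
Qed.

(** * A corner map for every exponent *)

(** It vanishes at the corner like z - 1, but unlike z - 1 it maps the rest of the closed exterior
    into the right half-plane, since Re (1/z) < 1 there. *)
Definition corner_factor (z : C) : C := (1 - / z)%C.

(* [w * w^(a-1)] instead of [w^a]: [Cpower 0 a] is 1. *)
Definition corner_power (a : R) (z : C) : C :=
  (corner_factor z * Cpower (corner_factor z) (a - 1))%C.

Definition model_map (A theta : R) (z : C) : C := (- RtoC A * (z * corner_power theta z))%C.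

(** With w = 1 - 1/z, w' = 1/z^2, this is -A (w^theta + theta w^(theta-1)/z), the derivative of -A z
    w^theta. *)
Definition model_map' (A theta : R) (z : C) : C :=
  (- RtoC A * (corner_power theta z + RtoC theta * (corner_power (theta - 1) z * / z)))%C.

Lemma outside_neq_0 (z : C) : 1 <= Cmod z -> z <> RtoC 0.
Proof. intros H E. rewrite E, Cmod_0 in H. lra. Qed.

Lemma corner_factor_pos (z : C) : 1 <= Cmod z -> z <> RtoC 1 -> 0 < fst (corner_factor z).
Proof.
  intros Hz N. pose proof (outside_neq_0 z Hz) as N0. pose proof (C_neq_0_sq _ N0) as P.
  pose proof (Cmod_sq z) as E. pose proof (pow2_ge_0 (snd z)) as Q.
  assert (M : 1 <= fst z ^ 2 + snd z ^ 2) by nra.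
  assert (L : fst z < fst z ^ 2 + snd z ^ 2).
  { destruct (Rlt_le_dec (fst z) (fst z ^ 2 + snd z ^ 2)) as [L|L]; [exact L | exfalso].
    apply N. assert (fst z = 1) by nra. apply C_ext; simpl; nra. }
  unfold corner_factor. simpl.
  assert (X : fst z / (fst z ^ 2 + snd z ^ 2) < 1).
  { apply Rmult_lt_reg_r with (fst z ^ 2 + snd z ^ 2); [lra|].
    unfold Rdiv. rewrite Rmult_assoc, Rinv_l by lra. lra. }
  simpl in X. lra.
Qed.

Lemma corner_factor_1 : corner_factor (RtoC 1) = RtoC 0.
Proof. unfold corner_factor. apply C_ext; simpl; field. Qed.

Lemma corner_factor_mult (z : C) : z <> RtoC 0 -> (corner_factor z * z)%C = (z - 1)%C.
Proof. intros N. unfold corner_factor. field. exact N. Qed.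

Lemma Cmod_corner_factor_le (z : C) : 1 <= Cmod z -> Cmod (corner_factor z) <= Cmod (z - 1).
Proof.
  intros Hz. rewrite <- (corner_factor_mult z) by now apply outside_neq_0.
  rewrite Cmod_mult. pose proof (Cmod_ge_0 (corner_factor z)). nra.
Qed.

Lemma corner_power_Cpower (a : R) (z : C) : 1 <= Cmod z -> z <> RtoC 1 ->
  corner_power a z = Cpower (corner_factor z) a.
Proof.
  intros Hz N. apply Cpower_minus_1. intros E. pose proof (corner_factor_pos z Hz N) as P.
  rewrite E in P. simpl in P. lra.
Qed.

Lemma corner_power_1 (a : R) : corner_power a (RtoC 1) = RtoC 0.
Proof. unfold corner_power. rewrite corner_factor_1. ring. Qed.

Lemma Cmod_corner_power_le (a : R) (z : C) : 0 <= a -> 1 <= Cmod z -> z <> RtoC 1 ->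
  Cmod (corner_power a z) <= Rpower (Cmod (z - 1)) a.
Proof.
  intros Ha Hz N. rewrite corner_power_Cpower, Cmod_Cpower by assumption.
  apply Rpower_le_l; [exact Ha|]. split; [|now apply Cmod_corner_factor_le].
  apply Cmod_gt_0. intros E. pose proof (corner_factor_pos z Hz N) as P.
  rewrite E in P. simpl in P. lra.
Qed.

Lemma continuous_corner_factor {T : UniformSpace} (g : T -> C) (x : T) :
  g x <> RtoC 0 -> continuous (U := C_UniformSpace) g x ->
  continuous (U := C_UniformSpace) (fun y => corner_factor (g y)) x.
Proof.
  intros N Hg. apply continuous_Cminus; [apply continuous_const | now apply continuous_Cinv].
Qed.

Lemma continuous_corner_power {T : UniformSpace} (g : T -> C) (x : T) (a : R) : 0 < a ->
  (forall y, 1 <= Cmod (g y)) -> continuous (U := C_UniformSpace) g x ->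
  continuous (U := C_UniformSpace) (fun y => corner_power a (g y)) x.
Proof.
  intros Ha H1 Hg. destruct (Ceq_dec (g x) (RtoC 1)) as [E|N].
  - apply continuous_Cmod_eps. intros eps He. rewrite E, corner_power_1.
    destruct (Rpower_eventually_lt a eps Ha He) as [d [Hd H]].
    generalize (proj1 (continuous_Cmod_eps _ _) Hg d Hd). apply filter_imp. intros y Hy.
    rewrite E in Hy. replace (corner_power a (g y) - RtoC 0)%C with (corner_power a (g y)) by ring.
    destruct (Ceq_dec (g y) (RtoC 1)) as [E'|N'].
    + rewrite E', corner_power_1, Cmod_0. exact He.
    + eapply Rle_lt_trans; [apply Cmod_corner_power_le; auto; lra|]. apply H. split; [|exact Hy].
      now apply Cmod_minus_1_pos.
  - assert (Hf := continuous_corner_factor g x (outside_neq_0 _ (H1 x)) Hg).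
    apply continuous_Cmult; [exact Hf|].
    apply continuous_Cpower_comp; [now apply corner_factor_pos | exact Hf].
Qed.

Lemma continuous_model_map {T : UniformSpace} (g : T -> C) (x : T) (A theta : R) : 1 < theta ->
  (forall y, 1 <= Cmod (g y)) -> continuous (U := C_UniformSpace) g x ->
  continuous (U := C_UniformSpace) (fun y => model_map A theta (g y)) x.
Proof.
  intros Ht H1 Hg. apply continuous_Cmult; [apply continuous_const|].
  apply continuous_Cmult; [exact Hg|]. apply continuous_corner_power; auto. lra.
Qed.

Lemma continuous_model_map' {T : UniformSpace} (g : T -> C) (x : T) (A theta : R) : 1 < theta ->
  (forall y, 1 <= Cmod (g y)) -> continuous (U := C_UniformSpace) g x ->
  continuous (U := C_UniformSpace) (fun y => model_map' A theta (g y)) x.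
Proof.
  intros Ht H1 Hg. apply continuous_Cmult; [apply continuous_const|].
  apply continuous_Cplus; [apply continuous_corner_power; auto; lra|].
  apply continuous_Cmult; [apply continuous_const|].
  apply continuous_Cmult; [apply continuous_corner_power; auto; lra|].
  apply continuous_Cinv; [now apply outside_neq_0 | exact Hg].
Qed.

(* Radial retraction onto the closed exterior of the unit disk. *)
Lemma continuous_on_outside (F : C -> C) :
  (forall (g : C -> C) (z : C), (forall y, 1 <= Cmod (g y)) ->
    continuous (T := C_UniformSpace) (U := C_UniformSpace) g z ->
    continuous (T := C_UniformSpace) (U := C_UniformSpace) (fun y => F (g y)) z) ->
  continuous_on (T := C_UniformSpace) (U := C_UniformSpace) (fun z => 1 <= Cmod z) F.
Proof.
  intros H. set (g := fun z => (RtoC (Rmax 1 (Cmod z)) * cis (Carg z))%C).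
  assert (G1 : forall z, 1 <= Cmod (g z)).
  { intros z. unfold g. pose proof (Rmax_l 1 (Cmod z)). rewrite Cmod_scal_cis; lra. }
  assert (Gid : forall z, 1 <= Cmod z -> g z = z).
  { intros z Hz. unfold g. rewrite Rmax_right by exact Hz.
    symmetry. now apply polar_form, outside_neq_0. }
  assert (Gc : forall z, 1 <= Cmod z -> continuous (T := C_UniformSpace) (U := C_UniformSpace) g z).
  { intros z Hz. pose proof (outside_neq_0 z Hz) as N.
    assert (Hid : continuous (T := C_UniformSpace) (U := C_UniformSpace) (fun y : C => y) z)
      by apply continuous_id.
    (* Near z the retraction equals y max(1, |y|)/|y|, which avoids the jump of [Carg] across the
       negative axis. *)
    apply (continuous_ext_loc (T := C_UniformSpace) (U := C_UniformSpace) _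
      (fun y : C => RtoC (Rmax 1 (Cmod y)) * (y * / RtoC (Cmod y)))%C).
    - apply locally_Cmod. exists 1. split; [lra|]. intros y Hy.
      assert (Ny : y <> RtoC 0).
      { intros E. rewrite E in Hy. replace (RtoC 0 - z)%C with (- z)%C in Hy by ring.
        rewrite Cmod_opp in Hy. lra. }
      pose proof (proj1 (Cmod_gt_0 y) Ny) as P.
      assert (E : (y * / RtoC (Cmod y))%C = cis (Carg y)).
      { rewrite (polar_form y Ny) at 1. field. intros E. apply RtoC_inj in E. lra. }
      now rewrite E.
    - assert (Hm : continuous (T := C_UniformSpace) (fun y : C => Cmod y) z)
        by now apply continuous_Cmod_comp.
      apply continuous_Cmult.
      + apply continuous_RtoC, continuous_Rmax; [apply continuous_const | exact Hm].
      + apply continuous_Cmult; [exact Hid|]. apply continuous_Cinv.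
        * intros E. apply RtoC_inj in E. lra.
        * now apply continuous_RtoC. }
  apply continuous_on_Cmod_eps. intros z Hz eps He.
  assert (L := proj1 (continuous_Cmod_eps _ _) (H g z G1 (Gc z Hz)) eps He).
  apply locally_Cmod in L. destruct L as [d [Hd L]]. exists d. split; [exact Hd|].
  intros w Hw Hwz. specialize (L w Hwz). rewrite !Gid in L by assumption. exact L.
Qed.

Lemma is_derive_model_map (A theta : R) (z : C) : 1 < theta -> 1 < Cmod z ->
  is_derive (K := C_AbsRing) (V := C_NormedModule) (model_map A theta) z (model_map' A theta z).
Proof.
  intros Ht Hz.
  assert (Hin : forall (d : C), Cmod d < Cmod z - 1 -> 1 < Cmod (z + d)).
  { intros d Hd. pose proof (Cmod_minus_ge z (- d)) as X. rewrite Cmod_opp in X.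
    replace (z - - d)%C with (z + d)%C in X by ring. lra. }
  assert (Hne : forall y, 1 < Cmod y -> y <> RtoC 1).
  { intros y Hy E. rewrite E, Cmod_R, Rabs_R1 in Hy. lra. }
  apply (is_derive_C_of_segments _ (model_map' A theta) z (Cmod z - 1)); [lra | |].
  - assert (Co := continuous_on_outside (model_map' A theta)
      (fun g y => continuous_model_map' (T := C_UniformSpace) g y A theta Ht)).
    apply continuous_Cmod_eps. intros eps He.
    destruct (proj1 (continuous_on_Cmod_eps _ _) Co z (Rlt_le _ _ Hz) eps He) as [d [Hd H]].
    apply locally_Cmod. exists (Rmin d (Cmod z - 1)). split; [apply Rmin_pos; lra|].
    intros y Hy. pose proof (Rmin_l d (Cmod z - 1)). pose proof (Rmin_r d (Cmod z - 1)).
    apply H; [|lra]. specialize (Hin (y - z)%C ltac:(lra)).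
    replace (z + (y - z))%C with y in Hin by ring. lra.
  - intros d t Hd. specialize (Hin _ Hd). set (g := fun x => (z + RtoC x * d)%C).
    change (z + RtoC t * d)%C with (g t) in *.
    assert (N0 : g t <> RtoC 0) by (apply outside_neq_0; lra).
    assert (Dg : is_derive_curve g t d).
    { apply is_derive_curve_iff. unfold g. split; simpl; auto_derive; auto; ring. }
    set (f := fun x => corner_factor (g x)).
    assert (Df : is_derive_curve f t (d * / (g t * g t))%C).
    { replace (d * / (g t * g t))%C with (RtoC 0 - (- d / (g t * g t)))%C
        by (field; exact N0).
      apply is_derive_curve_minus; [apply is_derive_curve_const | now apply is_derive_curve_inv]. }
    assert (Pf : 0 < fst (f t)) by (apply corner_factor_pos; [lra | now apply Hne]).
    assert (Nf : f t <> RtoC 0) by (intros E; rewrite E in Pf; simpl in Pf; lra).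
    assert (Dp := is_derive_curve_Cpower f t (theta - 1) _ Pf Df).
    assert (D := is_derive_curve_mult (fun _ => - RtoC A)%C
      (fun x => g x * (f x * Cpower (f x) (theta - 1)))%C
      t _ _ (is_derive_curve_const _ _)
      (is_derive_curve_mult _ _ _ _ _ Dg (is_derive_curve_mult _ _ _ _ _ Df Dp))).
    replace (d * model_map' A theta (g t))%C with
      (RtoC 0 * (g t * (f t * Cpower (f t) (theta - 1))) + - RtoC A *
        (d * (f t * Cpower (f t) (theta - 1)) + g t * (d * / (g t * g t) * Cpower (f t) (theta - 1)
          + f t * (d * / (g t * g t) * (RtoC (theta - 1) * Cpower (f t) (theta - 1 - 1))))))%C.
    + exact D.
    + unfold model_map', corner_power. change (corner_factor (g t)) with (f t).
      rewrite <- (Cpower_minus_1 (f t) (theta - 1) Nf). rewrite RtoC_minus. field. exact N0.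
Qed.

(** If the value were x, then w = 1 - 1/z would satisfy w^theta = -(x/A) (1 - w) with |1 - w| <= 1.
    The choice of A makes x/A at most k^theta/2, which forces |w| < k. On the other hand theta |arg
    w| <= theta PI/2 < PI gives cos(theta arg w) >= -1 + k, and real parts then yield Re w >= k. *)
Lemma model_map_avoids (theta L : R) : 1 < theta < 2 -> 0 < L ->
  exists A, 0 < A /\ forall x z, 0 <= x <= L -> 1 <= Cmod z -> z <> RtoC 1 ->
    model_map A theta z <> RtoC x.
Proof.
  intros Ht HL. pose proof PI_RGT_0.
  set (k := 1 + cos (theta * (PI / 2))).
  assert (Hk : 0 < k < 1).
  { unfold k. split.
    - assert (-1 < cos (theta * (PI / 2))); [|lra]. rewrite <- cos_PI.
      apply cos_decreasing_1; nra.
    - assert (cos (theta * (PI / 2)) < 0); [|lra]. apply cos_lt_0; nra. }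
  assert (Pk := Rpower_pos k theta).
  exists (2 * L / Rpower k theta).
  assert (HA : 0 < 2 * L / Rpower k theta) by (apply Rdiv_lt_0_compat; lra).
  split; [exact HA|]. intros x z Hx Hz N E. set (A := 2 * L / Rpower k theta) in *.
  pose proof (corner_factor_pos z Hz N) as P. pose proof (outside_neq_0 z Hz) as N0.
  unfold model_map in E. rewrite corner_power_Cpower in E by assumption.
  set (w := corner_factor z) in *.
  assert (Nw : w <> RtoC 0) by (intros E'; rewrite E' in P; simpl in P; lra).
  pose proof (proj1 (Cmod_gt_0 w) Nw) as Pw.
  assert (Ez : (/ z)%C = (1 - w)%C) by (unfold w, corner_factor; ring).
  assert (E2 : Cpower w theta = (RtoC (- (x / A)) * (1 - w))%C).
  { rewrite <- Ez. rewrite RtoC_opp, RtoC_div by lra. rewrite <- E. field.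
    split; [exact N0|]. intros E'. apply RtoC_inj in E'. lra. }
  set (r := Rpower (Cmod w) theta). assert (Pr : 0 < r) by apply Rpower_pos.
  assert (M : r = x / A * Cmod (1 - w)).
  { unfold r. rewrite <- Cmod_Cpower, E2, Cmod_mult, Cmod_R, Rabs_Ropp, Rabs_pos_eq; [reflexivity|].
    apply Rdiv_le_0_compat; lra. }
  assert (M1 : Cmod (1 - w) <= 1).
  { rewrite <- Ez, Cmod_inv by exact N0. rewrite <- Rinv_1. apply Rinv_le_contravar; lra. }
  pose proof (Cmod_ge_0 (1 - w)) as M0.
  assert (XA : 0 <= x / A) by (apply Rdiv_le_0_compat; lra).
  assert (XA0 : 0 < x / A) by nra.
  assert (Sm : Cmod w < k).
  { destruct (Rlt_le_dec (Cmod w) k) as [Q|Q]; [exact Q | exfalso].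
    assert (r <= x / A) by nra.
    assert (Rpower k theta <= r) by (apply Rpower_le_l; lra).
    assert (x / A <= Rpower k theta / 2); [|lra].
    apply Rle_trans with (L / A).
    - apply Rmult_le_compat_r; [left; now apply Rinv_0_lt_compat | lra].
    - unfold A. right. field. lra. }
  pose proof (Re_le_Cmod w) as Rw. apply Rabs_le_between in Rw.
  assert (Hcos : -1 + k <= cos (theta * Carg w)).
  { replace (-1 + k) with (cos (theta * (PI / 2))) by (unfold k; ring).
    pose proof (Carg_right_half_plane w P).
    assert (K : forall s, 0 <= s <= PI / 2 -> cos (theta * (PI / 2)) <= cos (theta * s)).
    { intros s Hs. apply cos_decr_1; nra. }
    destruct (Rle_lt_dec 0 (Carg w)) as [Q|Q].
    - apply K. lra.
    - rewrite <- (cos_neg (theta * Carg w)), Ropp_mult_distr_r. apply K. lra. }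
  clearbody w. pose proof (f_equal fst E2) as F. unfold Cpower in F. fold r in F. simpl in F.
  ring_simplify in F. rewrite M in F.
  assert (F2 : Cmod (1 - w) * cos (theta * Carg w) = - (1 - fst w)).
  { apply Rmult_eq_reg_l with (x / A); [|lra]. lra. }
  nra.
Qed.

Lemma corner_map_exists (lam : nat -> R) (theta : R) : 1 < theta < 2 ->
  (forall k, 0 < lam k <= lam 0%nat) ->
  exists Psi dPsi c, corner_map_with lam Psi dPsi theta c.
Proof.
  intros Ht Hlam. destruct (model_map_avoids theta (lam 0%nat) Ht (proj1 (Hlam 0%nat)))
    as [A [HA Hav]].
  exists (model_map A theta), (model_map' A theta), A.
  assert (Hne : forall y, 1 < Cmod y -> y <> RtoC 1).
  { intros y Hy E. rewrite E, Cmod_R, Rabs_R1 in Hy. lra. }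
  constructor.
  - exact Ht.
  - exact HA.
  - intros z Hz. apply is_derive_model_map; [lra | exact Hz].
  - intros z Hz. unfold model_map.
    assert (Hc : 1 <= Cmod (Cconj z)) by (rewrite Cmod_conj; lra).
    assert (Nc : Cconj z <> RtoC 1).
    { apply Hne. rewrite Cmod_conj. exact Hz. }
    rewrite !corner_power_Cpower by (auto; lra).
    assert (E : corner_factor (Cconj z) = Cconj (corner_factor z)).
    { unfold corner_factor. apply C_ext; simpl; unfold Rdiv.
      - f_equal. f_equal. f_equal. f_equal. ring.
      - replace (- snd z * (- snd z * 1)) with (snd z * (snd z * 1)) by ring. ring. }
    rewrite E, Cpower_conj by (apply corner_factor_pos; auto; lra).
    rewrite !Cmult_conj. f_equal. apply C_ext; simpl; ring.
  - intros eps. apply at_corner_iff.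
    (* As z - 1 = w z, the powers satisfy (z - 1)^theta = w^theta z^theta. The asymptotics thus
       compare z^theta with z, which agree at z = 1, and [q] < 0 near 1 by continuity. *)
    set (q := fun y : C => Cmod (Cpower y theta - y) - eps * Cmod (Cpower y theta)).
    assert (Cq : continuous (T := C_UniformSpace) q (RtoC 1)).
    { assert (Hid : continuous (T := C_UniformSpace) (U := C_UniformSpace) (fun y : C => y) (RtoC 1))
        by apply continuous_id.
      assert (Hp : continuous (T := C_UniformSpace) (U := C_UniformSpace)
        (fun y : C => Cpower y theta) (RtoC 1)).
      { apply continuous_Cpower_comp; [simpl; lra | exact Hid]. }
      apply (continuous_minus (V := R_NormedModule)).
      - apply continuous_Cmod_comp, continuous_Cminus; assumption.
      - apply (continuous_mult (K := R_AbsRing)); [apply continuous_const|].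
        now apply continuous_Cmod_comp. }
    assert (P1 : Cpower (RtoC 1) theta = RtoC 1).
    { unfold Cpower. rewrite Carg_atan by (simpl; lra). rewrite Cmod_R, Rabs_R1, Rpower_1_l.
      simpl. unfold Rdiv. rewrite Rmult_0_l, atan_0, Rmult_0_r, cis_0. ring. }
    assert (Q1 : q (RtoC 1) < 0).
    { unfold q. rewrite P1. replace (RtoC 1 - RtoC 1)%C with (RtoC 0) by ring.
      rewrite Cmod_0, Cmod_R, Rabs_R1. pose proof (cond_pos eps). lra. }
    assert (Lq : locally (T := C_UniformSpace) (RtoC 1) (fun y => q y < 0)).
    { apply (Cq (fun u => u < 0)). apply (open_lt 0). exact Q1. }
    apply locally_Cmod in Lq. destruct Lq as [d [Hd Lq]].
    exists (Rmin d 1). split; [apply Rmin_pos; lra|]. intros z Z1 Z2 Z3.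
    pose proof (Rmin_l d 1). pose proof (Rmin_r d 1).
    specialize (Lq z ltac:(lra)). unfold q in Lq.
    assert (Pz : 0 < fst z).
    { pose proof (Re_le_Cmod (z - 1)) as X. apply Rabs_le_between in X. simpl in X. lra. }
    assert (Pf := corner_factor_pos z Z1 Z2). pose proof (outside_neq_0 z Z1) as N0.
    unfold model_map. rewrite corner_power_Cpower by assumption.
    rewrite <- (corner_factor_mult z N0), Cpower_mult_base by assumption.
    set (W := Cpower (corner_factor z) theta). set (Z := Cpower z theta) in *.
    change (Cmod ((- RtoC A * (W * Z)) - (- RtoC A * (z * W)))%C <= eps * Cmod (- RtoC A * (W * Z))).
    replace ((- RtoC A * (W * Z)) - (- RtoC A * (z * W)))%C with (- RtoC A * (W * (Z - z)))%C by ring.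
    rewrite !Cmod_mult.
    pose proof (Cmod_ge_0 (- RtoC A)). pose proof (Cmod_ge_0 W).
    replace (eps * (Cmod (- RtoC A) * (Cmod W * Cmod Z))) with
      (Cmod (- RtoC A) * (Cmod W * (eps * Cmod Z))) by ring.
    repeat apply Rmult_le_compat_l; auto. lra.
  - apply continuous_on_outside. intros g z. apply continuous_model_map. lra.
  - apply continuous_on_outside. intros g z. apply continuous_model_map'. lra.
  - intros M. set (c := Rpower (/ 2) theta). assert (Pc : 0 < c) by apply Rpower_pos.
    exists (Rmax 2 (M / (A * c))). intros z Hz Hz2.
    pose proof (Rmax_l 2 (M / (A * c))). pose proof (Rmax_r 2 (M / (A * c))).
    assert (Ac : 0 < A * c) by (apply Rmult_lt_0_compat; lra).
    unfold model_map. rewrite corner_power_Cpower by (auto; lra).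
    rewrite !Cmod_mult, Cmod_opp, Cmod_R, Cmod_Cpower, Rabs_pos_eq by lra.
    assert (W : / 2 <= Cmod (corner_factor z)).
    { pose proof (Cmod_minus_ge (RtoC 1) (/ z)) as X. fold (corner_factor z) in X.
      rewrite Cmod_R, Rabs_R1, Cmod_inv in X by (apply outside_neq_0; lra).
      assert (/ Cmod z <= / 2) by (apply Rinv_le_contravar; lra). lra. }
    assert (Wc : c <= Rpower (Cmod (corner_factor z)) theta) by (apply Rpower_le_l; lra).
    apply Rlt_le_trans with (A * (Cmod z * c)).
    + replace M with (A * c * (M / (A * c))) by (field; lra).
      replace (A * (Cmod z * c)) with (A * c * Cmod z) by ring. apply Rmult_lt_compat_l; lra.
    + apply Rmult_le_compat_l; [lra|]. apply Rmult_le_compat_l; lra.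
  - exists (A * (1 + theta)). apply at_corner_iff. exists 1. split; [lra|]. intros z Z1 Z2 Z3.
    pose proof (Cmod_minus_1_pos z Z2) as P.
    change (Cmod (model_map' A theta z) <= A * (1 + theta) * Rabs (Rpower (Cmod (z - 1)) (theta - 1))).
    set (r := Cmod (z - 1)) in *. assert (Pr := Rpower_pos r (theta - 1)).
    rewrite (Rabs_pos_eq (Rpower r (theta - 1))) by lra.
    unfold model_map'. rewrite Cmod_mult, Cmod_opp, Cmod_R, Rabs_pos_eq, Rmult_assoc by lra.
    apply Rmult_le_compat_l; [lra|]. eapply Rle_trans; [apply Cmod_triangle|].
    assert (B1 := Cmod_corner_power_le theta z ltac:(lra) Z1 Z2). fold r in B1.
    assert (B2 := Cmod_corner_power_le (theta - 1) z ltac:(lra) Z1 Z2). fold r in B2.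
    assert (B3 : Rpower r theta <= Rpower r (theta - 1)).
    { replace theta with (theta - 1 + 1) at 1 by ring. rewrite Rpower_plus, Rpower_1 by lra. nra. }
    assert (Iz : Cmod (/ z) <= 1).
    { rewrite Cmod_inv by now apply outside_neq_0. rewrite <- Rinv_1. apply Rinv_le_contravar; lra. }
    rewrite !Cmod_mult, Cmod_R, Rabs_pos_eq by lra.
    pose proof (Cmod_ge_0 (corner_power (theta - 1) z)). pose proof (Cmod_ge_0 (/ z)).
    assert (Cmod (corner_power (theta - 1) z) * Cmod (/ z) <= Rpower r (theta - 1) * 1)
      by (apply Rmult_le_compat; lra).
    nra.
  - intros z Hz N x Hx. apply Hav; [exact Hx | lra | exact N].
  - intros k z Hz. apply Hav; [split; [left|]; apply Hlam | lra | now apply Hne].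
Qed.

(** * The optimal rate *)

Lemma Ut_nonneg (lam : nat -> R) (tau1 : R) (Psi : C -> C) (B t : nat) :
  0 < tau1 -> (1 <= B)%nat ->
  ex_series (fun k => lam k ^ 2 * Cmod (Ucoef Psi t (lam k)) ^ 2) -> 0 <= Ut lam tau1 Psi B t.
Proof.
  intros Ht HB E. unfold Ut. apply Rmult_le_pos.
  - left. apply Rdiv_lt_0_compat; [exact Ht | apply lt_0_INR; lia].
  - apply (psum_le_Series _ 0); [|exact E]. intros k. apply Rmult_le_pos; apply pow2_ge_0.
Qed.

Lemma achievable_rate_le (lam w : nat -> R) (tau1 Lambda Q nu zeta tht : R) :
  (forall k, 0 < lam k <= lam 0%nat) -> is_lim_seq lam 0 -> 0 < tau1 -> 0 < Lambda -> 0 < Q ->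
  power_law_eigenvalues lam Lambda nu -> power_law_target lam w Q zeta -> 1 < nu -> 0 < zeta ->
  achievable_rate lam w tau1 zeta tht -> tht <= 2 /\ tht <= nu /\ tht <= 2 / (zeta + 1 / nu).
Proof.
  intros Hlam Hlim Htau HL HQ Heig Hw Hnu Hz [Psi [B [[theta [c [dPsi H]]] [HB HO]]]].
  pose proof (cm_theta _ _ _ _ _ H) as Ht.
  destruct (eigenvalue_bounds lam Lambda nu HL (fun k => proj1 (Hlam k)) Heig)
    as [c1 [c2 [Hc1 [Hc2 He]]]].
  destruct (target_bounds lam w Q zeta HQ (fun k => proj1 (Hlam k)) Hlim Hw Hz)
    as [Ea [c0 [C0 [x0 [Hc0 [HC0 [Hx0 [T1 T2]]]]]]]].
  destruct (coefficient_bounds _ _ _ _ _ H Hlam) as [K [HK HC]].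
  destruct (signal_lower lam w Psi theta K Ht HK Hlam HC zeta c0 x0 Ea Hc0 Hx0 Hz T1)
    as [c' [Hc' HV]].
  destruct (noise_lower lam Psi theta K c1 c2 nu Ht HK Hlam HC Hnu Hc1 Hc2 He)
    as [cn [eta [C3 [Hcn [Heta [HC3 HN]]]]]].
  destruct (noise_upper lam Psi theta K c1 c2 nu Ht HK Hlam HC Hnu Hc2 He) as [CU [HCU HUs]].
  assert (HB0 : 0 < INR B) by (apply lt_0_INR; lia).
  assert (Hg : 0 < tau1 / INR B) by (apply Rdiv_lt_0_compat; lra).
  apply (achieved_rate_le (Ut lam tau1 Psi B) (Vt lam w Psi) theta nu zeta tht c'
    (tau1 / INR B * cn) eta C3); auto.
  - apply Rmult_lt_0_compat; lra.
  - intros t Ht1. apply Ut_nonneg; auto. now apply HUs.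
  - intros M HM y. destruct (HN M HM) as [D [n [N1 [N2 N3]]]]. exists D, n.
    split; [exact N1|]. split; [exact N2|]. unfold Ut. rewrite psum_scal.
    unfold Rdiv in *. rewrite !Rmult_assoc in *.
    apply Rmult_le_compat_l; [lra|]. apply Rmult_le_compat_l; [left; now apply Rinv_0_lt_compat|].
    exact N3.
Qed.

(** The rate is used as the exponent of the corner map itself, which is why theta has to lie in (1,
    2). *)
Lemma achievable_rate_of_lt (lam w : nat -> R) (tau1 Lambda Q nu zeta theta : R) :
  (forall k, 0 < lam k <= lam 0%nat) -> is_lim_seq lam 0 -> 0 < tau1 -> 0 < Lambda -> 0 < Q ->
  power_law_eigenvalues lam Lambda nu -> power_law_target lam w Q zeta -> 1 < nu -> 0 < zeta ->
  1 < theta -> theta < 2 -> theta < nu -> theta < 2 / (zeta + 1 / nu) ->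
  achievable_rate lam w tau1 zeta theta.
Proof.
  intros Hlam Hlim Htau HL HQ Heig Hw Hnu Hz Ht1 Ht2 Ht3 Ht4.
  destruct (corner_map_exists lam theta (conj Ht1 Ht2) Hlam) as [Psi [dPsi [c H]]].
  pose proof (cm_theta _ _ _ _ _ H) as Ht.
  destruct (eigenvalue_bounds lam Lambda nu HL (fun k => proj1 (Hlam k)) Heig)
    as [c1 [c2 [Hc1 [Hc2 He]]]].
  destruct (target_bounds lam w Q zeta HQ (fun k => proj1 (Hlam k)) Hlim Hw Hz)
    as [Ea [c0 [C0 [x0 [Hc0 [HC0 [Hx0 [T1 T2]]]]]]]].
  destruct (coefficient_bounds _ _ _ _ _ H Hlam) as [K [HK HC]].
  assert (Inu : 0 < 1 / nu) by (apply Rdiv_lt_0_compat; lra).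
  assert (Hsum : theta * zeta + theta * (1 / nu) < 2).
  { rewrite <- Rmult_plus_distr_l. apply Rlt_le_trans with (2 / (zeta + 1 / nu) * (zeta + 1 / nu)).
    - apply Rmult_lt_compat_r; lra.
    - right. unfold Rdiv at 1. rewrite Rmult_assoc, Rinv_l; lra. }
  assert (Htn : 0 < theta * (1 / nu) < 1).
  { split; [apply Rmult_lt_0_compat; lra|]. apply Rmult_lt_reg_r with nu; [lra|].
    replace (theta * (1 / nu) * nu) with theta by (field; lra). lra. }
  destruct (signal_upper lam w Psi theta K Ht HK Hlam HC zeta C0 Ea HC0 Hz ltac:(lra) T2)
    as [CV [HCV HV]].
  destruct (noise_upper lam Psi theta K c1 c2 nu Ht HK Hlam HC Hnu Hc2 He) as [CU [HCU HUs]].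
  (* The noise decays with exponent q and the signal with exponent b. The condition theta < nu gives
     q > 1, and theta (zeta + 1/nu) < 2 gives b < q. *)
  set (q := 2 - theta * (1 / nu)). set (b := theta * zeta).
  set (Z := 2 * Rpower 2 b * (Rpower 2 q / (q - 1))).
  assert (HZ : 0 < Z).
  { unfold Z, q. repeat apply Rmult_lt_0_compat; try apply Rpower_pos; try lra.
    apply Rinv_0_lt_compat. lra. }
  (* The batch size exceeds 2 tau1 CU Z, so the noise constant tau1 CU / B times Z is at most
     1/2. *)
  destruct (nfloor_ex (2 * tau1 * CU * Z)) as [B0 [_ HB0]].
  { left. apply Rmult_lt_0_compat; [|exact HZ]. apply Rmult_lt_0_compat; lra. }
  set (B := S B0). assert (HBr : 2 * tau1 * CU * Z < INR B) by (unfold B; rewrite S_INR; lra).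
  assert (HBp : 0 < INR B) by (apply lt_0_INR; unfold B; lia).
  exists Psi, B. split; [now exists theta, c, dPsi|]. split; [unfold B; lia|].
  assert (Hbound : forall t, loss (Ut lam tau1 Psi B) (Vt lam w Psi) t <=
    CV * Rpower (INR t + 1) (- b)).
  { apply (loss_power_bound _ _ (tau1 / INR B * CU) q b CV).
    - unfold q. lra.
    - unfold q, b. split; [apply Rmult_lt_0_compat; lra | lra].
    - left. repeat apply Rmult_lt_0_compat; try lra. now apply Rinv_0_lt_compat.
    - exact HCV.
    - fold Z. apply Rmult_le_reg_l with (2 * INR B); [lra|].
      replace (2 * INR B * (tau1 / INR B * CU * Z)) with (2 * tau1 * CU * Z) by (field; lra).
      replace (2 * INR B * / 2) with (INR B) by field. lra.
    - intros t Ht0. destruct (HUs t Ht0) as [E U]. split; [apply Ut_nonneg; auto; unfold B; lia|].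
      unfold Ut. rewrite Rmult_assoc. apply Rmult_le_compat_l.
      + left. now apply Rdiv_lt_0_compat.
      + replace (- q) with (theta / nu - 2) by (unfold q; field; lra). exact U.
    - intros t Ht0. exact (HV t Ht0). }
  exists CV, 1%nat. intros t Ht0.
  change (Rabs (loss (Ut lam tau1 Psi B) (Vt lam w Psi) t) <=
    CV * Rabs (Rpower (INR t) (- b))).
  rewrite (Rabs_pos_eq (Rpower (INR t) (- b))) by (left; apply Rpower_pos).
  rewrite Rabs_pos_eq.
  - eapply Rle_trans; [apply Hbound|]. apply Rmult_le_compat_l; [lra|].
    assert (0 < INR t) by (apply lt_0_INR; lia).
    assert (0 < b) by (unfold b; apply Rmult_lt_0_compat; lra).
    apply Rpower_le_l_neg; lra.
  - apply loss_nonneg.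
    + intros s Hs. apply Ut_nonneg; auto; [unfold B; lia | now apply HUs].
    + intros s Hs. now apply HV.
Qed.

Theorem theorem4
  (E : CompleteNormedModule R_AbsRing) (ip : E -> E -> R) (H : E -> E)
  (lam : nat -> R) (e : nat -> E) (w : nat -> R)
  (tau1 Lambda Q nu zeta : R)
  (Hproblem : spectral_problem ip H lam e)
  (Htau1 : 0 < tau1) (HLambda : 0 < Lambda) (HQ : 0 < Q)
  (Hlam : power_law_eigenvalues lam Lambda nu)
  (Hw : power_law_target lam w Q zeta)
  (Hnu : 1 < nu) (Hzeta : 0 < zeta < 2 - 1 / nu) :
  theta_max lam w tau1 zeta =
    Finite (Rmin 2 (Rmin nu (2 / (zeta + 1 / nu)))).
Proof.
  assert (Hdec : forall k, 0 < lam k <= lam 0%nat).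
  { intros k. split; [apply (sp_lam_pos _ _ _ _ Hproblem)|].
    induction k as [|k IH]; [lra|].
    eapply Rle_trans; [apply (sp_lam_decr _ _ _ _ Hproblem) | exact IH]. }
  pose proof (sp_lam_lim _ _ _ _ Hproblem) as Hlim.
  assert (Inu : 0 < 1 / nu) by (apply Rdiv_lt_0_compat; lra).
  set (m := Rmin 2 (Rmin nu (2 / (zeta + 1 / nu)))).
  (* This is where zeta < 2 - 1/nu enters: it keeps the interval (1, m) of achievable rates
     nonempty. *)
  assert (Hm1 : 1 < m).
  { unfold m. repeat apply Rmin_glb_lt; try lra.
    apply Rmult_lt_reg_r with (zeta + 1 / nu); [lra|].
    unfold Rdiv at 2. rewrite Rmult_assoc, Rinv_l; lra. }
  assert (Hm : m <= 2 /\ m <= nu /\ m <= 2 / (zeta + 1 / nu)).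
  { unfold m. split; [apply Rmin_l|].
    split; (eapply Rle_trans; [apply Rmin_r|]); [apply Rmin_l | apply Rmin_r]. }
  apply is_lub_Rbar_unique. split.
  - intros t Ht. destruct (achievable_rate_le lam w tau1 Lambda Q nu zeta t) as [A1 [A2 A3]];
      auto; [lra|].
    simpl. unfold m. repeat apply Rmin_glb; assumption.
  - intros b Hb.
    assert (X : forall t, 1 < t < m -> Rbar_le t b).
    { intros t Ht. apply Hb. apply (achievable_rate_of_lt lam w tau1 Lambda Q nu zeta); auto; lra. }
    destruct b as [b| |]; simpl; auto.
    + destruct (Rle_lt_dec m b) as [L|L]; [exact L | exfalso].
      (* An achievable rate strictly between b and m; the maximum with 1 keeps it above 1. *)
      specialize (X ((Rmax 1 b + m) / 2)). simpl in X.
      pose proof (Rmax_l 1 b). pose proof (Rmax_r 1 b).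
      assert (Rmax 1 b < m) by (apply Rmax_lub_lt; lra).
      specialize (X ltac:(lra)). lra.
    + apply (X ((1 + m) / 2)). lra.
Qed.
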